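(* Let $\mathcal S_0$ be a shape such that $e^{i\pi/2}\mathcal S_0=\mathcal S_0$ (the shape is invariant under the rotation of angle $\pi/2$ and center $0$). Then, from the complex potential $\xi$ one can always deduce the values of $r$, of $w_0e^{i\alpha}$ (the translational velocity expressed in a fixed reference frame) and of $|\omega|$ (the absolute value of the rotational velocity). That is: for $j=1,2$ let $r_j,w_{0,j}\in\mathbf C$, $\alpha_j\in\mathbf R/2\pi$, $\omega_j\in\mathbf R$ with $(w_{0,j},\omega_j)\neq(0,0)$ (the solid is moving), and let $\xi_j$ be the complex potential of the solid occupying $\mathcal S_j=e^{i\alpha_j}\mathcal S_0+r_j$ and moving with rigid velocity field $\mathbf v_j(z)=i\omega_j(z-r_j)+w_{0,j}e^{i\alpha_j}$. If $\xi_1=\xi_2$ on $\{|z|>R\}$ for some $R>0$, then $r_1=r_2$, $w_{0,1}e^{i\alpha_1}=w_{0,2}e^{i\alpha_2}$ and $|\omega_1|=|\omega_2|$.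
   Context: The plane $\mathbf R^2$ is identified with $\mathbf C$. Shape: a simply connected compact set $\mathcal S_0\subset\mathbf C$ whose exterior $\mathcal F_0=\mathbf C\setminus\mathcal S_0$ is the image of $\Omega=\{|z|>1\}$ under a conformal (holomorphic, injective) map $f(z)=c_1z+\sum_{k\leq -1}c_kz^k$ with $c_1\neq 0$ and $\sum_k|c_k|<\infty$ (the constant term is normalized to $0$); thus $f$ extends continuously to $\{|z|\ge 1\}$. Complex potential: for a solid occupying $\mathcal S=e^{i\alpha}\mathcal S_0+r$ with rigid velocity field $\mathbf v(z)=i\omega(z-r)+w$, where $w=w_0e^{i\alpha}$ and $w_0$ is the translational velocity in the frame attached to the solid, it is the holomorphic function $\xi=\varphi+i\psi$ on $\mathcal F=\mathbf C\setminus\mathcal S$ with $\xi(z)\to 0$ as $|z|\to\infty$ and satisfying the slip condition $\partial_n\varphi=\mathbf v\cdot\mathbf n$ on $\partial\mathcal S$ ($\mathbf n$ the unit normal). The slip condition is understood in integrated form: the function $z\mapsto\xi(e^{i\alpha}f(z)+r)$ extends continuously to $\{|z|\geq 1\}$ and there is a real constant $C$ such that $\operatorname{Im}\xi(x)=\operatorname{Im}(\bar w x)-\frac{\omega}{2}|x-r|^2+C$ for $x=e^{i\alpha}f(z)+r$, $|z|=1$ (boundary values taken through this extension).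
   Formalization: The shape is assumed not to be a disk: for a disk, rotation about its center generates zero potential, so the absolute value of the rotational velocity (and, with no translation, also r) cannot be deduced and the claim fails. *)

(* Defs.v *)
From Stdlib Require Import Reals List.
From Coquelicot Require Import Coquelicot.

Open Scope R_scope.
Open Scope C_scope.

(* Stdlib's [compact] only concerns subsets of the real line. *)
Definition compact_set (S : C -> Prop) : Prop :=
  forall (I : Type) (U : I -> C -> Prop),
    (forall i, open (U i)) ->
    (forall z, S z -> exists i, U i z) ->
    exists l : list I, forall z, S z -> exists i, In i l /\ U i z.

Definition unit_interval (t : R) : Prop := (0 <= t <= 1)%R.

Definition path_in (S : C -> Prop) (g : R -> C) : Prop :=
  continuous_on unit_interval g /\ forall t, unit_interval t -> S (g t).

Definition path_connected (S : C -> Prop) : Prop :=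
  (exists z, S z) /\
  forall a b, S a -> S b -> exists g, path_in S g /\ g 0%R = a /\ g 1%R = b.

(* The homotopy fixes the base point of the loop. *)
Definition null_homotopic (S : C -> Prop) (g : R -> C) : Prop :=
  exists H : R * R -> C,
    continuous_on (fun p => unit_interval (fst p) /\ unit_interval (snd p)) H /\
    (forall s t, unit_interval s -> unit_interval t -> S (H (s, t))) /\
    (forall t, unit_interval t -> H (0%R, t) = g t /\ H (1%R, t) = g 0%R) /\
    (forall s, unit_interval s -> H (s, 0%R) = g 0%R /\ H (s, 1%R) = g 0%R).

Definition simply_connected (S : C -> Prop) : Prop :=
  path_connected S /\
  forall g, path_in S g -> g 0%R = g 1%R -> null_homotopic S g.

Definition holomorphic_on (D : C -> Prop) (h : C -> C) : Prop :=
  forall z, D z -> @ex_derive C_AbsRing C_NormedModule h z.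

Definition Omega (z : C) : Prop := (1 < Cmod z)%R.

Definition closed_Omega (z : C) : Prop := (1 <= Cmod z)%R.

Definition exterior (S : C -> Prop) (z : C) : Prop := ~ S z.

(* [c k] is the coefficient of z^(-(k+1)).  On the unit circle, [f] is by
   definition the sum of the series, that is, the continuous extension of the
   conformal map to the closure of [Omega]. *)
Definition laurent_map (c1 : C) (c : nat -> C) (f : C -> C) : Prop :=
  c1 <> 0 /\
  ex_series (fun k : nat => Cmod (c k)) /\
  forall z, closed_Omega z ->
    @is_series C_AbsRing C_NormedModule
      (fun k : nat => c k / z ^ S k) (f z - c1 * z).

Definition shape (S0 : C -> Prop) (f : C -> C) : Prop :=
  compact_set S0 /\
  simply_connected S0 /\
  holomorphic_on Omega f /\
  (forall z z', Omega z -> Omega z' -> f z = f z' -> z = z') /\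
  (forall x, exterior S0 x <-> exists z, Omega z /\ f z = x) /\
  exists (c1 : C) (c : nat -> C), laurent_map c1 c f.

(* The complex number e^(i a). *)
Definition Cexpi (a : R) : C := (cos a, sin a).

(* The set e^(i alpha) S + r. *)
Definition rigid_image (alpha : R) (r : C) (S : C -> Prop) (x : C) : Prop :=
  exists s, S s /\ x = Cexpi alpha * s + r.

(* A rotating disk generates the same potential whatever its angular velocity,
   so that disks are the exceptional shapes of the detection problem. *)
Definition is_disk (S : C -> Prop) : Prop :=
  exists (a : C) (rho : R), forall z, S z <-> (Cmod (z - a) <= rho)%R.

(* Slip condition in integrated form, for the velocity field
   v(x) = i omega (x - r) + w with w = w0 e^(i alpha): the function
   Im (conj w x) - omega/2 |x - r|^2 is a stream function of v.  The boundary
   values of [xi] are those of the continuous extension [g] of its pullback. *)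
Definition slip_condition (f : C -> C) (r : C) (alpha : R) (w0 : C) (omega : R)
    (xi : C -> C) : Prop :=
  exists g : C -> C,
    continuous_on closed_Omega g /\
    (forall z, Omega z -> g z = xi (Cexpi alpha * f z + r)) /\
    exists K : R, forall z, Cmod z = 1%R ->
      let x := Cexpi alpha * f z + r in
      let w := w0 * Cexpi alpha in
      Im (g z) = (Im (Cconj w * x) - omega / 2 * Cmod (x - r) ^ 2 + K)%R.

(* [xi] is a total function, but only its values on the fluid domain
   [exterior (rigid_image alpha r S0)] are constrained. *)
Definition complex_potential (S0 : C -> Prop) (f : C -> C) (r : C) (alpha : R)
    (w0 : C) (omega : R) (xi : C -> C) : Prop :=
  let F := exterior (rigid_image alpha r S0) in
  holomorphic_on F xi /\
  (forall eps : R, (0 < eps)%R -> exists M : R,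
     forall x, F x -> (M < Cmod x)%R -> (Cmod (xi x) < eps)%R) /\
  slip_condition f r alpha w0 omega xi.

(* Main.v *)
Require Import Defs.
From Stdlib Require Import Reals Lra Lia ZArith Classical ClassicalEpsilon List.
From Coquelicot Require Import Coquelicot.

(** In the frame attached to the solid the potential becomes a function [eta]
    on the exterior of [S0] whose boundary values depend only on [w0] and
    [omega], linearly.  The symmetry of [S0] lets one replace [eta u] by
    [eta (Ci * u)], which rotates [w0] and keeps [omega], and uniqueness for the
    boundary problem then forces the shape of the expansion at infinity: the
    translational part is odd, with leading term [- |c1|^2 w0 / u], while the
    rotational part is even and has no [1/u^2] term.  Hence the [1/x] term
    of [xi] gives [w0 e^(i alpha)].  Whatever the leading exponent [p] is, the next
    coefficient of [eta] vanishes, so the coefficient of [x^(-p-1)] in [xi] is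
    [p r] times that of [x^(-p)], which gives [r]; finally the modulus of the leading
    coefficient of the even part gives [|omega|].  The even part does not vanish:
    otherwise [|f|] would be constant on the unit circle and [S0] a disk.

    Uniqueness is obtained by comparing Laurent coefficients of [eta o f], which are
    circle means independent of the radius by Goursat's lemma.  Only limits at the
    unit circle enter, so [f] is never inverted; that [f] maps the circle into
    [S0] follows from the maximum modulus bound for [1 / (f - w)]. *)

(** The symmetry is a property of the set [S0], whereas the slip condition is read through [f], and
    no equivariance of [f] under the quarter turn is established. Instead the condition is restated
    as a limit that is uniform as [Cmod z] tends to 1 from above, and the quarter turn is shown to
    carry exterior points close to the boundary to exterior points close to the boundary. This is
    the reason for knowing that [f] maps the unit circle into [S0].

    The symmetry is also what removes the coefficient of [1 / z] in [f] from the dipole term, which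
    would otherwise mix [w0] with its conjugate.

    Only the modulus of [omega] is read off, because the leading rotational coefficient is
    [omega b e^(i p alpha)]: here [p] and [b] belong to the shape, and the two angles are not known
    to be related. *)

Open Scope R_scope.

(** * Complex derivatives and the exponential *)

(** Neighbourhoods in [C] come from the product structure on [R * R], whose balls are squares, while
    the estimates below use discs of [Cmod]. *)
Lemma locally_Cmod (z : C) (P : C -> Prop) :
  locally z P <->
  exists del : R, 0 < del /\ forall y : C, Cmod (y - z) < del -> P y.
Proof.
split.
- intros H.
  destruct (locally_norm_le_locally (V := C_R_NormedModule) z P H) as [e He]. exists e; split; [apply cond_pos|].
  intros y Hy. apply He. unfold ball_norm. rewrite <- Cmod_norm. exact Hy.
- intros [d [Hd H]].
  apply (locally_le_locally_norm (V := C_R_NormedModule) z P).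
  exists (mkposreal d Hd). intros y Hy. apply H.
  unfold ball_norm in Hy. rewrite <- Cmod_norm in Hy. exact Hy.
Qed.

(** [C] carries two uniform structures, that of a product and that of the ring [C_AbsRing]. Their
    agreement lets the continuity of products be borrowed from the ring structure. *)
Lemma locally_AbsRing (z : C) (P : C -> Prop) :
  @locally (AbsRing_UniformSpace C_AbsRing) z P <-> locally z P.
Proof.
split.
- intros [d Hd]. apply locally_Cmod. exists d; split; [apply cond_pos|exact Hd].
- intros H. apply locally_Cmod in H. destruct H as [d [Hd H]].
  exists (mkposreal d Hd). exact H.
Qed.

Lemma locally_R (t : R) (P : R -> Prop) :
  locally t P <->
  exists del : R, 0 < del /\ forall y : R, Rabs (y - t) < del -> P y.
Proof.
split.
- intros [e He]. exists e; split; [apply cond_pos|]. exact He.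
- intros [d [Hd H]]. exists (mkposreal d Hd). exact H.
Qed.

Lemma continuous_Cmod {U : UniformSpace} (h : U -> C) (x : U) :
  continuous h x <->
  forall eps : R, 0 < eps -> locally x (fun y => Cmod (h y - h x) < eps).
Proof.
split.
- intros H eps He. apply (H (fun v => Cmod (v - h x) < eps)).
  apply locally_Cmod. exists eps; split; auto.
- intros H P HP. apply locally_Cmod in HP. destruct HP as [d [Hd HP]].
  change (locally x (fun y => P (h y))).
  generalize (H d Hd). apply filter_imp. intros y Hy. now apply HP.
Qed.

Lemma is_derive_Cmod (h : C -> C) (z D : C) :
  @is_derive C_AbsRing C_NormedModule h z D <->
  forall eps : R, 0 < eps -> exists del : R, 0 < del /\
    forall y : C, Cmod (y - z) < del ->
      Cmod (h y - h z - (y - z) * D) <= eps * Cmod (y - z).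
Proof.
split.
- intros [_ H] eps He.
  specialize (H z (fun P HP => HP) (mkposreal eps He)).
  destruct H as [d H]. exists d; split; [apply cond_pos|].
  intros y Hy. exact (H y Hy).
- intros H. split; [apply is_linear_scal_l|].
  intros x Hx eps.
  apply (@is_filter_lim_locally_unique C_AbsRing (AbsRing_NormedModule C_AbsRing)) in Hx. rewrite <- Hx.
  destruct (H eps (cond_pos eps)) as [d [Hd H']].
  exists (mkposreal d Hd). intros y Hy. exact (H' y Hy).
Qed.

(** The product rule, and the inner map of the chain rule, are phrased with the module structure of
    a ring over itself instead of [C_NormedModule]. *)
Lemma is_derive_AbsRing (h : C -> C) (z D : C) :
  @is_derive C_AbsRing C_NormedModule h z D <->
  @is_derive C_AbsRing (AbsRing_NormedModule C_AbsRing) h z D.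
Proof. split; intros [_ H]; (split; [apply is_linear_scal_l|exact H]). Qed.

Definition cdiff (h : C -> C) (z : C) : Prop :=
  @ex_derive C_AbsRing C_NormedModule h z.

Lemma cdiff_continuous (h : C -> C) (z : C) : cdiff h z -> continuous h z.
Proof.
intros H.
assert (H' := ex_derive_continuous (K:=C_AbsRing) (V:=C_NormedModule) h z H).
intros P HP. destruct (H' P HP) as [d Hd]. apply locally_Cmod.
exists d; split; [apply cond_pos|]. intros y Hy. exact (Hd y Hy).
Qed.

Lemma cdiff_const (k z : C) : cdiff (fun _ => k) z.
Proof. exact (ex_derive_const (K:=C_AbsRing) (V:=C_NormedModule) k z). Qed.
Lemma cdiff_id (z : C) : cdiff (fun u => u) z.
Proof.
exists (RtoC 1). apply is_derive_Cmod. intros eps He. exists 1; split; [lra|].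
intros y _. assert (E : (y - z - (y - z) * 1)%C = 0%C) by ring.
rewrite E, Cmod_0. apply Rmult_le_pos; [lra|apply Cmod_ge_0].
Qed.
Lemma cdiff_plus (g h : C -> C) (z : C) :
  cdiff g z -> cdiff h z -> cdiff (fun u => g u + h u)%C z.
Proof. exact (ex_derive_plus (K:=C_AbsRing) (V:=C_NormedModule) g h z). Qed.
Lemma cdiff_minus (g h : C -> C) (z : C) :
  cdiff g z -> cdiff h z -> cdiff (fun u => g u - h u)%C z.
Proof. exact (ex_derive_minus (K:=C_AbsRing) (V:=C_NormedModule) g h z). Qed.
Lemma cdiff_mult (g h : C -> C) (z : C) :
  cdiff g z -> cdiff h z -> cdiff (fun u => g u * h u)%C z.
Proof. intros [a Ha] [b Hb]. exists (a * h z + g z * b)%C.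
apply is_derive_AbsRing in Ha. apply is_derive_AbsRing in Hb. apply is_derive_AbsRing.
exact (is_derive_mult (K:=C_AbsRing) g h z a b Ha Hb Cmult_comm).
Qed.
Lemma cdiff_comp (g h : C -> C) (z : C) :
  cdiff g (h z) -> cdiff h z -> cdiff (fun u => g (h u))%C z.
Proof. intros [a Ha] [b Hb]. exists (b * a)%C.
apply is_derive_AbsRing in Hb.
exact (is_derive_comp (K:=C_AbsRing) (V:=C_NormedModule) g h z a b Ha Hb). Qed.

Lemma cdiff_ext_loc (g h : C -> C) (z : C) :
  locally z (fun u => g u = h u) -> cdiff g z -> cdiff h z.
Proof.
intros H. apply (ex_derive_ext_loc (K:=C_AbsRing) (V:=C_NormedModule) g h z).
apply locally_Cmod in H. destruct H as [d [Hd H]].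
exists (mkposreal d Hd). intros y Hy. exact (H y Hy).
Qed.

Lemma Cmod_sub_sym (a b : C) : Cmod (a - b) = Cmod (b - a).
Proof. replace (a - b)%C with (- (b - a))%C by ring. apply Cmod_opp. Qed.

Lemma Cmod_sub_le (a b : C) : Cmod a - Cmod b <= Cmod (a - b).
Proof.
generalize (Cmod_triangle (a - b) b).
replace (a - b + b)%C with a by ring. lra.
Qed.

Lemma Cmod_minus_le (a b : C) : Cmod (a - b) <= Cmod a + Cmod b.
Proof. unfold Cminus. rewrite <- (Cmod_opp b). apply Cmod_triangle. Qed.

Lemma continuous_Cinv (z : C) : z <> 0%C -> continuous Cinv z.
Proof.
intros Hz. apply Cmod_gt_0 in Hz as Hm.
apply continuous_Cmod. intros eps He. apply locally_Cmod.
exists (Rmin (Cmod z / 2) (eps * (Cmod z) ^ 2 / 2)). split.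
{ apply Rmin_pos. lra. assert (0 < Cmod z ^ 2) by nra. nra. }
intros y Hy.
assert (H1 := Rmin_l (Cmod z / 2) (eps * (Cmod z) ^ 2 / 2)).
assert (H2 := Rmin_r (Cmod z / 2) (eps * (Cmod z) ^ 2 / 2)).
assert (H3 := Cmod_sub_le z y). rewrite Cmod_sub_sym in H3.
assert (Hy2 : Cmod z / 2 < Cmod y) by lra.
assert (Hy0 : y <> 0%C) by (apply Cmod_gt_0; lra).
replace (/ y - / z)%C with ((z - y) / (y * z))%C by (field; auto).
rewrite Cmod_div by (now apply Cmult_neq_0).
rewrite Cmod_mult, Cmod_sub_sym.
assert (H4 : Cmod z ^ 2 / 2 < Cmod y * Cmod z) by nra.
apply Rlt_div_l; [nra|].
apply Rlt_trans with (eps * (Cmod z ^ 2 / 2)); [lra|].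
now apply Rmult_lt_compat_l.
Qed.

(** The remainder is [y - z] times [- (/ y - / z) / z], so continuity of the inverse suffices. *)
Lemma cdiff_Cinv (z : C) : z <> 0%C -> cdiff Cinv z.
Proof.
intros Hz. apply Cmod_gt_0 in Hz as Hm.
exists (- / (z * z))%C. apply is_derive_Cmod. intros eps He.
assert (Hc := continuous_Cinv z Hz).
assert (Hez : 0 < eps * Cmod z) by nra.
destruct (proj1 (locally_Cmod z _) (proj1 (continuous_Cmod Cinv z) Hc (eps * Cmod z) Hez)) as [d [Hd H]].
exists (Rmin d (Cmod z)). split. now apply Rmin_pos.
intros y Hy.
assert (H1 := Rmin_l d (Cmod z)). assert (H2 := Rmin_r d (Cmod z)).
assert (H3 := Cmod_sub_le z y). rewrite Cmod_sub_sym in H3.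
assert (Hy0 : y <> 0%C) by (apply Cmod_gt_0; lra).
replace (/ y - / z - (y - z) * - / (z * z))%C with ((y - z) * (- (/ y - / z) / z))%C
  by (field; auto).
rewrite Cmod_mult, Rmult_comm. apply Rmult_le_compat_r; [apply Cmod_ge_0|].
rewrite Cmod_div, Cmod_opp by auto.
apply Rle_div_l; auto. left. apply H. lra.
Qed.

Lemma cdiff_div (g h : C -> C) (z : C) :
  cdiff g z -> cdiff h z -> h z <> 0%C -> cdiff (fun u => g u / h u)%C z.
Proof.
intros Hg Hh Hz. apply cdiff_mult; auto.
apply (cdiff_comp Cinv h); auto. now apply cdiff_Cinv.
Qed.

Lemma continuous_Cplus {U : UniformSpace} (g h : U -> C) (x : U) :
  continuous g x -> continuous h x -> continuous (fun u => g u + h u)%C x.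
Proof. exact (continuous_plus (K:=R_AbsRing) (V:=C_R_NormedModule) g h x). Qed.
Lemma continuous_Cminus {U : UniformSpace} (g h : U -> C) (x : U) :
  continuous g x -> continuous h x -> continuous (fun u => g u - h u)%C x.
Proof. exact (continuous_minus (K:=R_AbsRing) (V:=C_R_NormedModule) g h x). Qed.
Lemma continuous_Cmult {U : UniformSpace} (g h : U -> C) (x : U) :
  continuous g x -> continuous h x -> continuous (fun u => g u * h u)%C x.
Proof.
assert (E : forall k : U -> C, continuous k x <->
    @filterlim U (AbsRing_UniformSpace C_AbsRing) k (locally x)
      (@locally (AbsRing_UniformSpace C_AbsRing) (k x))).
{ intros k; split; intros H P HP; apply H.
  - exact (proj1 (locally_AbsRing (k x) P) HP).
  - exact (proj2 (locally_AbsRing (k x) P) HP). }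
intros Hg Hh. apply E in Hg. apply E in Hh. apply E.
exact (continuous_mult (K:=C_AbsRing) g h x Hg Hh).
Qed.

Lemma Cexpi_plus (a b : R) : Cexpi (a + b) = (Cexpi a * Cexpi b)%C.
Proof.
unfold Cexpi, Cmult; simpl. rewrite cos_plus, sin_plus.
apply injective_projections; simpl; ring.
Qed.

Lemma Cmod_Cexpi (a : R) : Cmod (Cexpi a) = 1.
Proof.
rewrite <- sqrt_1. unfold Cmod, Cexpi. f_equal. simpl.
generalize (sin2_cos2 a). unfold Rsqr. lra.
Qed.

Lemma Cexpi_period (n : Z) : Cexpi (IZR n * (2 * PI)) = 1%C.
Proof.
unfold Cexpi.
rewrite <- (Rplus_0_l (IZR n * (2 * PI))).
destruct n as [|p|p].
- rewrite Rmult_0_l, Rplus_0_r, cos_0, sin_0. reflexivity.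
- rewrite <- positive_nat_Z, <- INR_IZR_INZ.
  replace (0 + INR (Pos.to_nat p) * (2 * PI)) with (0 + 2 * INR (Pos.to_nat p) * PI) by ring.
  rewrite cos_period, sin_period, cos_0, sin_0. reflexivity.
- rewrite <- Pos2Z.opp_pos, opp_IZR, <- positive_nat_Z, <- INR_IZR_INZ.
  rewrite <- (cos_period _ (Pos.to_nat p)), <- (sin_period _ (Pos.to_nat p)).
  replace (0 + - INR (Pos.to_nat p) * (2 * PI) + 2 * INR (Pos.to_nat p) * PI) with 0 by ring.
  rewrite cos_0, sin_0. reflexivity.
Qed.

Definition cexp (p : C) : C := (RtoC (exp (Re p)) * Cexpi (Im p))%C.

Lemma cexp_plus (p q : C) : cexp (p + q) = (cexp p * cexp q)%C.
Proof.
unfold cexp. change (Re (p + q)) with (Re p + Re q). change (Im (p + q)) with (Im p + Im q).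
rewrite exp_plus, Cexpi_plus, RtoC_mult. ring.
Qed.

Lemma Cmod_cexp (p : C) : Cmod (cexp p) = exp (Re p).
Proof.
unfold cexp. rewrite Cmod_mult, Cmod_Cexpi, Cmod_R, Rmult_1_r.
apply Rabs_pos_eq. left; apply exp_pos.
Qed.

Lemma cexp_0 : cexp 0 = 1%C.
Proof. unfold cexp, Cexpi; simpl. rewrite exp_0, cos_0, sin_0. unfold Cmult, RtoC; simpl.
apply injective_projections; simpl; ring. Qed.

Lemma Cexpi_taylor (eps : R) : 0 < eps -> exists del, 0 < del /\
  forall t, Rabs t < del -> Cmod (Cexpi t - 1 - (0, t)) <= eps * Rabs t.
Proof.
intros He.
assert (Hs : is_derive sin 0 1). { rewrite <- cos_0. apply is_derive_Reals, derivable_pt_lim_sin. }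
assert (Hc : is_derive cos 0 0). { replace 0 with (- sin 0) at 2 by (rewrite sin_0; ring). apply is_derive_Reals, derivable_pt_lim_cos. }
apply is_derive_Reals in Hs. apply is_derive_Reals in Hc.
assert (He2 : 0 < eps / 2) by lra.
destruct (Hs _ He2) as [d1 H1]. destruct (Hc _ He2) as [d2 H2].
exists (Rmin d1 d2). split. apply Rmin_pos; apply cond_pos.
intros t Ht.
assert (L1 := Rmin_l d1 d2). assert (L2 := Rmin_r d1 d2).
destruct (Req_dec t 0) as [->|Hn].
{ unfold Cexpi. rewrite cos_0, sin_0, Rabs_R0, Rmult_0_r.
  assert (E : (((1, 0) : C) - 1 - (0, 0))%C = 0%C) by (apply injective_projections; simpl; ring).
  rewrite E, Cmod_0. lra. }
specialize (H1 t Hn ltac:(lra)). specialize (H2 t Hn ltac:(lra)).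
rewrite Rplus_0_l, sin_0 in H1. rewrite Rplus_0_l, cos_0 in H2.
assert (Ha : 0 < Rabs t) by now apply Rabs_pos_lt.
assert (H1' : Rabs (sin t - t) <= eps / 2 * Rabs t).
{ replace (sin t - t) with (((sin t - 0) / t - 1) * t) by (field; auto).
  rewrite Rabs_mult. nra. }
assert (H2' : Rabs (cos t - 1) <= eps / 2 * Rabs t).
{ replace (cos t - 1) with (((cos t - 1) / t - 0) * t) by (field; auto).
  rewrite Rabs_mult. nra. }
replace (Cexpi t - 1 - (0, t))%C with (RtoC (cos t - 1) + Ci * RtoC (sin t - t))%C
  by (unfold Cexpi; apply injective_projections; simpl; ring).
eapply Rle_trans; [apply Cmod_triangle|].
rewrite Cmod_mult, Cmod_Ci, !Cmod_R. lra.
Qed.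

Lemma exp_taylor (eps : R) : 0 < eps -> exists del, 0 < del /\
  forall t, Rabs t < del -> Rabs (exp t - 1 - t) <= eps * Rabs t.
Proof.
intros He.
destruct (derivable_pt_lim_exp_0 eps He) as [d H].
exists d. split. apply cond_pos. intros t Ht.
destruct (Req_dec t 0) as [->|Hn].
{ rewrite exp_0, Rabs_R0. replace (1 - 1 - 0) with 0 by ring. rewrite Rabs_R0. lra. }
specialize (H t Hn Ht). rewrite Rplus_0_l, exp_0 in H.
replace (exp t - 1 - t) with (((exp t - 1) / t - 1) * t) by (field; auto).
rewrite Rabs_mult. assert (0 <= Rabs t) by apply Rabs_pos. nra.
Qed.

Lemma im_le_Cmod (c : C) : Rabs (Im c) <= Cmod c.
Proof. eapply Rle_trans; [|apply Rmax_Cmod]. apply Rmax_r. Qed.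

(** The functional equation reduces the claim to the estimate [H0] at the origin. *)
Lemma cdiff_cexp (p : C) : cdiff cexp p.
Proof.
assert (H0 : forall eps, 0 < eps -> exists del, 0 < del /\ forall q, Cmod q < del ->
   Cmod (cexp q - 1 - q) <= eps * Cmod q).
{ intros eps He.
  (* The remainder is split below into three terms, each allowed [eps / 4]. The second carries the
     factor [1 + s], of modulus at most 2, hence [eps / 8]. *)
  destruct (exp_taylor (eps / 4)) as [d1 [Hd1 H1]]. lra.
  destruct (Cexpi_taylor (eps / 8)) as [d2 [Hd2 H2]]. lra.
  set (d := Rmin (Rmin d1 d2) (Rmin 1 (eps / 4))).
  assert (D1 : d <= d1) by (unfold d; eapply Rle_trans; [apply Rmin_l|apply Rmin_l]).
  assert (D2 : d <= d2) by (unfold d; eapply Rle_trans; [apply Rmin_l|apply Rmin_r]).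
  assert (D3 : d <= 1) by (unfold d; eapply Rle_trans; [apply Rmin_r|apply Rmin_l]).
  assert (D4 : d <= eps / 4) by (unfold d; eapply Rle_trans; [apply Rmin_r|apply Rmin_r]).
  exists d. split. { unfold d. repeat apply Rmin_pos; lra. }
  intros [s t] Hq.
  assert (Hs := re_le_Cmod (s, t)). assert (Ht := im_le_Cmod (s, t)). simpl in Hs, Ht.
  specialize (H1 s ltac:(lra)). specialize (H2 t ltac:(lra)).
  set (m := Cmod (s, t)) in *.
  replace (cexp (s, t) - 1 - (s, t))%C with
    (RtoC (exp s - 1 - s) * Cexpi t + (RtoC (1 + s) * (Cexpi t - 1 - (0, t)) + Ci * RtoC (s * t)))%C
    by (unfold cexp, Cexpi; apply injective_projections; simpl; ring).
  eapply Rle_trans; [apply Cmod_triangle|].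
  eapply Rle_trans; [apply Rplus_le_compat_l, Cmod_triangle|].
  rewrite !Cmod_mult, Cmod_Cexpi, Cmod_Ci, !Cmod_R, Rabs_mult.
  assert (Hs1 : Rabs (1 + s) <= 2). { eapply Rle_trans; [apply Rabs_triang|]. rewrite Rabs_R1. lra. }
  assert (P0 := Rabs_pos s). assert (P1 := Rabs_pos t). assert (P2 := Rabs_pos (1 + s)).
  assert (P3 := Cmod_ge_0 (Cexpi t - 1 - (0, t))).
  assert (A1 : Rabs (exp s - 1 - s) * 1 <= eps / 4 * m) by nra.
  assert (A2 : Rabs (1 + s) * Cmod (Cexpi t - 1 - (0, t)) <= eps / 4 * m).
  { apply Rle_trans with (2 * (eps / 8 * Rabs t)). apply Rmult_le_compat; auto. nra. }
  assert (A3 : 1 * (Rabs s * Rabs t) <= eps / 4 * m) by nra.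
  assert (0 <= m) by apply Cmod_ge_0. nra. }
exists (cexp p). apply is_derive_Cmod. intros eps He.
assert (Hp := exp_pos (Re p)).
assert (He2 : 0 < eps / exp (Re p)) by (apply Rdiv_lt_0_compat; auto).
destruct (H0 _ He2) as [d [Hd H]]. exists d. split; auto.
intros y Hy. specialize (H _ Hy).
assert (E : (cexp y - cexp p - (y - p) * cexp p = cexp p * (cexp (y - p) - 1 - (y - p)))%C).
{ replace y with (p + (y - p))%C at 1 by ring. rewrite cexp_plus. ring. }
rewrite E, Cmod_mult, Cmod_cexp.
replace (eps * Cmod (y - p)) with (exp (Re p) * (eps / exp (Re p) * Cmod (y - p))) by (field; lra).
apply Rmult_le_compat_l; lra.
Qed.

(** * Integrals over intervals and the Goursat lemma *)

Definition Cint (f : R -> C) (a b : R) : C :=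
  RInt (V := C_R_CompleteNormedModule) f a b.

Definition cont_on (f : R -> C) (a b : R) : Prop :=
  forall t, a <= t <= b -> continuous f t.

Lemma is_Cint (f : R -> C) (a b : R) : a <= b -> cont_on f a b ->
  @is_RInt C_R_NormedModule f a b (Cint f a b).
Proof.
intros Hab Hf. apply (RInt_correct (V := C_R_CompleteNormedModule)).
apply ex_RInt_continuous. intros t. rewrite Rmin_left, Rmax_right by auto. apply Hf.
Qed.

Lemma Cint_unique (f : R -> C) (a b : R) (l : C) :
  @is_RInt C_R_NormedModule f a b l -> Cint f a b = l.
Proof. exact (is_RInt_unique (V := C_R_CompleteNormedModule) f a b l). Qed.

Lemma Cint_ext (f g : R -> C) (a b : R) :
  a <= b -> (forall t, a <= t <= b -> f t = g t) -> Cint f a b = Cint g a b.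
Proof.
intros Hab H. apply (RInt_ext (V := C_R_CompleteNormedModule)).
intros t. rewrite Rmin_left, Rmax_right by auto. intros; apply H; lra.
Qed.

Lemma Cint_plus (f g : R -> C) (a b : R) : a <= b -> cont_on f a b -> cont_on g a b ->
  Cint (fun t => f t + g t)%C a b = (Cint f a b + Cint g a b)%C.
Proof.
intros Hab Hf Hg. apply Cint_unique.
apply (is_RInt_plus (V := C_R_NormedModule)); now apply is_Cint.
Qed.

(** The integral is taken in a real vector space, so linearity over complex scalars has to be
    recovered from the components. *)
Lemma is_Cint_scal (f : R -> C) (k l : C) (a b : R) :
  @is_RInt C_R_NormedModule f a b l ->
  @is_RInt C_R_NormedModule (fun t => k * f t)%C a b (k * l)%C.
Proof.
intros H.
assert (H1 := is_RInt_fct_extend_fst (U := R_NormedModule) (V := R_NormedModule) f a b l H).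
assert (H2 := is_RInt_fct_extend_snd (U := R_NormedModule) (V := R_NormedModule) f a b l H).
apply (is_RInt_fct_extend_pair (U := R_NormedModule) (V := R_NormedModule)).
- exact (is_RInt_minus (V := R_NormedModule) _ _ _ _ _ _
    (is_RInt_scal (V := R_NormedModule) _ _ _ (fst k) _ H1)
    (is_RInt_scal (V := R_NormedModule) _ _ _ (snd k) _ H2)).
- exact (is_RInt_plus (V := R_NormedModule) _ _ _ _ _ _
    (is_RInt_scal (V := R_NormedModule) _ _ _ (fst k) _ H2)
    (is_RInt_scal (V := R_NormedModule) _ _ _ (snd k) _ H1)).
Qed.

Lemma Cint_scal (f : R -> C) (k : C) (a b : R) : a <= b -> cont_on f a b ->
  Cint (fun t => k * f t)%C a b = (k * Cint f a b)%C.
Proof. intros Hab Hf. apply Cint_unique, is_Cint_scal. now apply is_Cint. Qed.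

Lemma Cint_minus (f g : R -> C) (a b : R) : a <= b -> cont_on f a b -> cont_on g a b ->
  Cint (fun t => f t - g t)%C a b = (Cint f a b - Cint g a b)%C.
Proof.
intros Hab Hf Hg. apply Cint_unique.
apply (is_RInt_minus (V := C_R_NormedModule)); now apply is_Cint.
Qed.

Lemma Cint_conj (f : R -> C) (a b : R) : a <= b -> cont_on f a b ->
  Cint (fun t => Cconj (f t)) a b = Cconj (Cint f a b).
Proof.
intros Hab Hf. apply Cint_unique. assert (H := is_Cint f a b Hab Hf).
assert (H1 := is_RInt_fct_extend_fst (U := R_NormedModule) (V := R_NormedModule) f a b _ H).
assert (H2 := is_RInt_fct_extend_snd (U := R_NormedModule) (V := R_NormedModule) f a b _ H).
apply (is_RInt_fct_extend_pair (U := R_NormedModule) (V := R_NormedModule)).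
- exact H1.
- exact (is_RInt_opp (V := R_NormedModule) _ _ _ _ H2).
Qed.

Lemma Cint_Chasles (f : R -> C) (a b c : R) : a <= b -> b <= c -> cont_on f a c ->
  Cint f a c = (Cint f a b + Cint f b c)%C.
Proof.
intros Hab Hbc Hf. apply Cint_unique.
apply (is_RInt_Chasles (V := C_R_NormedModule) f a b c);
  apply is_Cint; auto; intros t Ht; apply Hf; lra.
Qed.

Lemma Cint_const (k : C) (a b : R) : Cint (fun _ => k) a b = (RtoC (b - a) * k)%C.
Proof.
apply Cint_unique.
assert (E : (RtoC (b - a) * k)%C = @scal R_AbsRing C_R_NormedModule (b - a) k).
{ apply injective_projections; simpl; unfold scal; simpl; unfold mult; simpl; ring. }
rewrite E. apply (is_RInt_const (V := C_R_NormedModule)).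
Qed.

Lemma Cint_bound (f : R -> C) (a b M : R) : a <= b -> cont_on f a b ->
  (forall t, a <= t <= b -> Cmod (f t) <= M) -> Cmod (Cint f a b) <= (b - a) * M.
Proof.
intros Hab Hf HM. rewrite Cmod_norm.
apply (norm_RInt_le_const (V := C_R_NormedModule) f); auto.
- intros t Ht. rewrite <- Cmod_norm. auto.
- now apply is_Cint.
Qed.

Lemma Cint_id (a b : R) : Cint (fun t => RtoC t) a b = RtoC ((b ^ 2 - a ^ 2) / 2).
Proof.
apply Cint_unique.
apply (is_RInt_fct_extend_pair (U := R_NormedModule) (V := R_NormedModule)); simpl.
- replace ((b * (b * 1) - a * (a * 1)) / 2) with (minus (b ^ 2 / 2) (a ^ 2 / 2))
    by (unfold minus, plus, opp; simpl; field).
  apply (is_RInt_derive (V := R_CompleteNormedModule) (fun t => t ^ 2 / 2)).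
  + intros t _. auto_derive; auto. simpl; field.
  + intros t _. apply continuous_id.
- assert (Q := is_RInt_const (V := R_NormedModule) a b 0).
  change (is_RInt (V := R_NormedModule) (fun _ => 0) a b ((b - a) * 0)) in Q.
  rewrite Rmult_0_r in Q. exact Q.
Qed.

Lemma continuous_pair_l (s t : R) : continuous (fun y : R => (s, y) : C) t.
Proof.
apply continuous_Cmod. intros eps He. apply locally_R. exists eps; split; auto.
intros y Hy. assert (E : ((s, y) - (s, t))%C = (Ci * RtoC (y - t))%C)
  by (apply injective_projections; simpl; ring).
rewrite E, Cmod_mult, Cmod_Ci, Cmod_R. lra.
Qed.

Lemma continuous_pair_r (s t : R) : continuous (fun x : R => (x, t) : C) s.
Proof.
apply continuous_Cmod. intros eps He. apply locally_R. exists eps; split; auto.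
intros y Hy. assert (E : ((y, t) - (s, t))%C = RtoC (y - s))
  by (apply injective_projections; simpl; ring).
rewrite E, Cmod_R. lra.
Qed.

(** The counterclockwise contour integral of [H] divided by [Ci], so that the vertical sides, which
    [cexp] turns into circles, enter without a factor. *)
Definition rect_int (H : C -> C) (a b c d : R) : C :=
  (Cint (fun t => H (b, t)) c d - Cint (fun t => H (a, t)) c d
   + Ci * (Cint (fun s => H (s, d)) a b - Cint (fun s => H (s, c)) a b))%C.

Definition cont_rect (H : C -> C) (a b c d : R) : Prop :=
  forall s t, a <= s <= b -> c <= t <= d -> continuous H (s, t).

Lemma cont_rect_v H a b c d s : cont_rect H a b c d -> a <= s <= b ->
  cont_on (fun t => H (s, t)) c d.
Proof.
intros HH Hs t Ht. apply (continuous_comp (fun t => (s, t) : C) H).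
apply continuous_pair_l. now apply HH.
Qed.

Lemma cont_rect_h H a b c d t : cont_rect H a b c d -> c <= t <= d ->
  cont_on (fun s => H (s, t)) a b.
Proof.
intros HH Hs s Ht. apply (continuous_comp (fun s => (s, t) : C) H).
apply continuous_pair_r. now apply HH.
Qed.

Lemma cont_rect_sub H a b c d a' b' c' d' : cont_rect H a b c d ->
  a <= a' -> b' <= b -> c <= c' -> d' <= d -> cont_rect H a' b' c' d'.
Proof. intros HH ? ? ? ? s t Hs Ht. apply HH; lra. Qed.

Lemma rect_int_split H a m b c n d : a <= m <= b -> c <= n <= d -> cont_rect H a b c d ->
  rect_int H a b c d =
  (rect_int H a m c n + rect_int H m b c n + rect_int H a m n d + rect_int H m b n d)%C.
Proof.
intros Hm Hn HH. unfold rect_int.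
rewrite (Cint_Chasles (fun t => H (b, t)) c n d), (Cint_Chasles (fun t => H (a, t)) c n d),
  (Cint_Chasles (fun s => H (s, d)) a m b), (Cint_Chasles (fun s => H (s, c)) a m b);
  try lra; try (eapply cont_rect_v; eauto; lra); try (eapply cont_rect_h; eauto; lra).
ring.
Qed.

Lemma rect_int_affine (k D : C) (a b c d : R) : a <= b -> c <= d ->
  rect_int (fun p => k + D * p)%C a b c d = 0%C.
Proof.
intros Hab Hcd. unfold rect_int.
assert (V : forall x, Cint (fun t => k + D * (x, t))%C c d
   = (RtoC (d - c) * (k + D * RtoC x) + D * Ci * RtoC ((d ^ 2 - c ^ 2) / 2))%C).
{ intros x. rewrite <- Cint_id.
  rewrite (Cint_ext _ (fun t => (k + D * RtoC x) + (D * Ci) * RtoC t)%C); auto.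
  - rewrite Cint_plus, Cint_const, Cint_scal; auto.
    + intros t _. apply (continuous_pair_r t 0).
    + intros t _. apply continuous_const.
    + intros t _. apply continuous_Cmult; [apply continuous_const|apply (continuous_pair_r t 0)].
  - intros t _. apply injective_projections; simpl; ring. }
assert (W : forall y, Cint (fun s => k + D * (s, y))%C a b
   = (RtoC (b - a) * (k + D * Ci * RtoC y) + D * RtoC ((b ^ 2 - a ^ 2) / 2))%C).
{ intros y. rewrite <- Cint_id.
  rewrite (Cint_ext _ (fun t => (k + D * Ci * RtoC y) + D * RtoC t)%C); auto.
  - rewrite Cint_plus, Cint_const, Cint_scal; auto.
    + intros t _. apply (continuous_pair_r t 0).
    + intros t _. apply continuous_const.
    + intros t _. apply continuous_Cmult; [apply continuous_const|apply (continuous_pair_r t 0)].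
  - intros t _. apply injective_projections; simpl; ring. }
rewrite !V, !W, !RtoC_minus.
assert (E : (Ci * Ci = RtoC (-1))%C) by (apply injective_projections; simpl; ring).
(* What remains is [D] times the area, once with the factor 1 and once with [Ci * Ci]. *)
transitivity (D * (RtoC d - RtoC c) * (RtoC b - RtoC a) * (1 + Ci * Ci))%C; [ring|].
rewrite E. apply injective_projections; simpl; ring.
Qed.

Lemma rect_int_bound H a b c d M : a <= b -> c <= d -> cont_rect H a b c d ->
  (forall s t, a <= s <= b -> c <= t <= d -> Cmod (H (s, t)) <= M) ->
  Cmod (rect_int H a b c d) <= 2 * ((b - a) + (d - c)) * M.
Proof.
intros Hab Hcd HH HM. unfold rect_int.
eapply Rle_trans; [apply Cmod_triangle|]. rewrite Cmod_mult, Cmod_Ci.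
assert (V : forall s, a <= s <= b -> Cmod (Cint (fun t => H (s, t)) c d) <= (d - c) * M).
{ intros s Hs. apply Cint_bound; auto. eapply cont_rect_v; eauto. }
assert (W : forall t, c <= t <= d -> Cmod (Cint (fun s => H (s, t)) a b) <= (b - a) * M).
{ intros s Hs. apply Cint_bound; auto. eapply cont_rect_h; eauto. }
assert (V1 := V a ltac:(lra)). assert (V2 := V b ltac:(lra)).
assert (W1 := W c ltac:(lra)). assert (W2 := W d ltac:(lra)).
assert (X1 := Cmod_minus_le (Cint (fun t => H (b, t)) c d) (Cint (fun t => H (a, t)) c d)).
assert (X2 := Cmod_minus_le (Cint (fun t => H (t, d)) a b) (Cint (fun t => H (t, c)) a b)).
lra.
Qed.

Lemma rect_int_plus G H a b c d : a <= b -> c <= d ->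
  cont_rect G a b c d -> cont_rect H a b c d ->
  rect_int (fun p => G p + H p)%C a b c d = (rect_int G a b c d + rect_int H a b c d)%C.
Proof.
intros Hab Hcd HG HH. unfold rect_int.
rewrite !Cint_plus; auto; try (eapply cont_rect_v; eauto; lra); try (eapply cont_rect_h; eauto; lra).
ring.
Qed.

Lemma rect_int_ext G H a b c d : a <= b -> c <= d ->
  (forall s t, a <= s <= b -> c <= t <= d -> G (s, t) = H (s, t)) ->
  rect_int G a b c d = rect_int H a b c d.
Proof.
intros Hab Hcd E. unfold rect_int.
rewrite (Cint_ext (fun t => G (b, t)) (fun t => H (b, t))),
 (Cint_ext (fun t => G (a, t)) (fun t => H (a, t))),
 (Cint_ext (fun s => G (s, d)) (fun s => H (s, d))),
 (Cint_ext (fun s => G (s, c)) (fun s => H (s, c))); auto; intros; apply E; lra.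
Qed.

(** The affine part integrates to zero, so only the distance of [H] to it counts, along a perimeter
    of length [2 * (L + M)]. *)
Lemma rect_int_small H a c L M D k E0 : 0 <= L -> 0 <= M ->
  cont_rect H a (a + L) c (c + M) ->
  (forall s t, a <= s <= a + L -> c <= t <= c + M ->
     Cmod (H (s, t) - (k + D * (s, t))) <= E0) ->
  Cmod (rect_int H a (a + L) c (c + M)) <= 2 * (L + M) * E0.
Proof.
intros HL HM HH HE.
assert (HA : cont_rect (fun p => k + D * p)%C a (a + L) c (c + M)).
{ intros s t _ _. apply continuous_Cplus; [apply continuous_const|].
  apply continuous_Cmult; [apply continuous_const|apply continuous_id]. }
assert (HD : cont_rect (fun p => H p - (k + D * p))%C a (a + L) c (c + M)).
{ intros s t Hs Ht. apply continuous_Cminus; [now apply HH|now apply HA]. }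
rewrite (rect_int_ext H (fun p => (k + D * p) + (H p - (k + D * p)))%C) by
  (try lra; intros; ring).
rewrite rect_int_plus, rect_int_affine by (auto; lra).
replace (0 + rect_int (fun p => H p - (k + D * p)) a (a + L) c (c + M))%C with
  (rect_int (fun p => H p - (k + D * p)) a (a + L) c (c + M))%C by ring.
eapply Rle_trans; [apply (rect_int_bound _ _ _ _ _ E0); auto; lra|]. right; ring.
Qed.

(** The left ends [u n] increase and the right ends [u n + L / 2 ^ n] decrease, so the supremum of
    the left ends lies in every interval. *)
Lemma nested_halving (u : nat -> R) (L : R) : 0 <= L ->
  (forall n, u n <= u (S n) <= u n + L / 2 ^ S n) ->
  exists l, forall n, u n <= l <= u n + L / 2 ^ n.
Proof.
intros HL Hu.
assert (Hp : forall n, 0 < 2 ^ n) by (intros; apply pow_lt; lra).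
assert (Hh : forall n, L / 2 ^ n = L / 2 ^ S n + L / 2 ^ S n).
{ intros n. simpl. field. generalize (Hp n). lra. }
assert (H1 : forall n k, u n <= u (k + n)%nat).
{ intros n k. induction k; simpl; [lra|]. generalize (Hu (k + n)%nat). lra. }
assert (H2 : forall n k, u (k + n)%nat + L / 2 ^ (k + n) <= u n + L / 2 ^ n).
{ intros n k. induction k. simpl; lra.
  generalize (Hu (k + n)%nat) (Hh (k + n)%nat). change (S k + n)%nat with (S (k + n)). lra. }
assert (H3 : forall n m, u m <= u n + L / 2 ^ n).
{ intros n m.
  assert (P : forall k, 0 <= L / 2 ^ k) by (intros; apply Rdiv_le_0_compat; auto).
  destruct (Nat.le_ge_cases n m) as [Hle|Hle].
  - replace m with (m - n + n)%nat by lia. generalize (H2 n (m - n)%nat) (P (m - n + n)%nat). lra.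
  - generalize (H1 m (n - m)%nat) (P n). replace (n - m + m)%nat with n by lia. lra. }
destruct (completeness (fun x => exists n, x = u n)) as [l [Hl1 Hl2]].
- exists (u 0%nat + L / 2 ^ 0). intros x [n ->]. apply H3.
- exists (u 0%nat), 0%nat. reflexivity.
- exists l. intros n. split.
  + apply Hl1. now exists n.
  + apply Hl2. intros x [m ->]. apply H3.
Qed.

Section Goursat.
Variables (H : C -> C) (a c L M : R).
Hypothesis HL : 0 <= L.
Hypothesis HM : 0 <= M.
Hypothesis Hd : forall s t, a <= s <= a + L -> c <= t <= c + M -> cdiff H (s, t).

Let cell (p : C) (n : nat) : C :=
  rect_int H (fst p) (fst p + L / 2 ^ n) (snd p) (snd p + M / 2 ^ n).

(** Selects the first quarter whose integral is large. The fourth quarter is the default; that its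
    integral is then large follows by additivity, in [Hbad]. *)
Let step (eps : R) (n : nat) (p : C) : C :=
  let x := fst p in let y := snd p in
  let l := L / 2 ^ S n in let m := M / 2 ^ S n in
  let small q := Rle_dec (Cmod (cell q (S n))) (eps / 4 ^ S n) in
  if small (x, y) then if small (x + l, y) then if small (x, y + m) then (x + l, y + m)
  else (x, y + m) else (x + l, y) else (x, y).

Let seq (eps : R) : nat -> C := fix seq n :=
  match n with 0%nat => (a, c) | S n => step eps n (seq n) end.

Lemma goursat : rect_int H a (a + L) c (c + M) = 0%C.
Proof.
assert (Hp : forall n, 0 < 2 ^ n) by (intros; apply pow_lt; lra).
assert (Hp4 : forall n, 0 < 4 ^ n) by (intros; apply pow_lt; lra).
assert (Hq : forall K n, 0 <= K -> 0 <= K / 2 ^ n) by (intros; now apply Rdiv_le_0_compat).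
assert (Hh : forall K n, K / 2 ^ n = K / 2 ^ S n + K / 2 ^ S n).
{ intros K n. simpl. field. generalize (Hp n). lra. }
assert (HC : cont_rect H a (a + L) c (c + M)).
{ intros s t Hs Ht. now apply cdiff_continuous, Hd. }
apply NNPP. intros Hne. apply Cmod_gt_0 in Hne.
(* Half the modulus, so that the strict inequality [Hbad] holds for the initial rectangle. *)
set (eps := Cmod (rect_int H a (a + L) c (c + M)) / 2).
set (p := seq eps).
assert (Hin : forall n, a <= fst (p n) /\ fst (p n) + L / 2 ^ n <= a + L /\
  c <= snd (p n) /\ snd (p n) + M / 2 ^ n <= c + M).
{ induction n; [simpl; lra|].
  assert (HLn := Hh L n). assert (HMn := Hh M n).
  assert (HL1 := Hq L (S n) HL). assert (HM1 := Hq M (S n) HM).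
  change (p (S n)) with (step eps n (p n)). unfold step.
  destruct (Rle_dec _ _); [destruct (Rle_dec _ _); [destruct (Rle_dec _ _)|]|];
  cbn [fst snd]; lra. }
assert (Hbad : forall n, eps / 4 ^ n < Cmod (cell (p n) n)).
{ induction n.
  - unfold cell; simpl. replace (L / 1) with L by field. replace (M / 1) with M by field.
    unfold eps. lra.
  - change (p (S n)) with (step eps n (p n)). unfold step.
    destruct (Rle_dec _ _) as [h1|h1]; [destruct (Rle_dec _ _) as [h2|h2];
      [destruct (Rle_dec _ _) as [h3|h3]|]|]; try (now apply Rnot_le_lt).
    apply Rnot_le_lt. intros h4. apply Rlt_not_le in IHn. apply IHn.
    assert (HLn := Hh L n). assert (HMn := Hh M n).
    assert (HL1 := Hq L (S n) HL). assert (HM1 := Hq M (S n) HM).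
    destruct (Hin n) as [I1 [I2 [I3 I4]]].
    unfold cell in *. cbn [fst snd] in h1, h2, h3, h4.
    rewrite (rect_int_split H _ (fst (p n) + L / 2 ^ S n) _ _ (snd (p n) + M / 2 ^ S n) _);
      [|lra|lra|].
    + replace (eps / 4 ^ n) with (4 * (eps / 4 ^ S n)) by (simpl; field; generalize (Hp4 n); lra).
      rewrite HLn, HMn, <- !Rplus_assoc.
      eapply Rle_trans; [apply Cmod_triangle|].
      eapply Rle_trans; [apply Rplus_le_compat_r, Cmod_triangle|].
      eapply Rle_trans; [apply Rplus_le_compat_r, Rplus_le_compat_r, Cmod_triangle|].
      lra.
    + eapply cont_rect_sub; eauto. }
assert (Hstep : forall n, fst (p n) <= fst (p (S n)) <= fst (p n) + L / 2 ^ S n /\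
   snd (p n) <= snd (p (S n)) <= snd (p n) + M / 2 ^ S n).
{ intros n. assert (HL1 := Hq L (S n) HL). assert (HM1 := Hq M (S n) HM).
  change (p (S n)) with (step eps n (p n)). unfold step.
  destruct (Rle_dec _ _); [destruct (Rle_dec _ _); [destruct (Rle_dec _ _)|]|]; cbn [fst snd]; lra. }
destruct (nested_halving (fun n => fst (p n)) L HL (fun n => proj1 (Hstep n))) as [x Hx].
destruct (nested_halving (fun n => snd (p n)) M HM (fun n => proj2 (Hstep n))) as [y Hy].
assert (Hxy : cdiff H (x, y)).
{ apply Hd.
  - specialize (Hx 0%nat). simpl in Hx. lra.
  - specialize (Hy 0%nat). simpl in Hy. lra. }
destruct Hxy as [D HD].
assert (Heps : 0 < eps) by (unfold eps; lra).
(* Near the limit point the integral over a cell is at most [2 * (L + M) ^ 2 * (eps / K) / 4 ^ n].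
   Adding 1 keeps [K] positive and puts this bound below [eps / 4 ^ n]. *)
set (K := 2 * (L + M) ^ 2 + 1).
assert (HK : 0 < K) by (unfold K; nra).
destruct (proj1 (is_derive_Cmod H (x, y) D) HD (eps / K)) as [d [Hd0 HD']].
{ now apply Rdiv_lt_0_compat. }
assert (Hn : exists n, (L + M) / 2 ^ n < d).
{ destruct (Pow_x_infinity 2 ltac:(rewrite Rabs_pos_eq; lra) ((L + M) / d + 1)) as [n Hn].
  exists n. specialize (Hn n (Nat.le_refl n)). rewrite Rabs_pos_eq in Hn by (left; apply Hp).
  apply Rlt_div_l; [apply Hp|]. rewrite Rmult_comm. apply Rlt_div_l; auto. lra. }
destruct Hn as [n Hn].
destruct (Hin n) as [I1 [I2 [I3 I4]]].
assert (HLn := Hq L n HL). assert (HMn := Hq M n HM).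
assert (ELM : (L + M) / 2 ^ n = L / 2 ^ n + M / 2 ^ n) by (field; generalize (Hp n); lra).
assert (Hsmall : Cmod (cell (p n) n) <= 2 * (L / 2 ^ n + M / 2 ^ n) * (eps / K * ((L + M) / 2 ^ n))).
{ unfold cell. apply (rect_int_small _ _ _ _ _ D (H (x, y) - D * (x, y))%C); auto.
  - eapply cont_rect_sub; eauto.
  - intros s t Hs Ht.
    assert (Hdist : Cmod ((s, t) - (x, y)) <= (L + M) / 2 ^ n).
    { assert (E : ((s, t) - (x, y))%C = (RtoC (s - x) + Ci * RtoC (t - y))%C)
        by (apply injective_projections; simpl; ring).
      rewrite E. eapply Rle_trans; [apply Cmod_triangle|].
      rewrite Cmod_mult, Cmod_Ci, !Cmod_R, ELM, Rmult_1_l.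
      specialize (Hx n). specialize (Hy n). simpl in Hx, Hy.
      apply Rplus_le_compat; apply Rabs_le; lra. }
    assert (E : (H (s, t) - (H (x, y) - D * (x, y) + D * (s, t)) =
       H (s, t) - H (x, y) - ((s, t) - (x, y)) * D)%C) by ring.
    rewrite E. eapply Rle_trans; [apply HD'; lra|].
    apply Rmult_le_compat_l; auto. left; now apply Rdiv_lt_0_compat. }
specialize (Hbad n). rewrite <- ELM in Hsmall.
assert (E4 : 4 ^ n = 2 ^ n * 2 ^ n) by (rewrite <- Rpow_mult_distr; f_equal; lra).
assert (Efin : 2 * ((L + M) / 2 ^ n) * (eps / K * ((L + M) / 2 ^ n)) =
   eps / 4 ^ n * ((K - 1) / K)).
{ rewrite E4. unfold K. field. split. unfold K in HK; lra. generalize (Hp n); lra. }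
rewrite Efin in Hsmall.
assert ((K - 1) / K < 1) by (apply Rlt_div_l; lra).
assert (0 < eps / 4 ^ n) by (apply Rdiv_lt_0_compat; auto).
nra.
Qed.
End Goursat.

(** * Laurent coefficients as circle means *)

Lemma exp_le_exp (x y : R) : x <= y -> exp x <= exp y.
Proof. intros [h| ->]; [left; now apply exp_increasing|lra]. Qed.

Lemma exp_le_inv (x y : R) : exp x <= exp y -> x <= y.
Proof.
intros H. apply Rnot_lt_le. intros h. apply exp_increasing in h. lra.
Qed.

(** Compactness of rectangles in the form used below: a local property that survives the shrinking
    of its parameter holds with a single parameter. A degenerate rectangle, with [a = b], serves for
    circles. *)
Lemma compact_rect (Q : R -> R -> R -> Prop) (a b c d : R) :
  (forall e e' s t, 0 < e' <= e -> Q e s t -> Q e' s t) ->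
  (forall s t, a <= s <= b -> c <= t <= d -> exists e, 0 < e /\
     forall s' t', Rabs (s' - s) < e -> Rabs (t' - t) < e -> Q e s' t') ->
  exists e, 0 < e /\ forall s t, a <= s <= b -> c <= t <= d -> Q e s t.
Proof.
intros Hanti Hloc.
assert (Hex : forall s t, exists e : posreal, a <= s <= b -> c <= t <= d ->
   forall s' t', Rabs (s' - s) < e -> Rabs (t' - t) < e -> Q e s' t').
{ intros s t. destruct (classic (a <= s <= b /\ c <= t <= d)) as [[h1 h2]|h].
  - destruct (Hloc s t h1 h2) as [e [He H]]. exists (mkposreal e He). intros _ _. exact H.
  - exists (mkposreal 1 Rlt_0_1). tauto. }
set (f := fun s t => proj1_sig (constructive_indefinite_description _ (Hex s t))).
assert (Hf : forall s t, a <= s <= b -> c <= t <= d ->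
   forall s' t', Rabs (s' - s) < f s t -> Rabs (t' - t) < f s t -> Q (f s t) s' t').
{ intros s t. exact (proj2_sig (constructive_indefinite_description _ (Hex s t))). }
destruct (compactness_value_2d a b c d f) as [e He].
exists e. split; [apply cond_pos|]. intros s t Hs Ht.
apply NNPP. intros Hn. apply (He s t Hs Ht). intros [u [v [Hu [Hv [H1 [H2 H3]]]]]].
apply Hn. apply (Hanti (f u v)); [split; [apply cond_pos|auto]|].
apply Hf; auto.
Qed.

Lemma cexp_log_polar (u : C) : u <> 0%C ->
  exists t, 0 <= t <= 2 * PI /\ u = cexp (ln (Cmod u), t).
Proof.
intros Hu. apply Cmod_gt_0 in Hu.
assert (Hm : (fst u / Cmod u)² + (snd u / Cmod u)² = 1).
{ assert (Hs : Cmod u ^ 2 = fst u ^ 2 + snd u ^ 2) by apply Cmod2_alt.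
  unfold Rsqr. field_simplify; [|lra]. rewrite <- Hs. field. lra. }
assert (Hpi := PI_RGT_0).
set (x := fst u / Cmod u) in *. set (y := snd u / Cmod u) in *.
assert (Hx : -1 <= x <= 1) by (unfold Rsqr in Hm; nra).
assert (Hsin : sin (acos x) = Rabs y).
{ rewrite sin_acos by auto. replace (1 - x²) with (y²) by lra. apply sqrt_Rsqr_abs. }
assert (Hb := acos_bound x).
assert (Hcos : cos (acos x) = x) by (apply cos_acos; auto).
assert (Hgoal : exists t, 0 <= t <= 2 * PI /\ cos t = x /\ sin t = y).
{ destruct (Rle_dec 0 y) as [h|h].
  - exists (acos x). rewrite Rabs_pos_eq in Hsin by auto. split; [lra|auto].
  - exists (2 * PI - acos x). rewrite Rabs_left in Hsin by lra. split; [lra|].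
    rewrite cos_minus, sin_minus, cos_2PI, sin_2PI. split; lra. }
destruct Hgoal as [t [Ht [Hc Hs]]]. exists t. split; auto.
unfold cexp, Cexpi; simpl. rewrite exp_ln by auto. rewrite Hc, Hs.
apply injective_projections; simpl; unfold x, y; field; lra.
Qed.

Lemma cexp_int_period (n : Z) (s : R) : cexp (RtoC (IZR n) * (s, (2 * PI)%R)) = cexp (RtoC (IZR n) * (s, 0%R)).
Proof.
assert (E : (RtoC (IZR n) * (s, (2 * PI)%R))%C = (RtoC (IZR n) * (s, 0%R) + (0%R, (IZR n * (2 * PI))%R))%C)
  by (apply injective_projections; simpl; ring).
rewrite E, cexp_plus. unfold cexp at 2. simpl. rewrite exp_0, Cexpi_period. ring.
Qed.

Lemma cexp_period (s : R) : cexp (s, (2 * PI)%R) = cexp (s, 0%R).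
Proof. generalize (cexp_int_period 1 s). now rewrite !Cmult_1_l. Qed.

(** The form [h u * u ^ n du / u] pulled back by [cexp]: circles become vertical segments and annuli
    become rectangles, to which [goursat] applies. *)
Definition lint (h : C -> C) (n : Z) (p : C) : C :=
  (h (cexp p) * cexp (RtoC (IZR n) * p))%C.

(* The coefficient of [u ^ (- n)] of [h]: the mean of [h u * u ^ n] over the
   circle of radius [exp s]. *)
Definition lcoef (h : C -> C) (n : Z) (s : R) : C :=
  (RtoC (/ (2 * PI)) * Cint (fun t => lint h n (s, t)) 0 (2 * PI))%C.

Lemma two_PI_pos : 0 < 2 * PI.
Proof. generalize PI_RGT_0. lra. Qed.
Lemma two_PI_ge0 : 0 <= 2 * PI.
Proof. left. apply two_PI_pos. Qed.
#[local] Hint Resolve two_PI_pos two_PI_ge0 : core.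

Lemma cdiff_lint h n p : cdiff h (cexp p) -> cdiff (lint h n) p.
Proof.
intros H. apply cdiff_mult.
- apply cdiff_comp; auto. apply cdiff_cexp.
- apply (cdiff_comp cexp (fun p => RtoC (IZR n) * p)%C); [apply cdiff_cexp|].
  apply cdiff_mult; [apply cdiff_const|apply cdiff_id].
Qed.

Lemma continuous_lint h n p : continuous h (cexp p) -> continuous (lint h n) p.
Proof.
intros H. apply continuous_Cmult.
- apply (continuous_comp cexp h); auto. apply cdiff_continuous, cdiff_cexp.
- apply cdiff_continuous.
  apply (cdiff_comp cexp (fun p => RtoC (IZR n) * p)%C); [apply cdiff_cexp|].
  apply cdiff_mult; [apply cdiff_const|apply cdiff_id].
Qed.

Definition cont_circle (h : C -> C) (s : R) : Prop :=
  forall u, Cmod u = exp s -> continuous h u.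

Lemma cont_on_lint h n s a b : cont_circle h s -> cont_on (fun t => lint h n (s, t)) a b.
Proof.
intros H t _. apply (continuous_comp (fun t => (s, t) : C) (lint h n)).
- apply continuous_pair_l.
- apply continuous_lint. apply H. apply Cmod_cexp.
Qed.

(** [goursat] is applied to the rectangle that [cexp] wraps onto the annulus; the two horizontal
    sides cancel by periodicity. *)
Lemma lcoef_const h n s1 s2 : s1 <= s2 ->
  (forall u, exp s1 <= Cmod u <= exp s2 -> cdiff h u) -> lcoef h n s1 = lcoef h n s2.
Proof.
intros Hs H. unfold lcoef. f_equal.
assert (G := goursat (lint h n) s1 0 (s2 - s1) (2 * PI) ltac:(lra) two_PI_ge0).
replace (s1 + (s2 - s1)) with s2 in G by ring. rewrite Rplus_0_l in G.
assert (G' : rect_int (lint h n) s1 s2 0 (2 * PI) = 0%C).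
{ apply G. intros s t h1 _. apply cdiff_lint. apply H. rewrite Cmod_cexp. simpl.
  split; apply exp_le_exp; lra. }
unfold rect_int in G'.
rewrite (Cint_ext (fun s => lint h n (s, 2 * PI)) (fun s => lint h n (s, 0))) in G'; auto.
- set (A := Cint (fun t => lint h n (s1, t)) 0 (2 * PI)) in *.
  set (B := Cint (fun t => lint h n (s2, t)) 0 (2 * PI)) in *.
  assert (E : (B - A = 0)%C) by (rewrite <- G'; ring).
  replace B with (B - A + A)%C by ring. rewrite E. ring.
- intros s _. unfold lint. rewrite cexp_period, cexp_int_period. reflexivity.
Qed.

Lemma Cmod_cexp_int (n : Z) (s t : R) : Cmod (cexp (RtoC (IZR n) * (s, t))) = exp (IZR n * s).
Proof. rewrite Cmod_cexp. f_equal. simpl. ring. Qed.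

Lemma lcoef_bound h n s M : cont_circle h s ->
  (forall u, Cmod u = exp s -> Cmod (h u) <= M) ->
  Cmod (lcoef h n s) <= exp (IZR n * s) * M.
Proof.
intros Hc HM. unfold lcoef. rewrite Cmod_mult, Cmod_R.
assert (Hpi := two_PI_pos).
rewrite Rabs_pos_eq by (left; now apply Rinv_0_lt_compat).
assert (B := Cint_bound (fun t => lint h n (s, t)) 0 (2 * PI) (exp (IZR n * s) * M)
  two_PI_ge0 (cont_on_lint h n s _ _ Hc)).
assert (B' : Cmod (Cint (fun t => lint h n (s, t)) 0 (2 * PI)) <= (2 * PI - 0) * (exp (IZR n * s) * M)).
{ apply B. intros t _. unfold lint. rewrite Cmod_mult, Cmod_cexp_int, Rmult_comm.
  apply Rmult_le_compat_l; [left; apply exp_pos|]. apply HM. apply Cmod_cexp. }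
apply Rmult_le_reg_l with (2 * PI); auto.
rewrite <- Rmult_assoc, Rinv_r, Rmult_1_l by lra. lra.
Qed.

Lemma lcoef_ext g h n s : (forall u, Cmod u = exp s -> g u = h u) -> lcoef g n s = lcoef h n s.
Proof.
intros E. unfold lcoef. f_equal. apply Cint_ext; auto.
intros t _. unfold lint. rewrite E; auto. apply Cmod_cexp.
Qed.

Lemma lcoef_plus g h n s : cont_circle g s -> cont_circle h s ->
  lcoef (fun u => g u + h u)%C n s = (lcoef g n s + lcoef h n s)%C.
Proof.
intros Hg Hh. unfold lcoef. rewrite <- Cmult_plus_distr_l. f_equal.
rewrite <- Cint_plus; auto using cont_on_lint.
apply Cint_ext; auto. intros; unfold lint. ring.
Qed.

Lemma lcoef_scal k h n s : cont_circle h s ->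
  lcoef (fun u => k * h u)%C n s = (k * lcoef h n s)%C.
Proof.
intros Hh. unfold lcoef.
transitivity (RtoC (/ (2 * PI)) * (k * Cint (fun t => lint h n (s, t)) 0 (2 * PI)))%C; [|ring].
f_equal. rewrite <- Cint_scal; auto using cont_on_lint.
apply Cint_ext; auto. intros; unfold lint. ring.
Qed.

Lemma cont_circle_scal k h s : cont_circle h s -> cont_circle (fun u => k * h u)%C s.
Proof. intros H u Hu. apply continuous_Cmult; [apply continuous_const|auto]. Qed.

Lemma lcoef_minus g h n s : cont_circle g s -> cont_circle h s ->
  lcoef (fun u => g u - h u)%C n s = (lcoef g n s - lcoef h n s)%C.
Proof.
intros Hg Hh.
rewrite (lcoef_ext _ (fun u => g u + RtoC (-1) * h u)%C).
- rewrite lcoef_plus, lcoef_scal; auto using cont_circle_scal. 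
  apply injective_projections; simpl; ring.
- intros; apply injective_projections; simpl; ring.
Qed.

Lemma lcoef_shift h n s : lcoef (fun u => u * h u)%C n s = lcoef h (n + 1) s.
Proof.
unfold lcoef. f_equal. apply Cint_ext; auto. intros t _. unfold lint.
rewrite plus_IZR, RtoC_plus.
replace ((RtoC (IZR n) + RtoC 1) * (s, t))%C with (RtoC (IZR n) * (s, t) + (s, t))%C by ring.
rewrite cexp_plus. ring.
Qed.

Lemma Cconj_RtoC (x : R) : Cconj (RtoC x) = RtoC x.
Proof. unfold Cconj, RtoC; simpl. now rewrite Ropp_0. Qed.

Lemma continuous_Cconj (z : C) : continuous Cconj z.
Proof.
apply continuous_Cmod. intros eps He.
apply locally_Cmod.
exists eps; split; auto. intros y Hy. rewrite <- Cminus_conj, Cmod_conj. exact Hy.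
Qed.

(** On the circle of radius [exp s] the conjugate of [u] is [exp (2 * s) / u], so conjugation
    exchanges the indices [n] and [- n] up to a power of the radius. *)
Lemma lcoef_conj h n s : cont_circle h s ->
  lcoef (fun u => Cconj (h u)) n s = (RtoC (exp (2 * IZR n * s)) * Cconj (lcoef h (- n) s))%C.
Proof.
intros Hh. unfold lcoef. rewrite Cmult_conj, Cconj_RtoC, <- Cint_conj by auto using cont_on_lint.
transitivity (RtoC (/ (2 * PI)) * (RtoC (exp (2 * IZR n * s)) *
   Cint (fun t => Cconj (lint h (- n) (s, t))) 0 (2 * PI)))%C; [|ring].
f_equal. rewrite <- Cint_scal; auto.
- apply Cint_ext; auto. intros t _. unfold lint. rewrite Cmult_conj.
  transitivity (Cconj (h (cexp (s, t))) * (RtoC (exp (2 * IZR n * s)) *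
     Cconj (cexp (RtoC (IZR (- n)) * (s, t)))))%C; [|ring].
  f_equal. unfold cexp. rewrite opp_IZR. simpl.
  replace (IZR n * s - 0 * t) with (2 * IZR n * s + (- IZR n * s - 0 * t)) by ring.
  rewrite exp_plus. unfold Cexpi.
  replace (- IZR n * t + 0 * s) with (- (IZR n * t + 0 * s)) by ring.
  rewrite cos_neg, sin_neg. apply injective_projections; simpl; ring.
- intros t Ht. apply (continuous_comp (fun t => lint h (- n) (s, t)) Cconj).
  + now apply (cont_on_lint h (- n) s 0 (2 * PI)).
  + apply continuous_Cconj.
Qed.

(** For [n <> 0] no integral is computed: the mean scales by [exp (n s)] with the radius and is also
    independent of it, so it is zero. *)
Lemma lcoef_one (n : Z) s : lcoef (fun _ => RtoC 1) n s = if Z.eqb n 0 then RtoC 1 else RtoC 0.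
Proof.
assert (Hpi := two_PI_pos).
destruct (Z.eqb_spec n 0) as [->|Hn].
- unfold lcoef. rewrite (Cint_ext _ (fun _ => RtoC 1)); auto.
  + rewrite Cint_const, <- !RtoC_mult. f_equal. field. lra.
  + intros t _. unfold lint. rewrite Cmult_0_l, cexp_0. ring.
- assert (Hsc : forall s, lcoef (fun _ => RtoC 1) n s = (RtoC (exp (IZR n * s)) * lcoef (fun _ => RtoC 1) n 0)%C).
  { intros s'. unfold lcoef.
    transitivity (RtoC (/ (2 * PI)) * (RtoC (exp (IZR n * s')) *
       Cint (fun t => lint (fun _ => RtoC 1) n (0, t)) 0 (2 * PI)))%C; [|ring].
    f_equal. rewrite <- Cint_scal; auto.
    - apply Cint_ext; auto. intros t _. unfold lint, cexp. simpl.
      rewrite !Rmult_0_r, Rmult_0_l, Rminus_0_r, Rminus_0_r, exp_0.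
      replace (IZR n * t + 0 * s') with (IZR n * t + 0) by ring.
      ring.
    - apply cont_on_lint. intros u _. apply continuous_const. }
  assert (Hc := lcoef_const (fun _ => RtoC 1) n 0 1 ltac:(lra) (fun u _ => cdiff_const _ _)).
  rewrite (Hsc 1) in Hc. rewrite (Hsc s).
  set (L := lcoef _ n 0) in *.
  assert (HL : L = RtoC 0).
  { apply NNPP. intros HL.
    assert (Hz : RtoC (exp (IZR n * 1)) = RtoC 1).
    { replace (RtoC (exp (IZR n * 1))) with (RtoC (exp (IZR n * 1)) * L * / L)%C by (field; auto).
      rewrite <- Hc. field; auto. }
    apply RtoC_inj in Hz. apply Hn, eq_IZR_R0, exp_inv.
    rewrite exp_0, <- Hz. f_equal. ring. }
  rewrite HL. ring.
Qed.

Lemma lcoef_cst (k : C) (n : Z) s : lcoef (fun _ => k) n s = if Z.eqb n 0 then k else RtoC 0.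
Proof.
rewrite (lcoef_ext _ (fun u => k * RtoC 1)%C) by (intros; ring).
rewrite lcoef_scal, lcoef_one by (intros u _; apply continuous_const).
destruct (Z.eqb n 0); ring.
Qed.

Lemma strip_uniform (H : C -> C) (s0 eps : R) :
  (forall t, 0 <= t <= 2 * PI -> continuous H (s0, t)) -> 0 < eps ->
  exists d, 0 < d /\ forall s t, Rabs (s - s0) < d -> 0 <= t <= 2 * PI ->
    Cmod (H (s, t) - H (s0, t)) < eps.
Proof.
intros Hc He.
destruct (compact_rect (fun d _ t => forall s, Rabs (s - s0) < d ->
   Cmod (H (s, t) - H (s0, t)) < eps) 0 0 0 (2 * PI)) as [d [Hd HH]].
- intros d d' x t [H1 H2] HH s Hs. apply HH. lra.
- intros x t _ Ht.
  assert (He2 : 0 < eps / 2) by lra.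
  destruct (proj1 (locally_Cmod _ _) (proj1 (continuous_Cmod _ _) (Hc t Ht) _ He2)) as [d [Hd HH]].
  exists (d / 2). split; [lra|]. intros x' t' _ Ht' s Hs.
  assert (Hdist : forall s, Rabs (s - s0) < d / 2 -> Cmod ((s, t') - (s0, t)) < d).
  { intros s1 Hs1. assert (E : ((s1, t') - (s0, t))%C = (RtoC (s1 - s0) + Ci * RtoC (t' - t))%C)
      by (apply injective_projections; simpl; ring).
    rewrite E. eapply Rle_lt_trans; [apply Cmod_triangle|].
    rewrite Cmod_mult, Cmod_Ci, !Cmod_R. lra. }
  assert (H1 := HH _ (Hdist s Hs)).
  assert (H2 := HH _ (Hdist s0 ltac:(rewrite Rminus_diag_eq, Rabs_R0 by auto; lra))).
  replace (H (s, t') - H (s0, t'))%C with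
    ((H (s, t') - H (s0, t)) - (H (s0, t') - H (s0, t)))%C by ring.
  eapply Rle_lt_trans; [apply Cmod_minus_le|]. lra.
- exists d. split; auto. intros s t Hs Ht. apply (HH 0 t); auto. lra.
Qed.

Lemma circle_bounded (h : C -> C) (s : R) : cont_circle h s ->
  exists M, 0 < M /\ forall u, Cmod u = exp s -> Cmod (h u) <= M.
Proof.
intros Hc.
(* The bound is written [/ d] so that shrinking [d] weakens the claim, as [compact_rect] demands. *)
destruct (compact_rect (fun d _ t => Cmod (h (cexp (s, t))) <= / d) 0 0 0 (2 * PI)) as [d [Hd H]].
- intros d d' x t Hdd H. eapply Rle_trans; [exact H|]. apply Rinv_le_contravar; lra.
- intros x t _ _.
  assert (Hcont : continuous (fun p => h (cexp p)) (s, t)).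
  { apply (continuous_comp cexp h). apply cdiff_continuous, cdiff_cexp. apply Hc, Cmod_cexp. }
  destruct (proj1 (locally_Cmod _ _) (proj1 (continuous_Cmod _ _) Hcont 1 Rlt_0_1)) as [d [Hd H]].
  set (m := Cmod (h (cexp (s, t))) + 1).
  assert (Hm : 0 < m) by (unfold m; generalize (Cmod_ge_0 (h (cexp (s, t)))); lra).
  exists (Rmin d (/ m)). assert (Hi : 0 < / m) by now apply Rinv_0_lt_compat.
  split; [now apply Rmin_pos|]. intros x' t' _ Ht'.
  assert (L1 := Rmin_l d (/ m)). assert (L2 := Rmin_r d (/ m)).
  assert (E : ((s, t') - (s, t))%C = (Ci * RtoC (t' - t))%C)
      by (apply injective_projections; simpl; ring).
  assert (H1 : Cmod ((s, t') - (s, t)) < d).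
  { rewrite E, Cmod_mult, Cmod_Ci, Cmod_R. lra. }
  apply H in H1.
  apply Rle_trans with m.
  + unfold m. assert (X := Cmod_sub_le (h (cexp (s, t'))) (h (cexp (s, t)))). lra.
  + apply Rle_trans with (/ / m); [rewrite Rinv_inv; lra|]. apply Rinv_le_contravar; auto. now apply Rmin_pos.
- exists (/ d). split; [now apply Rinv_0_lt_compat|]. intros u Hu.
  assert (Hu0 : u <> 0%C) by (apply Cmod_gt_0; rewrite Hu; apply exp_pos).
  destruct (cexp_log_polar u Hu0) as [t [Ht E]].
  rewrite E, Hu, ln_exp. apply (H 0 t); lra.
Qed.

Lemma lcoef_continuous (h : C -> C) (n : Z) (s0 s1 s2 eps : R) : s1 < s0 < s2 ->
  (forall u, exp s1 < Cmod u < exp s2 -> continuous h u) -> 0 < eps ->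
  exists d, 0 < d /\ forall s, Rabs (s - s0) < d -> Cmod (lcoef h n s - lcoef h n s0) < eps.
Proof.
intros Hs Hc He. assert (Hpi := two_PI_pos).
assert (Hcirc : forall s, s1 < s < s2 -> cont_circle h s).
{ intros s Hs' u Hu. apply Hc. rewrite Hu. split; apply exp_increasing; lra. }
destruct (strip_uniform (lint h n) s0 (eps / 2)) as [d [Hd H]]; [|lra|].
{ intros t _. apply continuous_lint. apply (Hcirc s0); auto. apply Cmod_cexp. }
exists (Rmin d (Rmin (s0 - s1) (s2 - s0))). split; [repeat apply Rmin_pos; lra|].
intros s Hss.
assert (Hs1 : Rabs (s - s0) < d) by (eapply Rlt_le_trans; [exact Hss|apply Rmin_l]).
assert (Hs2 : Rabs (s - s0) < s0 - s1).
{ eapply Rlt_le_trans; [exact Hss|]. eapply Rle_trans; [apply Rmin_r|apply Rmin_l]. }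
assert (Hs3 : Rabs (s - s0) < s2 - s0).
{ eapply Rlt_le_trans; [exact Hss|]. eapply Rle_trans; [apply Rmin_r|apply Rmin_r]. }
apply Rabs_def2 in Hs2. apply Rabs_def2 in Hs3.
replace (lcoef h n s - lcoef h n s0)%C with (RtoC (/ (2 * PI)) *
   (Cint (fun t => lint h n (s, t)) 0 (2 * PI) -
    Cint (fun t => lint h n (s0, t)) 0 (2 * PI)))%C by (unfold lcoef; ring).
rewrite <- Cint_minus; auto;
  [|apply cont_on_lint, Hcirc; lra|apply cont_on_lint, Hcirc; lra].
rewrite Cmod_mult, Cmod_R, Rabs_pos_eq by (left; now apply Rinv_0_lt_compat).
assert (B : Cmod (Cint (fun t => lint h n (s, t) - lint h n (s0, t))%C 0 (2 * PI)) <= (2 * PI - 0) * (eps / 2)).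
{ apply Cint_bound; auto.
  - intros t Ht. apply continuous_Cminus; refine (cont_on_lint h n _ 0 (2 * PI) _ t Ht); apply Hcirc; lra.
  - intros t Ht. left. now apply H. }
apply Rle_lt_trans with (eps / 2); [|lra].
apply Rmult_le_reg_l with (2 * PI); auto.
rewrite <- Rmult_assoc, Rinv_r, Rmult_1_l by lra. lra.
Qed.

(** A removable singularity: the mean is constant on either side of the circle through [u0], and its
    continuity in the radius joins the two sides. *)
Lemma lcoef_const_punctured (h : C -> C) (n : Z) (a b s1 s2 : R) (u0 : C) :
  a < s1 <= s2 -> s2 < b ->
  (forall u, exp a < Cmod u < exp b -> continuous h u) ->
  (forall u, exp a < Cmod u < exp b -> u <> u0 -> cdiff h u) ->
  lcoef h n s1 = lcoef h n s2.
Proof.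
intros Hs Hb Hc Hd.
assert (Hconst : forall x y, a < x -> x <= y -> y < b ->
   (forall s, x <= s <= y -> Cmod u0 <> exp s) -> lcoef h n x = lcoef h n y).
{ intros x y Hx Hxy Hy Hn. apply lcoef_const; auto. intros u Hu. apply Hd.
  - apply exp_increasing in Hx. apply exp_increasing in Hy. lra.
  - intros ->. assert (Hpos : 0 < Cmod u0) by (generalize (exp_pos x); lra).
    apply (Hn (ln (Cmod u0))); [|now rewrite exp_ln].
    split; apply exp_le_inv; rewrite exp_ln; lra. }
destruct (classic (exists s, s1 <= s <= s2 /\ Cmod u0 = exp s)) as [[s [Hs0 Hu0]]|Hn];
  [|apply Hconst; try lra; intros s h1 h2; apply Hn; eauto].
assert (Hlim : forall x, a < x < b -> lcoef h n x = lcoef h n s).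
{ intros x Hx. apply NNPP. intros Hne.
  assert (He : 0 < Cmod (lcoef h n x - lcoef h n s)).
  { apply Cmod_gt_0. intros E. apply Hne. replace (lcoef h n x) with (lcoef h n x - lcoef h n s + lcoef h n s)%C by ring.
    rewrite E. ring. }
  destruct (lcoef_continuous h n s a b _ ltac:(lra) Hc He) as [d [Hdd H]].
  destruct (Rtotal_order x s) as [Hxs|[->|Hxs]]; [| now apply Hne |].
  - set (y := Rmax x (s - d / 2)).
    assert (Hy1 : x <= y) by apply Rmax_l. assert (Hy2 : s - d / 2 <= y) by apply Rmax_r.
    assert (Hy3 : y < s) by (apply Rmax_lub_lt; lra).
    rewrite (Hconst x y) in H; try lra.
    + specialize (H y). rewrite Rabs_left in H by lra. specialize (H ltac:(lra)). lra.
    + intros z Hz E. rewrite Hu0 in E. apply exp_inv in E. lra.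
  - set (y := Rmin x (s + d / 2)).
    assert (Hy1 : y <= x) by apply Rmin_l. assert (Hy2 : y <= s + d / 2) by apply Rmin_r.
    assert (Hy3 : s < y) by (apply Rmin_glb_lt; lra).
    rewrite <- (Hconst y x) in H; try lra.
    + specialize (H y). rewrite Rabs_pos_eq in H by lra. specialize (H ltac:(lra)). lra.
    + intros z Hz E. rewrite Hu0 in E. apply exp_inv in E. lra. }
rewrite (Hlim s1), (Hlim s2) by lra. reflexivity.
Qed.

(** * Maximum modulus and expansions at infinity *)

Lemma cont_circle_cdiff h s : (forall u, Cmod u = exp s -> cdiff h u) -> cont_circle h s.
Proof. intros H u Hu. now apply cdiff_continuous, H. Qed.

(** The mean over circles centred at [z] does not depend on the radius; it is at most [M] in modulus
    on the outer circle and approaches [h z] on small ones. *)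
Lemma max_modulus_center (h : C -> C) (z : C) (rho M : R) : 0 < rho ->
  (forall u, Cmod (u - z) <= rho -> cdiff h u) ->
  (forall u, Cmod (u - z) = rho -> Cmod (h u) <= M) -> Cmod (h z) <= M.
Proof.
intros Hr Hd HM. set (g := fun v => h (z + v)%C).
assert (Hg : forall v, Cmod v <= rho -> cdiff g v).
{ intros v Hv. apply (cdiff_comp h (fun v => z + v)%C).
  - apply Hd. replace (z + v - z)%C with v by ring. exact Hv.
  - apply cdiff_plus; [apply cdiff_const|apply cdiff_id]. }
apply le_epsilon. intros eps He.
assert (H0 : cdiff g 0) by (apply Hg; rewrite Cmod_0; lra).
apply cdiff_continuous in H0.
destruct (proj1 (locally_Cmod _ _) (proj1 (continuous_Cmod _ _) H0 eps He)) as [d [Hd0 H]].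
set (s := Rmin (ln rho) (ln (d / 2))).
assert (Hs1 : exp s <= rho).
{ rewrite <- (exp_ln rho) by auto. apply exp_le_exp, Rmin_l. }
assert (Hs2 : exp s < d).
{ apply Rle_lt_trans with (d / 2); [|lra]. rewrite <- (exp_ln (d / 2)) by lra. apply exp_le_exp, Rmin_r. }
assert (Hc : forall t, exp t <= rho -> cont_circle g t).
{ intros t Ht. apply cont_circle_cdiff. intros u Hu. apply Hg. lra. }
assert (E1 : lcoef g 0 s = lcoef g 0 (ln rho)).
{ apply lcoef_const; [apply Rmin_l|]. intros u Hu. apply Hg. rewrite exp_ln in Hu; lra. }
assert (B1 : Cmod (lcoef g 0 (ln rho)) <= M).
{ replace M with (exp (0 * ln rho) * M) by (rewrite Rmult_0_l, exp_0; ring).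
  apply lcoef_bound; [apply Hc; rewrite exp_ln; lra|].
  intros u Hu. apply HM. replace (z + u - z)%C with u by ring. rewrite Hu. now apply exp_ln. }
assert (B2 : Cmod (lcoef (fun v => g v - g 0)%C 0 s) <= eps).
{ replace eps with (exp (0 * s) * eps) by (rewrite Rmult_0_l, exp_0; ring).
  apply lcoef_bound.
  - intros u Hu. apply continuous_Cminus; [exact (Hc s Hs1 u Hu)|apply continuous_const].
  - intros u Hu. left. apply H. replace (u - 0)%C with u by ring. lra. }
rewrite lcoef_minus, lcoef_cst in B2; [|now apply Hc|intros u _; apply continuous_const].
simpl in B2. rewrite E1 in B2.
replace (h z) with (g 0) by (unfold g; f_equal; ring).
assert (X := Cmod_sub_le (g 0) (lcoef g 0 (ln rho))). rewrite Cmod_sub_sym in X. lra.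
Qed.

(** * Limits at infinity *)

Definition lim_infty (h : C -> C) (l : C) : Prop :=
  forall eps, 0 < eps -> exists R0, forall u, R0 < Cmod u -> Cmod (h u - l) < eps.

Lemma exists_large (R0 : R) : exists u : C, R0 < Cmod u.
Proof.
exists (RtoC (Rabs R0 + 1)). rewrite Cmod_R.
rewrite (Rabs_pos_eq (Rabs R0 + 1)) by (generalize (Rabs_pos R0); lra).
generalize (Rle_abs R0). lra.
Qed.

Lemma lim_infty_unique h l1 l2 : lim_infty h l1 -> lim_infty h l2 -> l1 = l2.
Proof.
intros H1 H2. apply NNPP. intros Hn.
assert (He : 0 < Cmod (l1 - l2) / 2).
{ apply Rdiv_lt_0_compat; [|lra]. apply Cmod_gt_0. intros E. apply Hn.
  replace l1 with (l1 - l2 + l2)%C by ring. rewrite E. ring. }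
destruct (H1 _ He) as [R1 HR1]. destruct (H2 _ He) as [R2 HR2].
destruct (exists_large (Rmax R1 R2)) as [u Hu].
specialize (HR1 u ltac:(generalize (Rmax_l R1 R2); lra)).
specialize (HR2 u ltac:(generalize (Rmax_r R1 R2); lra)).
assert (X := Cmod_minus_le (h u - l2) (h u - l1)).
replace (h u - l2 - (h u - l1))%C with (l1 - l2)%C in X by ring. lra.
Qed.

Lemma lim_infty_ext g h l R0 : (forall u, R0 < Cmod u -> g u = h u) -> lim_infty g l -> lim_infty h l.
Proof.
intros E H eps He. destruct (H eps He) as [R1 HR]. exists (Rmax R0 R1). intros u Hu.
rewrite <- E by (generalize (Rmax_l R0 R1); lra). apply HR. generalize (Rmax_r R0 R1); lra.
Qed.

Lemma lim_infty_eq h l l' : l = l' -> lim_infty h l -> lim_infty h l'.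
Proof. intros ->; auto. Qed.

Lemma lim_infty_const k : lim_infty (fun _ => k) k.
Proof. intros eps He. exists 0. intros u _. replace (k - k)%C with (RtoC 0) by ring. now rewrite Cmod_0. Qed.

Lemma lim_infty_plus g h a b : lim_infty g a -> lim_infty h b -> lim_infty (fun u => g u + h u)%C (a + b)%C.
Proof.
intros Hg Hh eps He. destruct (Hg (eps / 2) ltac:(lra)) as [R1 H1].
destruct (Hh (eps / 2) ltac:(lra)) as [R2 H2]. exists (Rmax R1 R2). intros u Hu.
specialize (H1 u ltac:(generalize (Rmax_l R1 R2); lra)).
specialize (H2 u ltac:(generalize (Rmax_r R1 R2); lra)).
replace (g u + h u - (a + b))%C with ((g u - a) + (h u - b))%C by ring.
eapply Rle_lt_trans; [apply Cmod_triangle|]. lra.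
Qed.

Lemma lim_infty_mult g h a b : lim_infty g a -> lim_infty h b -> lim_infty (fun u => g u * h u)%C (a * b)%C.
Proof.
intros Hg Hh eps He.
assert (Ha := Cmod_ge_0 a). assert (Hb := Cmod_ge_0 b).
set (e := Rmin 1 (eps / (2 * (Cmod a + Cmod b + 1)))).
assert (He' : 0 < e) by (apply Rmin_pos; [lra|apply Rdiv_lt_0_compat; lra]).
assert (He1 : e <= 1) by apply Rmin_l.
assert (He2 : e * (Cmod a + Cmod b + 1) <= eps / 2).
{ apply Rle_trans with (eps / (2 * (Cmod a + Cmod b + 1)) * (Cmod a + Cmod b + 1)).
  - apply Rmult_le_compat_r; [lra|apply Rmin_r].
  - right. field. lra. }
destruct (Hg e He') as [R1 H1]. destruct (Hh e He') as [R2 H2]. exists (Rmax R1 R2). intros u Hu.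
specialize (H1 u ltac:(generalize (Rmax_l R1 R2); lra)).
specialize (H2 u ltac:(generalize (Rmax_r R1 R2); lra)).
replace (g u * h u - a * b)%C with ((g u - a) * (h u - b) + (a * (h u - b) + b * (g u - a)))%C by ring.
eapply Rle_lt_trans; [apply Cmod_triangle|].
eapply Rle_lt_trans; [apply Rplus_le_compat_l, Cmod_triangle|].
rewrite !Cmod_mult.
assert (P1 := Cmod_ge_0 (g u - a)). assert (P2 := Cmod_ge_0 (h u - b)).
nra.
Qed.

Lemma lim_infty_scal k h a : lim_infty h a -> lim_infty (fun u => k * h u)%C (k * a)%C.
Proof. apply lim_infty_mult. apply lim_infty_const. Qed.

Lemma lim_infty_minus g h a b : lim_infty g a -> lim_infty h b -> lim_infty (fun u => g u - h u)%C (a - b)%C.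
Proof.
intros Hg Hh. replace (a - b)%C with (a + RtoC (-1) * b)%C
  by (apply injective_projections; simpl; ring).
apply (lim_infty_ext (fun u => g u + RtoC (-1) * h u)%C _ _ 0).
- intros u _; apply injective_projections; simpl; ring.
- apply lim_infty_plus; auto. now apply lim_infty_scal.
Qed.

Lemma lim_infty_comp h g l : (forall R0, exists R1, forall u, R1 < Cmod u -> R0 < Cmod (g u)) ->
  lim_infty h l -> lim_infty (fun u => h (g u)) l.
Proof.
intros Hg Hh eps He. destruct (Hh eps He) as [R0 H0]. destruct (Hg R0) as [R1 H1].
exists R1. auto.
Qed.

Lemma lim_infty_inv_shift (r : C) : lim_infty (fun u => / (u - r))%C 0.
Proof.
intros eps He. exists (Cmod r + / eps). intros u Hu.
assert (H1 := Cmod_sub_le u r). assert (Hi : 0 < / eps) by now apply Rinv_0_lt_compat.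
replace (/ (u - r) - 0)%C with (/ (u - r))%C by ring.
rewrite Cmod_inv by (apply Cmod_gt_0; lra).
rewrite <- (Rinv_inv eps). apply Rinv_lt_contravar; [|lra]. apply Rmult_lt_0_compat; lra.
Qed.

Lemma lim_infty_quot_shift (r : C) : lim_infty (fun u => u / (u - r))%C 1.
Proof.
apply (lim_infty_ext (fun u => RtoC 1 + r * / (u - r))%C _ _ (Cmod r)).
- intros u Hu. field. intros E. assert (X := Cmod_sub_le u r). rewrite E, Cmod_0 in X. lra.
- apply (lim_infty_eq _ (RtoC 1 + r * 0)%C); [ring|].
  apply lim_infty_plus; [apply lim_infty_const|]. apply lim_infty_scal, lim_infty_inv_shift.
Qed.

Lemma lcoef_lim_infty h l c R0 :
  (forall u, R0 < Cmod u -> continuous h u) -> lim_infty h l ->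
  (forall s, R0 < exp s -> lcoef h 0 s = c) -> c = l.
Proof.
intros Hc Hl Hs. apply NNPP. intros Hn.
assert (He : 0 < Cmod (c - l) / 2).
{ apply Rdiv_lt_0_compat; [|lra]. apply Cmod_gt_0. intros E. apply Hn.
  replace c with (c - l + l)%C by ring. rewrite E. ring. }
destruct (Hl _ He) as [R1 H1].
set (s := ln (Rmax 1 (Rmax R0 R1) + 1)).
assert (Hm1 := Rmax_l 1 (Rmax R0 R1)). assert (Hm2 := Rmax_r 1 (Rmax R0 R1)).
assert (Hm3 := Rmax_l R0 R1). assert (Hm4 := Rmax_r R0 R1).
assert (Es : exp s = Rmax 1 (Rmax R0 R1) + 1) by (apply exp_ln; lra).
assert (Hcs : cont_circle h s). { intros u Hu. apply Hc. lra. }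
assert (B : Cmod (lcoef (fun u => h u - l)%C 0 s) <= Cmod (c - l) / 2).
{ replace (Cmod (c - l) / 2) with (exp (0 * s) * (Cmod (c - l) / 2)) by (rewrite Rmult_0_l, exp_0; ring).
  apply lcoef_bound.
  - intros u Hu. apply continuous_Cminus; [auto|apply continuous_const].
  - intros u Hu. left. apply H1. lra. }
rewrite lcoef_minus, lcoef_cst, Hs in B; [|lra|auto|intros u _; apply continuous_const].
simpl in B. lra.
Qed.

Lemma cdiff_pow (n : nat) (z : C) : cdiff (fun u => u ^ n)%C z.
Proof.
induction n; simpl.
- apply cdiff_const.
- apply cdiff_mult; [apply cdiff_id|exact IHn].
Qed.

(** * Laurent expansion of a holomorphic function that vanishes at infinity *)

Section Laurent.
Variables (h : C -> C) (R0 : R).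
Hypothesis HR0 : 0 < R0.
Hypothesis Hd : forall u, R0 < Cmod u -> cdiff h u.

Lemma lcoef_indep n s1 s2 : R0 < exp s1 -> R0 < exp s2 -> lcoef h n s1 = lcoef h n s2.
Proof.
intros H1 H2. destruct (Rle_dec s1 s2).
- apply lcoef_const; auto. intros u Hu. apply Hd. lra.
- symmetry. apply lcoef_const; [lra|]. intros u Hu. apply Hd. lra.
Qed.

Lemma cont_circle_outside s : R0 < exp s -> cont_circle h s.
Proof. intros Hs. apply cont_circle_cdiff. intros u Hu. apply Hd. lra. Qed.

Hypothesis Hlim : lim_infty h 0.

Section DiffQuot.
Variables (s : R) (u0 : C).
Hypothesis Hs : R0 < exp s.
Hypothesis Hu0 : exp s < Cmod u0.
(** Plays the part of a Cauchy kernel: its coefficients on a circle inside that of [u0] are the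
    remainders of the Laurent expansion of [h] at [u0], up to powers of [u0] and a sign. *)
Let q (u : C) : C := ((h u - h u0) / (u - u0))%C.

Lemma diff_quot_neq u : Cmod u <> Cmod u0 -> (u - u0)%C <> 0%C.
Proof. intros Hu E. apply Hu. f_equal. replace u with (u - u0 + u0)%C by ring. rewrite E. ring. Qed.

Lemma cdiff_quot u : R0 < Cmod u -> u <> u0 -> cdiff q u.
Proof.
intros Hu Hne. apply cdiff_div.
- apply cdiff_minus; [now apply Hd|apply cdiff_const].
- apply cdiff_minus; [apply cdiff_id|apply cdiff_const].
- intros E. apply Hne. replace u with (u - u0 + u0)%C by ring. rewrite E. ring.
Qed.

Lemma quot_circle : cont_circle q s.
Proof.
intros u Hu. apply cdiff_continuous, cdiff_quot; [lra|]. intros ->. lra.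
Qed.

(** Once the singularity at [u0] is filled, the coefficient does not depend on the radius, and
    [u * q u] tends to [- h u0] at infinity. *)
Lemma quot_coef_1 : lcoef q 1 s = (- h u0)%C.
Proof.
destruct (Hd u0 ltac:(lra)) as [D HD].
(* At [u0] the quotient receives the derivative as its value. Only continuity is proved there, which
   is what [lcoef_const_punctured] asks for. *)
set (qq := fun u => if excluded_middle_informative (u = u0) then D else q u).
assert (Hqq : forall u, u <> u0 -> qq u = q u).
{ intros u Hu. unfold qq. destruct (excluded_middle_informative (u = u0)); tauto. }
assert (Hqd : forall u, R0 < Cmod u -> u <> u0 -> cdiff qq u).
{ intros u Hu Hne. apply (cdiff_ext_loc q); [|now apply cdiff_quot].
  apply locally_Cmod. exists (Cmod (u - u0)). split.
  - apply Cmod_gt_0. intros E. apply Hne. replace u with (u - u0 + u0)%C by ring. rewrite E. ring.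
  - intros y Hy. symmetry. apply Hqq. intros ->. rewrite Cmod_sub_sym in Hy. lra. }
assert (Hqc : forall u, R0 < Cmod u -> continuous qq u).
{ intros u Hu. destruct (classic (u = u0)) as [->|Hne]; [|now apply cdiff_continuous, Hqd].
  apply continuous_Cmod. intros eps He. apply locally_Cmod.
  destruct (proj1 (is_derive_Cmod _ _ _) HD (eps / 2) ltac:(lra)) as [d [Hd0 H]].
  exists d. split; auto. intros y Hy.
  assert (E0 : qq u0 = D).
  { unfold qq. destruct (excluded_middle_informative (u0 = u0)); tauto. }
  rewrite E0. destruct (classic (y = u0)) as [->|Hyn].
  - rewrite E0. replace (D - D)%C with (RtoC 0) by ring. now rewrite Cmod_0.
  - rewrite Hqq by auto. assert (Hn0 : (y - u0)%C <> 0%C).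
    { intros E. apply Hyn. replace y with (y - u0 + u0)%C by ring. rewrite E. ring. }
    unfold q. specialize (H y Hy).
    replace ((h y - h u0) / (y - u0) - D)%C with ((h y - h u0 - (y - u0) * D) / (y - u0))%C by (field; auto).
    apply Cmod_gt_0 in Hn0 as Hn1.
    rewrite Cmod_div by auto. apply Rlt_div_l; auto. nra. }
rewrite (lcoef_ext q qq).
2:{ intros u Hu. symmetry. apply Hqq. intros ->. lra. }
change (lcoef qq 1 s) with (lcoef qq (0 + 1) s).
rewrite <- (lcoef_shift qq 0 s).
set (W := fun u => (u * qq u)%C).
assert (HWd : forall u, R0 < Cmod u -> u <> u0 -> cdiff W u).
{ intros u Hu Hne. apply cdiff_mult; [apply cdiff_id|now apply Hqd]. }
assert (HWc : forall u, R0 < Cmod u -> continuous W u).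
{ intros u Hu. apply continuous_Cmult; [apply continuous_id|now apply Hqc]. }
apply (lcoef_lim_infty W _ _ (exp s)).
- intros u Hu. apply HWc. lra.
- apply (lim_infty_ext (fun u => (u / (u - u0)) * (h u - h u0))%C _ _ (Cmod u0)).
  + intros u Hu. unfold W. rewrite Hqq by (intros ->; lra). unfold q. field.
    apply diff_quot_neq. lra.
  + replace (- h u0)%C with (1 * (0 - h u0))%C by ring.
    apply lim_infty_mult; [apply lim_infty_quot_shift|].
    apply lim_infty_minus; [exact Hlim|apply lim_infty_const].
- intros s' Hs'. symmetry.
  apply (lcoef_const_punctured W 0 (ln R0) (s' + 1) s s' u0).
  + split; [|left; now apply exp_lt_inv]. apply exp_lt_inv. rewrite exp_ln; lra.
  + lra.
  + intros u. rewrite exp_ln by lra. intros [? _]. now apply HWc.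
  + intros u. rewrite exp_ln by lra. intros [? _]. now apply HWd.
Qed.

(** Coefficients are compared in [u * q u = u0 * q u + h u - h u0]; the constant [h u0] is seen only
    at index 0. *)
Lemma quot_coef_succ n : n <> 0%Z -> lcoef q (n + 1) s = (u0 * lcoef q n s + lcoef h n s)%C.
Proof.
intros Hn. rewrite <- lcoef_shift.
rewrite (lcoef_ext _ (fun u => u0 * q u + (h u + - h u0))%C).
- rewrite lcoef_plus, lcoef_scal, lcoef_plus, lcoef_cst.
  + destruct (Z.eqb_spec n 0) as [|_]; [tauto|]. ring.
  + now apply cont_circle_outside.
  + intros u _. apply continuous_const.
  + apply quot_circle.
  + apply cont_circle_scal, quot_circle.
  + intros u Hu. apply continuous_Cplus; [exact (cont_circle_outside s Hs u Hu)|apply continuous_const].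
- intros u Hu. unfold q. field. apply diff_quot_neq. lra.
Qed.
End DiffQuot.

(** Up to sign the error at [u0] is the coefficient of index 2 of the difference quotient on a fixed
    circle, where that quotient is of order [1 / Cmod u0]. *)
Lemma laurent_lim_1 s : R0 < exp s -> lim_infty (fun u => u * h u)%C (lcoef h 1 s).
Proof.
intros Hs eps He.
assert (Hcirc := cont_circle_outside s Hs).
destruct (circle_bounded h s Hcirc) as [M [HM HMb]].
destruct (Hlim 1 Rlt_0_1) as [R1 HR1].
set (K := exp (2 * s) * (M + 1)).
assert (HK : 0 < K) by (unfold K; generalize (exp_pos (2 * s)); nra).
exists (Rmax R1 (exp s + K / eps)). intros u0 Hu0.
assert (L1 := Rmax_l R1 (exp s + K / eps)). assert (L2 := Rmax_r R1 (exp s + K / eps)).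
assert (HKe : 0 < K / eps) by now apply Rdiv_lt_0_compat.
assert (Hu : exp s < Cmod u0) by lra.
assert (E1 := quot_coef_1 s u0 Hs Hu).
assert (E2 := quot_coef_succ s u0 Hs Hu 1 ltac:(lia)).
rewrite E1 in E2. set (q := fun u => ((h u - h u0) / (u - u0))%C) in *.
replace (u0 * h u0 - lcoef h 1 s)%C with (- lcoef q (1 + 1) s)%C by (rewrite E2; ring).
rewrite Cmod_opp.
apply Rle_lt_trans with (exp (2 * s) * ((M + 1) / (Cmod u0 - exp s))).
- apply (lcoef_bound q 2 s).
  + now apply quot_circle.
  + intros u Hum. unfold q.
    assert (Hh0 : Cmod (h u0) < 1).
    { specialize (HR1 u0 ltac:(lra)). replace (h u0 - 0)%C with (h u0) in HR1 by ring. exact HR1. }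
    rewrite Cmod_div by (apply diff_quot_neq; lra).
    assert (X := Cmod_sub_le u0 u). rewrite Cmod_sub_sym, Hum in X.
    assert (Y := Cmod_minus_le (h u) (h u0)). assert (Z := HMb u Hum).
    apply Rmult_le_compat; [apply Cmod_ge_0|left; apply Rinv_0_lt_compat; lra|lra|].
    apply Rinv_le_contravar; lra.
- unfold Rdiv. rewrite <- Rmult_assoc. apply Rlt_div_l; [lra|]. fold K.
  assert (K / eps < Cmod u0 - exp s) by lra.
  apply Rlt_div_l in H; lra.
Qed.

(** When all coefficients vanish, the recursion makes [- (u0 ^ N * h u0)] the coefficient of index
    [N + 1] of the difference quotient. That coefficient grows at most like [x ^ N] for some
    [x < Cmod u0], which forces [h u0 = 0]. *)
Lemma laurent_zero s : R0 < exp s ->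
  (forall n : nat, lcoef h (Z.of_nat (S n)) s = 0%C) -> forall u, R0 < Cmod u -> h u = 0%C.
Proof.
intros Hs0 Hz u0 Hu0.
set (s1 := ln ((R0 + Cmod u0) / 2)).
assert (Es : exp s1 = (R0 + Cmod u0) / 2) by (apply exp_ln; lra).
assert (Hs : R0 < exp s1) by lra. assert (Hu : exp s1 < Cmod u0) by lra.
set (q := fun u => ((h u - h u0) / (u - u0))%C).
assert (Hrec : forall N : nat, lcoef q (Z.of_nat (S N)) s1 = (- (u0 ^ N * h u0))%C).
{ induction N.
  - change (Z.of_nat 1) with 1%Z. unfold q. rewrite quot_coef_1 by auto. simpl. ring.
  - replace (Z.of_nat (S (S N))) with (Z.of_nat (S N) + 1)%Z by lia.
    unfold q. rewrite quot_coef_succ by (auto; lia). fold q. rewrite IHN.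
    rewrite (lcoef_indep _ s1 s) by auto. rewrite Hz. simpl. ring. }
destruct (circle_bounded q s1) as [M [HM HMb]]; [now apply quot_circle|].
apply Cmod_eq_0. apply NNPP. intros Hne.
assert (Hpos : 0 < Cmod (h u0)) by (generalize (Cmod_ge_0 (h u0)); lra).
set (x := exp s1) in *.
assert (Hx : 0 < x) by apply exp_pos.
assert (HB : forall N : nat, Cmod u0 ^ N * Cmod (h u0) <= x * x ^ N * M).
{ intros N. assert (B := lcoef_bound q (Z.of_nat (S N)) s1 M (quot_circle s1 u0 Hs Hu) HMb).
  rewrite Hrec, Cmod_opp, Cmod_mult, Cmod_pow in B.
  replace (x * x ^ N) with (exp (IZR (Z.of_nat (S N)) * s1)); [exact B|].
  rewrite <- INR_IZR_INZ. change (x * x ^ N) with (x ^ S N). unfold x.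
  rewrite Rmult_comm. symmetry. rewrite <- Rpower_pow by apply exp_pos. unfold Rpower.
  rewrite ln_exp. f_equal. ring. }
set (y := Cmod u0 / x).
assert (Hy : 1 < y) by (unfold y; apply Rlt_div_r; lra).
destruct (Pow_x_infinity y ltac:(rewrite Rabs_pos_eq; lra) (x * M / Cmod (h u0) + 1)) as [N HN].
specialize (HN N (Nat.le_refl N)). rewrite Rabs_pos_eq in HN by (apply pow_le; lra).
specialize (HB N).
assert (HxN : 0 < x ^ N) by now apply pow_lt.
assert (Ey : Cmod u0 ^ N = y ^ N * x ^ N).
{ rewrite <- Rpow_mult_distr. f_equal. unfold y. field. lra. }
rewrite Ey in HB.
assert (H1 : y ^ N * Cmod (h u0) <= x * M).
{ apply Rmult_le_reg_r with (x ^ N); auto. lra. }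
assert (H2 : x * M / Cmod (h u0) < y ^ N) by lra.
apply Rlt_div_l in H2; lra.
Qed.
End Laurent.

Lemma lcoef_pow_shift h (k : nat) n s : lcoef (fun u => u ^ k * h u)%C n s = lcoef h (n + Z.of_nat k) s.
Proof.
revert n. induction k; intros n.
- rewrite Z.add_0_r. apply lcoef_ext. intros; simpl; ring.
- rewrite (lcoef_ext _ (fun u => u * (u ^ k * h u))%C) by (intros; simpl; ring).
  rewrite lcoef_shift, IHk. f_equal. lia.
Qed.

(** [p] is the first index with a nonzero coefficient, provided by [laurent_zero]. Below it the
    products [u ^ k * h u] still tend to 0, so [laurent_lim_1] applies again after each
    multiplication by [u]. *)
Lemma laurent_leading (h : C -> C) (R0 : R) : 0 < R0 ->
  (forall u, R0 < Cmod u -> cdiff h u) -> lim_infty h 0 ->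
  (exists u, R0 < Cmod u /\ h u <> 0%C) ->
  exists (p : nat) (b b' : C), (1 <= p)%nat /\ b <> 0%C /\
    lim_infty (fun u => u ^ p * h u)%C b /\
    lim_infty (fun u => u * (u ^ p * h u - b))%C b'.
Proof.
intros HR Hd Hl [u1 [Hu1 Hne]].
set (s := ln (R0 + 1)).
assert (Hs : R0 < exp s) by (unfold s; rewrite exp_ln; lra).
assert (Hex : exists n : nat, lcoef h (Z.of_nat (S n)) s <> 0%C).
{ apply NNPP. intros Hn. apply Hne.
  apply (laurent_zero h R0 HR Hd Hl s Hs); auto. intros n. apply NNPP. intros h0. apply Hn. now exists n. }
assert (Hmin : exists n : nat, lcoef h (Z.of_nat (S n)) s <> 0%C /\
   forall j : nat, (j < n)%nat -> lcoef h (Z.of_nat (S j)) s = 0%C).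
{ apply NNPP. intros Hno. destruct Hex as [n Hn]. revert Hn. 
  induction n as [n IH] using (well_founded_induction lt_wf). intros Hn. apply Hno. exists n.
  split; auto. intros j Hj. apply NNPP. intros hj. now apply (IH j Hj). }
destruct Hmin as [n [Hn Hj]].
assert (Hdk : forall k u, R0 < Cmod u -> cdiff (fun u => u ^ k * h u)%C u).
{ intros k u Hu. apply cdiff_mult; [apply cdiff_pow|auto]. }
assert (Hk : forall k, (k <= n)%nat -> lim_infty (fun u => u ^ k * h u)%C 0).
{ induction k; intros Hkn.
  - apply (lim_infty_ext h _ _ 0); auto. intros; simpl; ring.
  - assert (L := laurent_lim_1 _ R0 HR (Hdk k) (IHk ltac:(lia)) s Hs).
    rewrite lcoef_pow_shift in L. replace (1 + Z.of_nat k)%Z with (Z.of_nat (S k)) in L by lia.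
    rewrite Hj in L by lia.
    revert L. apply (lim_infty_ext _ _ _ 0). intros; simpl; ring. }
set (b := lcoef h (Z.of_nat (S n)) s) in *.
assert (Hb : lim_infty (fun u => u ^ S n * h u)%C b).
{ assert (L := laurent_lim_1 _ R0 HR (Hdk n) (Hk n (Nat.le_refl n)) s Hs).
  rewrite lcoef_pow_shift in L. replace (1 + Z.of_nat n)%Z with (Z.of_nat (S n)) in L by lia.
  revert L. apply (lim_infty_ext _ _ _ 0). intros; simpl; ring. }
exists (S n), b, (lcoef (fun u => u ^ S n * h u - b)%C 1 s).
split; [lia|]. split; [exact Hn|]. split; [exact Hb|].
apply (laurent_lim_1 (fun u => u ^ S n * h u - b)%C R0 HR); auto.
- intros u Hu. apply cdiff_minus; [now apply Hdk|apply cdiff_const].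
- replace (RtoC 0) with (b - b)%C by ring. apply lim_infty_minus; [exact Hb|apply lim_infty_const].
Qed.

(** * Exterior maps of shapes *)

Lemma compact_set_bounded (S : C -> Prop) : compact_set S ->
  exists M, 0 < M /\ forall z, M < Cmod z -> ~ S z.
Proof.
intros HS.
destruct (HS nat (fun n z => Cmod z < INR n)) as [l Hl].
- intros n z Hz. apply locally_Cmod. exists (INR n - Cmod z). split; [lra|].
  intros y Hy. assert (X := Cmod_sub_le y z). lra.
- intros z _. destruct (nfloor_ex (Cmod z) (Cmod_ge_0 z)) as [n Hn].
  exists (n + 1)%nat. rewrite plus_INR. simpl. lra.
- exists (INR (list_max l) + 1). split; [generalize (pos_INR (list_max l)); lra|].
  intros z Hz Sz. destruct (Hl z Sz) as [i [Hi Hzi]].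
  assert (Hm : (i <= list_max l)%nat).
  { assert (F := proj1 (list_max_le l (list_max l)) (Nat.le_refl _)).
    rewrite Forall_forall in F. now apply F. }
  apply le_INR in Hm. lra.
Qed.

Lemma compact_set_closed (S : C -> Prop) (x : C) : compact_set S -> ~ S x ->
  exists e, 0 < e /\ forall z, Cmod (z - x) < e -> ~ S z.
Proof.
intros HS Hx.
destruct (HS nat (fun n z => / (INR n + 1) < Cmod (z - x))) as [l Hl].
- intros n z Hz. apply locally_Cmod. exists (Cmod (z - x) - / (INR n + 1)). split; [lra|].
  intros y Hy. assert (X := Cmod_sub_le (z - x) (z - y)).
  replace (z - x - (z - y))%C with (y - x)%C in X by ring. rewrite (Cmod_sub_sym z y) in X. lra.
- intros z Hz. assert (Hp : 0 < Cmod (z - x)).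
  { apply Cmod_gt_0. intros E. apply Hx. replace x with z; auto.
    replace z with (z - x + x)%C by ring. rewrite E. ring. }
  destruct (nfloor_ex (/ Cmod (z - x))) as [n Hn].
  { left. now apply Rinv_0_lt_compat. }
  exists n. rewrite <- (Rinv_inv (Cmod (z - x))). apply Rinv_lt_contravar; [|lra].
  apply Rmult_lt_0_compat; [now apply Rinv_0_lt_compat|]. generalize (pos_INR n); lra.
- exists (/ (INR (list_max l) + 1)).
  split; [apply Rinv_0_lt_compat; generalize (pos_INR (list_max l)); lra|].
  intros z Hz Sz. destruct (Hl z Sz) as [i [Hi Hzi]].
  assert (Hm : (i <= list_max l)%nat).
  { assert (F := proj1 (list_max_le l (list_max l)) (Nat.le_refl _)).
    rewrite Forall_forall in F. now apply F. }
  apply le_INR in Hm.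
  assert (/ (INR (list_max l) + 1) <= / (INR i + 1)).
  { apply Rinv_le_contravar; [generalize (pos_INR i)|]; lra. }
  lra.
Qed.

Lemma sum_n_incr (a : nat -> R) (Ha : forall k, 0 <= a k) (A : R) :
  is_series a A -> forall n, sum_n a n <= A.
Proof.
intros HA n. apply (is_lim_seq_incr_compare (sum_n a) A HA).
intros k. rewrite sum_Sn. unfold plus; simpl. generalize (Ha (S k)). lra.
Qed.

(** The Weierstrass test with an explicit tail: differences of partial sums are dominated term by
    term, and the bound passes to the limit. *)
Lemma series_tail_bound (t : nat -> C) (a : nat -> R) (l : C) (A : R) (N : nat) :
  (forall k, Cmod (t k) <= a k) -> is_series a A ->
  @is_series C_AbsRing C_NormedModule t l ->
  Cmod (l - @sum_n C_AbelianGroup t N) <= A - sum_n a N.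
Proof.
intros Hta HA Hl.
assert (Ha : forall k, 0 <= a k) by (intros k; eapply Rle_trans; [apply Cmod_ge_0|apply Hta]).
assert (Hinc : forall j, Cmod (@sum_n C_AbelianGroup t (j + N) - @sum_n C_AbelianGroup t N) <= sum_n a (j + N) - sum_n a N).
{ induction j.
  - simpl. replace (@sum_n C_AbelianGroup t N - @sum_n C_AbelianGroup t N)%C with (RtoC 0) by ring.
    rewrite Cmod_0. lra.
  - change (S j + N)%nat with (S (j + N)). rewrite !sum_Sn.
    change (plus (sum_n a (j + N)) (a (S (j + N)))) with (sum_n a (j + N) + a (S (j + N))).
    change (plus (@sum_n C_AbelianGroup t (j + N)) (t (S (j + N)))) with (@sum_n C_AbelianGroup t (j + N) + t (S (j + N)))%C.
    replace (@sum_n C_AbelianGroup t (j + N) + t (S (j + N)) - @sum_n C_AbelianGroup t N)%C with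
      (@sum_n C_AbelianGroup t (j + N) - @sum_n C_AbelianGroup t N + t (S (j + N)))%C by ring.
    eapply Rle_trans; [apply Cmod_triangle|]. generalize (Hta (S (j + N))). lra. }
apply le_epsilon. intros eps He.
assert (HP : locally l (fun y => Cmod (y - l) < eps)) by (apply locally_Cmod; exists eps; auto).
destruct (Hl _ HP) as [M HM].
specialize (HM (M + N)%nat ltac:(lia)). specialize (Hinc M).
assert (HS := sum_n_incr a Ha A HA (M + N)).
change (@sum_n (NormedModule.AbelianGroup C_AbsRing C_NormedModule) t (M + N)) with (@sum_n C_AbelianGroup t (M + N)) in HM.
assert (X := Cmod_triangle (@sum_n C_AbelianGroup t (M + N) - @sum_n C_AbelianGroup t N)
   (l - @sum_n C_AbelianGroup t (M + N))).
replace (@sum_n C_AbelianGroup t (M + N) - @sum_n C_AbelianGroup t N + (l - @sum_n C_AbelianGroup t (M + N)))%C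
  with (l - @sum_n C_AbelianGroup t N)%C in X by ring.
rewrite (Cmod_sub_sym l (@sum_n C_AbelianGroup t (M + N))) in X.
refine (Rle_trans _ _ _ X _).
apply Rle_trans with ((sum_n a (M + N) - sum_n a N) + eps).
- apply Rplus_le_compat; [exact Hinc|left; exact HM].
- apply Rplus_le_compat_r, Rplus_le_compat_r. exact HS.
Qed.

Lemma laurent_map_bound c1 c f : laurent_map c1 c f ->
  exists B, 0 <= B /\ forall z, closed_Omega z -> Cmod (f z - c1 * z) <= B.
Proof.
intros [_ [[A HA] Hf]].
assert (Hnn : forall k : nat, 0 <= Cmod (c k)) by (intros; apply Cmod_ge_0).
exists (A + Cmod (c 0%nat)). split.
{ assert (X := sum_n_incr _ Hnn A HA 0). rewrite sum_O in X. generalize (Hnn 0%nat). lra. }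
intros z Hz. assert (Hz0 : z <> 0%C). { apply Cmod_gt_0. unfold closed_Omega in Hz. lra. }
assert (Hterm : forall k, Cmod (c k / z ^ S k) <= Cmod (c k)).
{ intros k. rewrite Cmod_div by (now apply Cpow_nz). rewrite Cmod_pow.
  assert (1 <= Cmod z ^ S k) by (apply pow_R1_Rle; exact Hz).
  apply Rle_div_l; [lra|]. generalize (Hnn k). nra. }
assert (X : Cmod (f z - c1 * z - c 0%nat / z ^ 1) <= A - Cmod (c 0%nat)).
{ assert (X := series_tail_bound _ _ _ _ 0%nat Hterm HA (Hf z Hz)).
  rewrite !sum_O in X. exact X. }
assert (Y := Cmod_sub_le (f z - c1 * z) (c 0%nat / z ^ 1)).
generalize (Hterm 0%nat) (Hnn 0%nat). lra.
Qed.

Lemma laurent_map_continuous c1 c f : laurent_map c1 c f -> forall z, closed_Omega z ->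
  forall eps, 0 < eps -> exists d, 0 < d /\
    forall y, closed_Omega y -> Cmod (y - z) < d -> Cmod (f y - f z) < eps.
Proof.
intros [_ [[A HA] Hf]] z Hz eps He.
assert (Hnn : forall k : nat, 0 <= Cmod (c k)) by (intros; apply Cmod_ge_0).
assert (Hterm : forall z, closed_Omega z -> forall k, Cmod (c k / z ^ S k) <= Cmod (c k)).
{ intros y Hy k. assert (Hy0 : y <> 0%C). { apply Cmod_gt_0. unfold closed_Omega in Hy. lra. }
  rewrite Cmod_div by (now apply Cpow_nz). rewrite Cmod_pow.
  assert (1 <= Cmod y ^ S k) by (apply pow_R1_Rle; exact Hy).
  apply Rle_div_l; [lra|]. generalize (Hnn k). nra. }
assert (HN : exists N, A - sum_n (fun k => Cmod (c k)) N < eps / 3).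
{ assert (HP : locally A (fun y => Rabs (y - A) < eps / 3)).
  { apply locally_R. exists (eps / 3). split; [lra|auto]. }
  destruct (HA _ HP) as [N HN]. exists N. specialize (HN N (Nat.le_refl N)).
  change (Rabs (sum_n (fun k => Cmod (c k)) N - A) < eps / 3) in HN.
  apply Rabs_def2 in HN. lra. }
destruct HN as [N HN].
set (P := fun N z => (c1 * z + @sum_n C_AbelianGroup (fun k => c k / z ^ S k)%C N)%C).
assert (HP : forall y, closed_Omega y -> Cmod (f y - P N y) < eps / 3).
{ intros y Hy. assert (X := series_tail_bound _ _ _ _ N (Hterm y Hy) HA (Hf y Hy)).
  unfold P. replace (f y - (c1 * y + @sum_n C_AbelianGroup (fun k => c k / y ^ S k)%C N))%C with
   (f y - c1 * y - @sum_n C_AbelianGroup (fun k => c k / y ^ S k)%C N)%C by ring. lra. }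
assert (Hz0 : z <> 0%C). { apply Cmod_gt_0. unfold closed_Omega in Hz. lra. }
assert (Hcd : cdiff (P N) z).
{ apply cdiff_plus; [apply cdiff_mult; [apply cdiff_const|apply cdiff_id]|].
  assert (Ht : forall k, cdiff (fun z => c k / z ^ S k)%C z).
  { intros k. apply cdiff_div; [apply cdiff_const|apply cdiff_pow|now apply Cpow_nz]. }
  clear HN HP. induction N.
  - apply (cdiff_ext_loc (fun z => c 0%nat / z ^ 1)%C); [|apply Ht].
    apply filter_forall. intros y. now rewrite sum_O.
  - apply (cdiff_ext_loc (fun z => @sum_n C_AbelianGroup (fun k => c k / z ^ S k)%C N + c (S N) / z ^ S (S N))%C).
    + apply filter_forall. intros y. now rewrite sum_Sn.
    + apply cdiff_plus; [exact IHN|apply Ht]. }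
apply cdiff_continuous in Hcd.
destruct (proj1 (locally_Cmod _ _) (proj1 (continuous_Cmod _ _) Hcd (eps / 3) ltac:(lra))) as [d [Hd H]].
exists d. split; auto. intros y Hy Hyz. specialize (H y Hyz).
assert (H1 := HP y Hy). assert (H2 := HP z Hz).
replace (f y - f z)%C with ((f y - P N y) + ((P N y - P N z) - (f z - P N z)))%C by ring.
eapply Rle_lt_trans; [apply Cmod_triangle|].
assert (X := Cmod_minus_le (P N y - P N z) (f z - P N z)). lra.
Qed.

(** For an expression in [f z] this speaks only of exterior points near the boundary, a form that
    can be transported by a rotation of the shape. *)
Definition bdry_lim (E : C -> R) (K : R) : Prop :=
  forall eps, 0 < eps -> exists d, 0 < d /\
    forall z, Omega z -> Cmod z < 1 + d -> Rabs (E z - K) < eps.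

Lemma Omega_cexp z : Omega z -> exists s t, 0 < s /\ 0 <= t <= 2 * PI /\ z = cexp (s, t) /\ exp s = Cmod z.
Proof.
unfold Omega. intros Hz. destruct (cexp_log_polar z) as [t [Ht E]].
- apply Cmod_gt_0. lra.
- exists (ln (Cmod z)), t. split; [|split; [auto|split; [auto|apply exp_ln; lra]]].
  rewrite <- ln_1. apply ln_increasing; lra.
Qed.

Lemma cexp_near (s t e : R) : 0 < e -> exists d, 0 < d /\ forall s' t',
  Rabs (s' - s) < d -> Rabs (t' - t) < d -> Cmod (cexp (s', t') - cexp (s, t)) < e.
Proof.
intros He. assert (H := cdiff_continuous _ _ (cdiff_cexp (s, t))).
destruct (proj1 (locally_Cmod _ _) (proj1 (continuous_Cmod _ _) H e He)) as [d [Hd Hcont]].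
exists (d / 2). split; [lra|]. intros s' t' Hs Ht. apply Hcont.
assert (E : ((s', t') - (s, t))%C = (RtoC (s' - s) + Ci * RtoC (t' - t))%C)
  by (apply injective_projections; simpl; ring).
rewrite E. eapply Rle_lt_trans; [apply Cmod_triangle|].
rewrite Cmod_mult, Cmod_Ci, !Cmod_R. lra.
Qed.

Lemma near_circle (P : C -> Prop) :
  (forall z, Cmod z = 1 -> exists e, 0 < e /\ forall y, Omega y -> Cmod (y - z) < e -> P y) ->
  exists d, 0 < d /\ forall z, Omega z -> Cmod z < 1 + d -> P z.
Proof.
intros H.
destruct (compact_rect (fun e _ t => forall s, 0 < s < e -> P (cexp (s, t))) 0 0 0 (2 * PI)) as [d [Hd HH]].
- intros e e' _s t He HH s Hs. apply HH. lra.
- intros x t _ Ht0. destruct (H (cexp (0, t))) as [e [He HP]].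
  { rewrite Cmod_cexp. simpl. apply exp_0. }
  destruct (cexp_near 0 t e He) as [d [Hd Hn]]. exists d. split; auto.
  intros x' t' _ Ht' s Hs. apply HP.
  + unfold Omega. rewrite Cmod_cexp. simpl. rewrite <- exp_0. apply exp_increasing. lra.
  + apply Hn; auto. rewrite Rminus_0_r, Rabs_pos_eq; lra.
- exists d. split; auto. intros z Hz Hzd.
  destruct (Omega_cexp z Hz) as [s [t [Hs [Ht [-> Es]]]]].
  apply (HH 0 t); auto; [lra|]. split; auto. apply exp_lt_inv.
  rewrite Es. generalize (exp_ineq1_le d). lra.
Qed.

Section Shape.
Variables (S0 : C -> Prop) (f : C -> C).
Hypothesis hS0 : shape S0 f.



Lemma shape_holo z : Omega z -> cdiff f z.
Proof. destruct hS0 as [_ [_ [H _]]]. apply H. Qed.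

Lemma shape_inj z z' : Omega z -> Omega z' -> f z = f z' -> z = z'.
Proof. destruct hS0 as [_ [_ [_ [H _]]]]. apply H. Qed.

Lemma shape_ext z : Omega z -> ~ S0 (f z).
Proof. destruct hS0 as [_ [_ [_ [_ [H _]]]]]. intros Hz. apply H. eauto. Qed.

Lemma shape_surj x : ~ S0 x -> exists z, Omega z /\ f z = x.
Proof. destruct hS0 as [_ [_ [_ [_ [H _]]]]]. apply H. Qed.

Lemma shape_asymp : exists (c1 : C) (B : R), c1 <> 0%C /\ 0 <= B /\
  forall z, Omega z -> Cmod (f z - c1 * z) <= B.
Proof.
destruct hS0 as [_ [_ [_ [_ [_ [c1 [c Hc]]]]]]].
destruct (laurent_map_bound _ _ _ Hc) as [B [HB H]].
exists c1, B. split; [apply Hc|]. split; auto. intros z Hz. apply H.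
unfold Omega in Hz. unfold closed_Omega. lra.
Qed.

Lemma shape_cont z : closed_Omega z -> forall eps, 0 < eps -> exists d, 0 < d /\
    forall y, closed_Omega y -> Cmod (y - z) < d -> Cmod (f y - f z) < eps.
Proof.
destruct hS0 as [_ [_ [_ [_ [_ [c1 [c Hc]]]]]]]. exact (laurent_map_continuous _ _ _ Hc z).
Qed.

Lemma shape_infty R0 : exists R1, forall z, Omega z -> R1 < Cmod z -> R0 < Cmod (f z).
Proof.
destruct shape_asymp as [c1 [B [Hc1 [HB H]]]]. apply Cmod_gt_0 in Hc1.
exists ((R0 + B) / Cmod c1). intros z Hz Hzz.
apply Rlt_div_l in Hzz; auto. specialize (H z Hz).
assert (X := Cmod_sub_le (c1 * z) (f z)). rewrite Cmod_sub_sym, Cmod_mult in X. lra.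
Qed.

(** If [f z = f z'] with [z'] in [Omega], some [y] of [Omega] close to [z] has a value [w] very
    close to [f z'] and not taken on a disc around [z']. Then [1 / (f - w)] is larger at the centre
    of that disc than on its boundary. *)
Lemma unit_circle_in_shape z : Cmod z = 1 -> S0 (f z).
Proof.
intros Hz. apply NNPP. intros Hn. destruct (shape_surj _ Hn) as [z' [Hz' E]].
unfold Omega in Hz'. set (rho := (Cmod z' - 1) / 2).
assert (Hr : 0 < rho) by (unfold rho; lra).
assert (Hdisk : forall u, Cmod (u - z') <= rho -> 1 + rho <= Cmod u).
{ intros u Hu. assert (X := Cmod_sub_le z' u). rewrite Cmod_sub_sym in X. unfold rho in *. lra. }
set (g := fun v => (/ (f (z' + v) - f z'))%C).
assert (Hg : cont_circle g (ln rho)).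
{ intros v Hv. rewrite exp_ln in Hv by auto.
  assert (Hv1 : Omega (z' + v)).
  { unfold Omega. assert (1 + rho <= Cmod (z' + v)); [|lra].
    apply Hdisk. replace (z' + v - z')%C with v by ring. lra. }
  apply (cdiff_continuous g v). apply (cdiff_comp Cinv (fun v => f (z' + v) - f z')%C).
  - apply cdiff_Cinv. intros E0. assert (Ez : (z' + v)%C = z').
    { apply shape_inj; auto. replace (f (z' + v)) with (f (z' + v) - f z' + f z')%C by ring.
      rewrite E0. ring. }
    assert (v = 0%C) by (replace v with (z' + v - z')%C by ring; rewrite Ez; ring).
    subst v. rewrite Cmod_0 in Hv. lra.
  - apply cdiff_minus; [|apply cdiff_const].
    apply (cdiff_comp f (fun v => z' + v)%C); [now apply shape_holo|].
    apply cdiff_plus; [apply cdiff_const|apply cdiff_id]. }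
destruct (circle_bounded g (ln rho) Hg) as [M [HM HMb]].
rewrite exp_ln in HMb by auto.
assert (HMi : 0 < / M) by now apply Rinv_0_lt_compat.
assert (Hmin : forall u, Cmod (u - z') = rho -> / M <= Cmod (f u - f z')).
{ intros u Hu. specialize (HMb _ Hu). unfold g in HMb.
  replace (z' + (u - z'))%C with u in HMb by ring.
  destruct (Req_dec (Cmod (f u - f z')) 0) as [h0|h0].
  - exfalso. apply Cmod_eq_0 in h0.
    assert (Ez : u = z').
    { apply shape_inj; auto. unfold Omega. specialize (Hdisk u ltac:(lra)). lra.
      replace (f u) with (f u - f z' + f z')%C by ring. rewrite h0. ring. }
    rewrite Ez in Hu. replace (z' - z')%C with (RtoC 0) in Hu by ring. rewrite Cmod_0 in Hu. lra.
  - assert (Hp : 0 < Cmod (f u - f z')) by (generalize (Cmod_ge_0 (f u - f z')); lra).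
    rewrite Cmod_inv in HMb by (now apply Cmod_gt_0).
    rewrite <- (Rinv_inv (Cmod _)). apply Rinv_le_contravar; auto. now apply Rinv_0_lt_compat. }
assert (Hz1 : closed_Omega z) by (unfold closed_Omega; lra).
destruct (shape_cont z Hz1 (/ M / 2)) as [d [Hd Hcont]]; [lra|].
(* [tau <= rho / 2] keeps [y] outside the disc around [z'], whose points have modulus at least
   [1 + rho]; [tau <= d / 2] brings [f y] within half of the lower bound [/ M]. *)
set (tau := Rmin (d / 2) (rho / 2)).
assert (Ht : 0 < tau) by (apply Rmin_pos; lra).
assert (Ht1 : tau <= d / 2) by apply Rmin_l. assert (Ht2 : tau <= rho / 2) by apply Rmin_r.
set (y := (RtoC (1 + tau) * z)%C).
assert (Hy : Cmod y = 1 + tau). { unfold y. rewrite Cmod_mult, Cmod_R, Hz, Rabs_pos_eq; lra. }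
assert (Hyz : Cmod (y - z) < d).
{ unfold y. replace (RtoC (1 + tau) * z - z)%C with (RtoC tau * z)%C by (rewrite RtoC_plus; ring).
  rewrite Cmod_mult, Cmod_R, Hz, Rabs_pos_eq; lra. }
assert (Hw := Hcont y ltac:(unfold closed_Omega; lra) Hyz). rewrite <- E in Hw.
set (w := f y) in *.
assert (Hny : forall u, Cmod (u - z') <= rho -> (f u - w)%C <> 0%C).
{ intros u Hu E0. assert (u = y).
  { apply shape_inj; [specialize (Hdisk u Hu); unfold Omega; lra|unfold Omega; lra|].
    fold w. replace (f u) with (f u - w + w)%C by ring. rewrite E0. ring. }
  subst u. specialize (Hdisk y Hu). lra. }
assert (MP : Cmod (/ (f z' - w)) <= / (/ M / 2)).
{ apply (max_modulus_center (fun u => / (f u - w))%C z' rho); auto.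
  - intros u Hu. apply (cdiff_comp Cinv (fun u => f u - w)%C); [apply cdiff_Cinv; auto|].
    apply cdiff_minus; [|apply cdiff_const]. apply shape_holo. specialize (Hdisk u Hu). unfold Omega; lra.
  - intros u Hu. rewrite Cmod_inv by (apply Hny; lra). apply Rinv_le_contravar; [lra|].
    specialize (Hmin u Hu). assert (X := Cmod_sub_le (f u - f z') (w - f z')).
    replace (f u - f z' - (w - f z'))%C with (f u - w)%C in X by ring. lra. }
assert (Hnz : (f z' - w)%C <> 0%C).
{ apply Hny. replace (z' - z')%C with (RtoC 0) by ring. rewrite Cmod_0. lra. }
rewrite Cmod_inv in MP by auto. apply Cmod_gt_0 in Hnz.
rewrite Cmod_sub_sym in Hw.
assert (/ (/ M / 2) < / Cmod (f z' - w)) by (apply Rinv_lt_contravar; [apply Rmult_lt_0_compat; lra|lra]).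
lra.
Qed.

(** A form of properness of [f]: on the compact annulus from [1 + d] to [b] the distance of [f z] to
    [y] has a positive minimum, and beyond [b] the value [f z] is too large. *)
Lemma near_shape y d : S0 y -> 0 < d ->
  exists e, 0 < e /\ forall z, Omega z -> Cmod (f z - y) < e -> Cmod z < 1 + d.
Proof.
intros Hy Hd.
destruct (shape_infty (Cmod y + 1)) as [R1 HR1].
set (b := Rmax R1 (1 + d)).
assert (Hb1 : R1 <= b) by apply Rmax_l. assert (Hb2 : 1 + d <= b) by apply Rmax_r.
destruct (compact_rect (fun e s t => e <= Cmod (f (cexp (s, t)) - y)) (ln (1 + d)) (ln b) 0 (2 * PI)) as [e [He HH]].
- intros e e' s t He H. lra.
- intros s t Hs Ht. set (z := cexp (s, t)).
  assert (Hz : Omega z).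
  { unfold Omega, z. rewrite Cmod_cexp. simpl. rewrite <- exp_0. apply exp_increasing.
    assert (ln 1 < ln (1 + d)) by (apply ln_increasing; lra). rewrite ln_1 in H. lra. }
  assert (Hp : 0 < Cmod (f z - y)).
  { apply Cmod_gt_0. intros E. apply (shape_ext z Hz). replace (f z) with (f z - y + y)%C by ring.
    rewrite E. replace (0 + y)%C with y by ring. exact Hy. }
  assert (Hc := cdiff_continuous _ _ (shape_holo z Hz)).
  destruct (proj1 (locally_Cmod _ _) (proj1 (continuous_Cmod _ _) Hc (Cmod (f z - y) / 2) ltac:(lra))) as [e1 [He1 H1]].
  destruct (cexp_near s t e1 He1) as [e2 [He2 H2]].
  exists (Rmin e2 (Cmod (f z - y) / 2)). split; [apply Rmin_pos; lra|].
  intros s' t' Hs' Ht'. assert (L1 := Rmin_l e2 (Cmod (f z - y) / 2)).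
  assert (L2 := Rmin_r e2 (Cmod (f z - y) / 2)).
  specialize (H1 _ (H2 s' t' ltac:(lra) ltac:(lra))).
  assert (X := Cmod_sub_le (f z - y) (f z - f (cexp (s', t')))).
  replace (f z - y - (f z - f (cexp (s', t'))))%C with (f (cexp (s', t')) - y)%C in X by ring.
  rewrite (Cmod_sub_sym (f z) (f (cexp (s', t')))) in X. lra.
- exists (Rmin e 1). split; [apply Rmin_pos; lra|]. intros z Hz Hzy.
  apply Rnot_le_lt. intros Hge.
  assert (L1 := Rmin_l e 1). assert (L2 := Rmin_r e 1).
  destruct (Rlt_dec b (Cmod z)) as [hb|hb].
  + specialize (HR1 z Hz ltac:(lra)). assert (X := Cmod_sub_le (f z) y). lra.
  + destruct (Omega_cexp z Hz) as [s [t [Hs [Ht [Ez Es]]]]].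
    assert (Hst : ln (1 + d) <= s <= ln b).
    { split; apply exp_le_inv; rewrite exp_ln by lra; lra. }
    specialize (HH s t Hst Ht). rewrite <- Ez in HH. lra.
Qed.
End Shape.

(** * Potentials in the frame of the solid *)

Lemma ivt_on (F : R -> R) (a b : R) : a < b ->
  (forall t, a <= t <= b -> forall eps, 0 < eps -> exists d, 0 < d /\
     forall t', a <= t' <= b -> Rabs (t' - t) < d -> Rabs (F t' - F t) < eps) ->
  F a < 0 -> 0 < F b -> exists t, a <= t <= b /\ F t = 0.
Proof.
intros Hab HF Ha Hb.
(* Clamping to the interval extends [F] to a function continuous on the whole line, as [IVT]
   requires. *)
set (k := fun t => Rmax a (Rmin b t)).
assert (Hk : forall t, a <= k t <= b).
{ intros t. unfold k. split; [apply Rmax_l|]. apply Rmax_lub; [lra|apply Rmin_l]. }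
assert (Hkid : forall t, a <= t <= b -> k t = t).
{ intros t Ht. unfold k. rewrite Rmin_right, Rmax_right; lra. }
assert (Hk1 : forall t t', Rabs (k t' - k t) <= Rabs (t' - t)).
{ intros t t'. unfold k, Rmax, Rmin.
  repeat destruct (Rle_dec _ _); unfold Rabs; repeat destruct (Rcase_abs _); lra. }
destruct (IVT (fun t => F (k t)) a b) as [t [Ht E]].
- intros t eps He. destruct (HF (k t) (Hk t) eps He) as [d [Hd H]].
  exists d. split; auto. intros t' [_ Ht']. apply H; auto.
  eapply Rle_lt_trans; [apply Hk1|]. exact Ht'.
- exact Hab.
- now rewrite Hkid by lra.
- now rewrite Hkid by lra.
- exists (k t). auto.
Qed.

Lemma Im_le_Cmod_minus (a b : C) : Rabs (Im a - Im b) <= Cmod (a - b).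
Proof. change (Im a - Im b) with (Im (a - b)). apply im_le_Cmod. Qed.

Lemma Cmod_abs_minus (a b : C) : Rabs (Cmod a - Cmod b) <= Cmod (a - b).
Proof.
apply Rabs_le. assert (X := Cmod_sub_le a b). assert (Y := Cmod_sub_le b a).
rewrite (Cmod_sub_sym b a) in Y. lra.
Qed.

Lemma Cmod_sqr_minus (a b : C) : Rabs (Cmod a ^ 2 - Cmod b ^ 2) <= Cmod (a - b) * (2 * Cmod b + Cmod (a - b)).
Proof.
replace (Cmod a ^ 2 - Cmod b ^ 2) with ((Cmod a - Cmod b) * (Cmod a + Cmod b)) by ring.
assert (Ha := Cmod_ge_0 a). assert (Hb := Cmod_ge_0 b).
rewrite Rabs_mult, (Rabs_pos_eq (Cmod a + Cmod b)) by lra.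
assert (X := Cmod_sub_le a b).
apply Rmult_le_compat; [apply Rabs_pos|lra|apply Cmod_abs_minus|lra].
Qed.

(** On a circle of radius at least 1 the weight [u ^ n] has modulus at most 1 for [n <= 0], so the
    coefficient is bounded by [h], which is small on large circles. *)
Lemma lcoef_nonpos_zero h R0 n s : 0 < R0 -> (forall u, R0 < Cmod u -> cdiff h u) ->
  lim_infty h 0 -> (n <= 0)%Z -> R0 < exp s -> lcoef h n s = 0%C.
Proof.
intros HR Hd Hl Hn Hs. apply Cmod_eq_0. apply Rle_antisym; [|apply Cmod_ge_0].
apply le_epsilon. intros eps He. rewrite Rplus_0_l.
destruct (Hl eps He) as [R1 H1].
set (m := Rmax 1 (Rmax R0 R1) + 1).
assert (Hm1 := Rmax_l 1 (Rmax R0 R1)). assert (Hm2 := Rmax_r 1 (Rmax R0 R1)).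
assert (Hm3 := Rmax_l R0 R1). assert (Hm4 := Rmax_r R0 R1).
assert (Em : exp (ln m) = m) by (apply exp_ln; unfold m; lra).
rewrite (lcoef_indep h R0 Hd n s (ln m)) by (auto; rewrite Em; unfold m; lra).
apply Rle_trans with (exp (IZR n * ln m) * eps).
- apply lcoef_bound.
  + apply (cont_circle_outside h R0 Hd). rewrite Em. unfold m; lra.
  + intros u Hu. rewrite Em in Hu. specialize (H1 u ltac:(unfold m in Hu; lra)).
    replace (h u - 0)%C with (h u) in H1 by ring. lra.
- rewrite <- (Rmult_1_l eps) at 2. apply Rmult_le_compat_r; [lra|].
  rewrite <- exp_0. apply exp_le_exp.
  assert (0 <= ln m). { rewrite <- ln_1. left. apply ln_increasing; unfold m; lra. }
  assert (IZR n <= 0) by (now apply IZR_le). nra.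
Qed.

(** The slip condition in the solid's frame: neither [r] nor [alpha] is left, the former having been
    absorbed in [K]. *)
Definition potential (S0 : C -> Prop) (f eta : C -> C) (w : C) (om : R) : Prop :=
  (forall u, ~ S0 u -> cdiff eta u) /\ lim_infty eta 0 /\
  exists K, bdry_lim (fun z => Im (eta (f z)) - Im (Cconj w * f z) + om / 2 * Cmod (f z) ^ 2) K.

Section Potential.
Variables (S0 : C -> Prop) (f : C -> C).
Hypothesis hS0 : shape S0 f.

Lemma shape_bounded : exists M, 0 < M /\ forall z, M < Cmod z -> ~ S0 z.
Proof. apply compact_set_bounded. apply hS0. Qed.

Lemma shape_quot_lim : exists c1 : C, c1 <> 0%C /\ lim_infty (fun z => f z / z)%C c1.
Proof.
destruct (shape_asymp S0 f hS0) as [c1 [B [Hc1 [HB H]]]]. exists c1. split; auto.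
intros eps He. exists (Rmax 1 (B / eps)). intros z Hz.
assert (L1 := Rmax_l 1 (B / eps)). assert (L2 := Rmax_r 1 (B / eps)).
assert (Hz0 : z <> 0%C) by (apply Cmod_gt_0; lra).
replace (f z / z - c1)%C with ((f z - c1 * z) / z)%C by (field; auto).
rewrite Cmod_div by auto. apply Rlt_div_l; [lra|].
eapply Rle_lt_trans; [apply H; unfold Omega; lra|].
assert (X : B / eps < Cmod z) by lra. apply Rlt_div_l in X; lra.
Qed.

Lemma potential_comp_lim eta l : lim_infty eta l -> lim_infty (fun z => eta (f z)) l.
Proof.
apply lim_infty_comp. intros R0. destruct (shape_infty S0 f hS0 R0) as [R1 H].
exists (Rmax 1 R1). intros u Hu.
assert (L1 := Rmax_l 1 R1). assert (L2 := Rmax_r 1 R1). apply H; unfold Omega; lra.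
Qed.

Lemma potential_comp_cdiff eta : (forall u, ~ S0 u -> cdiff eta u) ->
  forall z, 1 < Cmod z -> cdiff (fun z => eta (f z)) z.
Proof.
intros H z Hz. apply cdiff_comp.
- apply H. now apply (shape_ext S0 f hS0).
- now apply (shape_holo S0 f hS0).
Qed.

Lemma potential_of_complex r alpha w0 om xi : complex_potential S0 f r alpha w0 om xi ->
  potential S0 f (fun u => xi (Cexpi alpha * u + r)%C) w0 om.
Proof.
intros [Hd [Hl [g [Hg [Hgx [K Hslip]]]]]].
assert (Hee : (Cconj (Cexpi alpha) * Cexpi alpha = 1)%C).
{ rewrite Cmult_comm, <- Cmod2_conj, Cmod_Cexpi. f_equal. ring. }
assert (He0 : Cexpi alpha <> 0%C) by (apply Cmod_gt_0; rewrite Cmod_Cexpi; lra).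
assert (Hext : forall u, ~ S0 u -> exterior (rigid_image alpha r S0) (Cexpi alpha * u + r)).
{ intros u Hu [s [Hs E]]. apply Hu. replace u with s; auto.
  replace s with ((Cexpi alpha * s + r - r) / Cexpi alpha)%C by (field; auto).
  rewrite <- E. field; auto. }
split; [|split].
- intros u Hu. apply (cdiff_comp xi (fun u => Cexpi alpha * u + r)%C).
  + apply Hd. now apply Hext.
  + apply cdiff_plus; [apply cdiff_mult; [apply cdiff_const|apply cdiff_id]|apply cdiff_const].
- intros eps He. destruct (Hl eps He) as [M HM]. destruct shape_bounded as [M0 [HM0 Hb]].
  exists (Rmax M0 (M + Cmod r)). intros u Hu.
  assert (L1 := Rmax_l M0 (M + Cmod r)). assert (L2 := Rmax_r M0 (M + Cmod r)).
  assert (E0 : forall z : C, (z - 0)%C = z) by (intros; ring). rewrite E0.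
  apply HM; [apply Hext, Hb; lra|].
  assert (X := Cmod_sub_le (Cexpi alpha * u) (- r)). rewrite Cmod_opp, Cmod_mult, Cmod_Cexpi in X.
  replace (Cexpi alpha * u - - r)%C with (Cexpi alpha * u + r)%C in X by ring. lra.
(* The added constant is the stream function of the translation evaluated at [r]. *)
- exists (K + Im (Cconj (w0 * Cexpi alpha) * r)).
  intros eps He. apply near_circle. intros z Hz.
  assert (Hzc : closed_Omega z) by (unfold closed_Omega; lra).
  set (b := Cmod (f z)). assert (Hb : 0 <= b) by apply Cmod_ge_0.
  (* A Lipschitz bound near [f z], valid at distance at most 1, for the translational and quadratic
     terms; the last 1 makes it positive. *)
  set (A := Cmod w0 + Rabs om * (2 * b + 1) + 1).
  assert (HA : 0 < A). { unfold A. generalize (Cmod_ge_0 w0) (Rabs_pos om). intros; nra. }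
  destruct (shape_cont S0 f hS0 z Hzc (Rmin 1 (eps / 2 / A))) as [d1 [Hd1 H1]].
  { apply Rmin_pos; [lra|]. apply Rdiv_lt_0_compat; lra. }
  assert (HP : locally (g z) (fun y => Cmod (y - g z) < eps / 2)).
  { apply locally_Cmod. exists (eps / 2). split; [lra|auto]. }
  assert (Hgz := Hg z Hzc _ HP). unfold within, filtermap in Hgz.
  destruct (proj1 (locally_Cmod _ _) Hgz) as [d2 [Hd2 H2]].
  exists (Rmin d1 d2). split; [now apply Rmin_pos|]. intros y Hy Hyz.
  assert (L1 := Rmin_l d1 d2). assert (L2 := Rmin_r d1 d2).
  assert (Hyc : closed_Omega y) by (unfold closed_Omega, Omega in *; lra).
  specialize (H1 y Hyc ltac:(lra)). specialize (H2 y ltac:(lra) Hyc).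
  rewrite <- (Hgx y Hy).
  specialize (Hslip z Hz). cbv zeta in Hslip.
  assert (E1 : (Cconj (w0 * Cexpi alpha) * (Cexpi alpha * f z + r) =
    Cconj w0 * f z + Cconj (w0 * Cexpi alpha) * r)%C).
  { rewrite Cmult_conj.
    transitivity (Cconj w0 * ((Cconj (Cexpi alpha) * Cexpi alpha) * f z) + Cconj w0 * Cconj (Cexpi alpha) * r)%C; [ring|].
    rewrite Hee. ring. }
  rewrite E1 in Hslip.
  replace (Cexpi alpha * f z + r - r)%C with (Cexpi alpha * f z)%C in Hslip by ring.
  rewrite Cmod_mult, Cmod_Cexpi, Rmult_1_l in Hslip.
  change (Im (Cconj w0 * f z + Cconj (w0 * Cexpi alpha) * r)) with
    (Im (Cconj w0 * f z) + Im (Cconj (w0 * Cexpi alpha) * r)) in Hslip.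
  set (df := Cmod (f y - f z)) in *.
  assert (M1 := Rmin_l 1 (eps / 2 / A)). assert (M2 := Rmin_r 1 (eps / 2 / A)).
  assert (Hdf : 0 <= df) by apply Cmod_ge_0.
  replace (Im (g y) - Im (Cconj w0 * f y) + om / 2 * Cmod (f y) ^ 2 - (K + Im (Cconj (w0 * Cexpi alpha) * r)))
    with ((Im (g y) - Im (g z)) + (- (Im (Cconj w0 * f y) - Im (Cconj w0 * f z)) +
       om / 2 * (Cmod (f y) ^ 2 - Cmod (f z) ^ 2))) by (rewrite Hslip; ring).
  eapply Rle_lt_trans; [apply Rabs_triang|].
  eapply Rle_lt_trans; [apply Rplus_le_compat_l, Rabs_triang|].
  rewrite Rabs_Ropp.
  assert (B1 := Im_le_Cmod_minus (g y) (g z)).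
  assert (B2 := Im_le_Cmod_minus (Cconj w0 * f y) (Cconj w0 * f z)).
  replace (Cconj w0 * f y - Cconj w0 * f z)%C with (Cconj w0 * (f y - f z))%C in B2 by ring.
  rewrite Cmod_mult, Cmod_conj in B2. fold df in B2.
  assert (B3 := Cmod_sqr_minus (f y) (f z)). fold df b in B3.
  rewrite Rabs_mult.
  assert (B4 : Rabs (om / 2) <= Rabs om).
  { unfold Rdiv. rewrite Rabs_mult, (Rabs_pos_eq (/ 2)) by lra. generalize (Rabs_pos om). lra. }
  assert (B5 : Rabs (om / 2) * Rabs (Cmod (f y) ^ 2 - Cmod (f z) ^ 2) <= Rabs om * (df * (2 * b + 1))).
  { apply Rmult_le_compat; try apply Rabs_pos; auto. eapply Rle_trans; [exact B3|].
    apply Rmult_le_compat_l; lra. }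
  fold b in B5. fold b.
  assert (B6 : df * A < eps / 2) by (apply Rlt_div_r; [lra|lra]).
  unfold A in B6. lra.
Qed.

(** The coefficients are real because the boundary condition involves an imaginary part and the
    conjugate of [w]. *)
Lemma potential_lin a b eta1 w1 om1 eta2 w2 om2 :
  potential S0 f eta1 w1 om1 -> potential S0 f eta2 w2 om2 ->
  potential S0 f (fun u => RtoC a * eta1 u + RtoC b * eta2 u)%C (RtoC a * w1 + RtoC b * w2)%C (a * om1 + b * om2).
Proof.
intros [D1 [L1 [K1 B1]]] [D2 [L2 [K2 B2]]]. split; [|split].
- intros u Hu. apply cdiff_plus; (apply cdiff_mult; [apply cdiff_const|auto]).
- apply (lim_infty_eq _ (RtoC a * 0 + RtoC b * 0)%C); [ring|].
  apply lim_infty_plus; now apply lim_infty_scal.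
- exists (a * K1 + b * K2). intros eps He.
  set (m := Rabs a + Rabs b + 1).
  assert (Hm : 0 < m) by (unfold m; generalize (Rabs_pos a) (Rabs_pos b); lra).
  assert (Hem : 0 < eps / m) by now apply Rdiv_lt_0_compat.
  destruct (B1 _ Hem) as [d1 [Hd1 H1]]. destruct (B2 _ Hem) as [d2 [Hd2 H2]].
  exists (Rmin d1 d2). split; [now apply Rmin_pos|]. intros z Hz Hzd.
  assert (X1 := Rmin_l d1 d2). assert (X2 := Rmin_r d1 d2).
  specialize (H1 z Hz ltac:(lra)). specialize (H2 z Hz ltac:(lra)).
  match type of H1 with Rabs ?x < _ => set (x1 := x) in * end.
  match type of H2 with Rabs ?x < _ => set (x2 := x) in * end.
  match goal with |- Rabs ?x < _ => replace x with (a * x1 + b * x2) end.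
  2:{ assert (E1 : forall X Y : C, Im (RtoC a * X + RtoC b * Y) = a * Im X + b * Im Y)
        by (intros; unfold Im; simpl; ring).
      assert (E2 : (Cconj (RtoC a * w1 + RtoC b * w2) * f z =
         RtoC a * (Cconj w1 * f z) + RtoC b * (Cconj w2 * f z))%C)
        by (apply injective_projections; simpl; ring).
      rewrite E2, !E1. unfold x1, x2. field. }
  eapply Rle_lt_trans; [apply Rabs_triang|]. rewrite !Rabs_mult.
  assert (Ee : eps = eps / m * Rabs a + eps / m * Rabs b + eps / m) by (unfold m; field; unfold m in Hm; lra).
  assert (Pa := Rabs_pos a). assert (Pb := Rabs_pos b). nra.
Qed.

Lemma potential_ext eta eta' w w' om om' : (forall u, eta u = eta' u) -> w = w' -> om = om' ->
  potential S0 f eta w om -> potential S0 f eta' w' om'.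
Proof.
intros E -> -> [D [L [K B]]]. split; [|split].
- intros u Hu. apply (cdiff_ext_loc eta); auto. now apply filter_forall.
- apply (lim_infty_ext eta _ _ 0); auto.
- exists K. intros eps He. destruct (B eps He) as [d [Hd H]]. exists d; split; auto.
  intros z Hz Hzd. rewrite <- E. auto.
Qed.

(** The function [D] below is [2 i] times the boundary error, hence small on circles close to the
    unit circle. At a positive index neither [Cconj (G u)] nor the constant contributes, since [G]
    has no coefficient of negative index. *)
Lemma potential_coef G w K n : (0 < n)%Z -> (forall z, 1 < Cmod z -> cdiff G z) -> lim_infty G 0 ->
  bdry_lim (fun z => Im (G z) - Im (Cconj w * f z)) K ->
  forall eps, 0 < eps -> exists d, 0 < d /\ forall s, 0 < s < d ->
   Cmod (lcoef G n s - (Cconj w * lcoef f n s - w * (RtoC (exp (2 * IZR n * s)) * Cconj (lcoef f (- n) s)))) <= eps.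
Proof.
intros Hn Hd Hl HB eps He.
(* Bounds the weight [exp (n s)] for [s <= 1]. *)
set (M := exp (IZR n)). assert (HM : 0 < M) by apply exp_pos.
destruct (HB (eps / (2 * M))) as [d [Hd0 H]]; [apply Rdiv_lt_0_compat; lra|].
exists (Rmin 1 (ln (1 + d))).
assert (Hln : 0 < ln (1 + d)) by (rewrite <- ln_1; apply ln_increasing; lra).
split; [apply Rmin_pos; lra|]. intros s [Hs Hsd].
assert (X1 := Rmin_l 1 (ln (1 + d))). assert (X2 := Rmin_r 1 (ln (1 + d))).
assert (Hes : 1 < exp s) by (rewrite <- exp_0; now apply exp_increasing).
assert (Hesd : exp s < 1 + d) by (rewrite <- (exp_ln (1 + d)) by lra; apply exp_increasing; lra).
assert (HG : cont_circle G s) by (apply cont_circle_cdiff; intros u Hu; apply Hd; lra).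
assert (Hf : cont_circle f s).
{ apply cont_circle_cdiff. intros u Hu. apply (shape_holo S0 f hS0). unfold Omega; lra. }
assert (HGc : cont_circle (fun u => Cconj (G u)) s).
{ intros u Hu. apply (continuous_comp G Cconj); [now apply HG|apply continuous_Cconj]. }
assert (Hfc : cont_circle (fun u => Cconj (f u)) s).
{ intros u Hu. apply (continuous_comp f Cconj); [now apply Hf|apply continuous_Cconj]. }
set (D := fun u => ((G u - Cconj (G u)) - (Cconj w * f u - w * Cconj (f u)) - RtoC 2 * Ci * RtoC K)%C).
assert (Hm : forall g h, cont_circle g s -> cont_circle h s -> cont_circle (fun u => g u - h u)%C s).
{ intros g h H1 H2 u Hu. apply continuous_Cminus; auto. }
assert (Hk : forall k : C, cont_circle (fun _ => k) s) by (intros k u _; apply continuous_const).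
assert (ED : lcoef D n s = (lcoef G n s - (Cconj w * lcoef f n s - w * (RtoC (exp (2 * IZR n * s)) * Cconj (lcoef f (- n) s))))%C).
{ unfold D. rewrite !lcoef_minus, !lcoef_scal, !lcoef_conj, lcoef_cst; auto using cont_circle_scal.
  rewrite (lcoef_nonpos_zero G 1 (- n) s); auto; [|lra|lia].
  destruct (Z.eqb_spec n 0); [lia|].
  replace (Cconj 0) with (RtoC 0) by (apply injective_projections; simpl; ring). ring. }
rewrite <- ED.
apply Rle_trans with (exp (IZR n * s) * (eps / M)).
- apply lcoef_bound; [unfold D; auto 10 using cont_circle_scal|].
  intros u Hu.
  assert (E : D u = (RtoC 2 * Ci * RtoC (Im (G u) - Im (Cconj w * f u) - K))%C).
  { unfold D. apply injective_projections; unfold Im; simpl; ring. }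
  rewrite E, !Cmod_mult, Cmod_Ci, !Cmod_R, (Rabs_pos_eq 2) by lra.
  specialize (H u ltac:(unfold Omega; lra) ltac:(lra)).
  replace (eps / M) with (2 * 1 * (eps / (2 * M))) by (field; lra). lra.
- assert (Hexp : exp (IZR n * s) <= M).
  { apply exp_le_exp. assert (1 <= IZR n) by (apply IZR_le; lia). nra. }
  apply Rle_trans with (M * (eps / M)); [|right; field; lra].
  apply Rmult_le_compat_r; [left; now apply Rdiv_lt_0_compat|auto].
Qed.

(** Uniqueness for the boundary problem: the coefficients of [eta o f] are arbitrarily small near
    the unit circle and independent of the radius, so all of them vanish. *)
Lemma potential_zero eta : potential S0 f eta 0 0 -> forall u, ~ S0 u -> eta u = 0%C.
Proof.
intros [Hd [Hl [K HB]]] u Hu.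
set (G := fun z => eta (f z)).
assert (HGd : forall z, 1 < Cmod z -> cdiff G z) by exact (potential_comp_cdiff eta Hd).
assert (HGl : lim_infty G 0) by (now apply potential_comp_lim).
assert (HGB : bdry_lim (fun z => Im (G z) - Im (Cconj 0 * f z)) K).
{ intros eps He. destruct (HB eps He) as [d [Hd0 H]]. exists d; split; auto.
  intros z Hz Hzd. specialize (H z Hz Hzd).
  replace (Im (G z) - Im (Cconj 0 * f z) - K) with
   (Im (eta (f z)) - Im (Cconj 0 * f z) + 0 / 2 * Cmod (f z) ^ 2 - K) by (unfold G; field). exact H. }
destruct (shape_surj S0 f hS0 u Hu) as [z [Hz <-]].
assert (He1 : 1 < exp 1) by (rewrite <- exp_0 at 1; apply exp_increasing; lra).
apply (laurent_zero G 1 Rlt_0_1 HGd HGl 1 He1); [|exact Hz].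
intros k. set (n := Z.of_nat (S k)).
apply Cmod_eq_0. apply Rle_antisym; [|apply Cmod_ge_0].
apply le_epsilon. intros eps He. rewrite Rplus_0_l.
destruct (potential_coef G 0 K n ltac:(unfold n; lia) HGd HGl HGB eps He) as [d [Hd0 H]].
specialize (H (d / 2) ltac:(lra)).
rewrite (lcoef_indep G 1 HGd n 1 (d / 2)); auto.
2:{ rewrite <- exp_0 at 1. apply exp_increasing. lra. }
match type of H with Cmod ?x <= _ => replace x with (lcoef G n (d / 2)) in H end; auto.
replace (Cconj 0) with (RtoC 0) by (apply injective_projections; simpl; ring). ring.
Qed.

(** [beta] is the coefficient of [1 / z] in [f]. The same coefficient of [eta o f] comes from
    [potential_coef] as the circle shrinks to the unit circle, and passing to [u = f z], which is
    asymptotic to [c1 z], multiplies it by [c1]. *)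
Lemma potential_dipole : exists (c1 beta : C), c1 <> 0%C /\
  forall eta w a, potential S0 f eta w 0 -> lim_infty (fun u => u * eta u)%C a ->
    a = (c1 * (Cconj w * beta - w * Cconj c1))%C.
Proof.
destruct shape_quot_lim as [c1 [Hc1 Hlim]].
assert (He1 : 1 < exp 1) by (rewrite <- exp_0 at 1; apply exp_increasing; lra).
assert (Hfd : forall z, 1 < Cmod z -> cdiff f z) by (intros; now apply (shape_holo S0 f hS0)).
assert (Hfm : forall s, 1 < exp s -> lcoef f (- 1) s = c1).
{ assert (Hq : forall u, 1 < Cmod u -> cdiff (fun z => f z / z)%C u).
  { intros u Hu. apply cdiff_div; [auto|apply cdiff_id|apply Cmod_gt_0; lra]. }
  assert (E : forall s, 1 < exp s -> lcoef f (- 1) s = lcoef (fun z => f z / z)%C 0 s).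
  { intros s Hs. change 0%Z with (-1 + 1)%Z. rewrite <- lcoef_shift. apply lcoef_ext.
    intros u Hu. field. apply Cmod_gt_0. lra. }
  intros s Hs. rewrite E by auto.
  apply (lcoef_lim_infty (fun z => f z / z)%C _ _ 1); auto.
  - intros u Hu. apply cdiff_continuous. now apply Hq.
  - intros s' Hs'. now apply (lcoef_indep _ 1 Hq). }
exists c1, (lcoef f 1 1). split; auto. intros eta w a [Hd [Hl [K HB]]] Ha.
set (G := fun z => eta (f z)).
assert (HGd : forall z, 1 < Cmod z -> cdiff G z) by exact (potential_comp_cdiff eta Hd).
assert (HGl : lim_infty G 0) by (now apply potential_comp_lim).
assert (HGB : bdry_lim (fun z => Im (G z) - Im (Cconj w * f z)) K).
{ intros eps He. destruct (HB eps He) as [d [Hd0 H]]. exists d; split; auto.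
  intros z Hz Hzd. specialize (H z Hz Hzd).
  replace (Im (G z) - Im (Cconj w * f z) - K) with
   (Im (eta (f z)) - Im (Cconj w * f z) + 0 / 2 * Cmod (f z) ^ 2 - K) by (unfold G; field). exact H. }
assert (HA := laurent_lim_1 G 1 Rlt_0_1 HGd HGl 1 He1).
set (A := lcoef G 1 1) in *.
assert (HAv : A = (Cconj w * lcoef f 1 1 - w * Cconj c1)%C).
{ set (V := (Cconj w * lcoef f 1 1 - w * Cconj c1)%C).
  assert (Z : (A - V = 0)%C).
  { apply Cmod_eq_0. apply Rle_antisym; [|apply Cmod_ge_0].
    apply le_epsilon. intros eps He. rewrite Rplus_0_l.
    destruct (potential_coef G w K 1 ltac:(lia) HGd HGl HGB (eps / 2) ltac:(lra)) as [d [Hd0 H]].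
    set (m := Cmod (w * Cconj c1) + 1).
    assert (Hm : 0 < m) by (unfold m; generalize (Cmod_ge_0 (w * Cconj c1)); lra).
    assert (Hl2 : 0 < ln (1 + eps / 2 / m)).
    { rewrite <- ln_1. apply ln_increasing; [lra|]. assert (0 < eps / 2 / m) by (apply Rdiv_lt_0_compat; lra). lra. }
    (* The second bound gives [exp (2 s) - 1 <= eps / (2 m)], which controls the radius factor in
       front of [w * Cconj c1]. *)
    set (s := Rmin (d / 2) (ln (1 + eps / 2 / m) / 2)).
    assert (Hs : 0 < s) by (apply Rmin_pos; lra).
    assert (S1 : s <= d / 2) by apply Rmin_l. assert (S2 : s <= ln (1 + eps / 2 / m) / 2) by apply Rmin_r.
    specialize (H s ltac:(lra)).
    assert (Hes : 1 < exp s) by (rewrite <- exp_0; now apply exp_increasing).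
    change (Z.opp 1) with (-1)%Z in H.
    rewrite (lcoef_indep G 1 HGd 1 s 1), (lcoef_indep f 1 Hfd 1 s 1), (Hfm s) in H by auto.
    fold A in H. set (x := exp (2 * 1 * s)) in *.
    assert (Hx1 : 1 < x) by (unfold x; rewrite <- exp_0 at 1; apply exp_increasing; lra).
    assert (Hx2 : x <= 1 + eps / 2 / m).
    { unfold x. rewrite <- (exp_ln (1 + eps / 2 / m)).
      - apply exp_le_exp. lra.
      - assert (0 < eps / 2 / m) by (apply Rdiv_lt_0_compat; lra). lra. }
    replace (A - V)%C with ((A - (Cconj w * lcoef f 1 1 - w * (RtoC x * Cconj c1))) + - (RtoC (x - 1) * (w * Cconj c1)))%C
      by (unfold V; rewrite RtoC_minus; ring).
    eapply Rle_trans; [apply Cmod_triangle|]. rewrite Cmod_opp, Cmod_mult, Cmod_R, Rabs_pos_eq by lra.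
    assert (P := Cmod_ge_0 (w * Cconj c1)).
    assert (Q : (x - 1) * Cmod (w * Cconj c1) <= eps / 2 / m * m).
    { apply Rmult_le_compat; try lra. unfold m; lra. }
    replace (eps / 2 / m * m) with (eps / 2) in Q by (field; lra). lra. }
  replace A with (A - V + V)%C by ring. rewrite Z. ring. }
rewrite <- HAv.
apply (lim_infty_unique (fun z => f z * eta (f z))%C).
- exact (potential_comp_lim (fun u => u * eta u)%C a Ha).
- apply (lim_infty_ext (fun z => (f z / z) * (z * G z))%C _ _ 1).
  + intros z Hz. unfold G. field. apply Cmod_gt_0; lra.
  + now apply lim_infty_mult.
Qed.
End Potential.

(** * Shapes invariant under a quarter turn *)

Section Symmetric.
Variables (S0 : C -> Prop) (f : C -> C).
Hypothesis hS0 : shape S0 f.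
Hypothesis hsym : forall z : C, rigid_image (PI / 2) 0%C S0 z <-> S0 z.

Lemma shape_quarter_turn z : S0 (Ci * z) <-> S0 z.
Proof.
assert (E : Cexpi (PI / 2) = Ci) by (unfold Cexpi; now rewrite cos_PI2, sin_PI2).
assert (Hi : Ci <> 0%C) by (apply Cmod_gt_0; rewrite Cmod_Ci; lra).
split; intros H.
- apply hsym in H. destruct H as [s [Hs Es]]. rewrite E in Es.
  replace z with s; auto. replace z with (Ci * z / Ci)%C by (field; auto).
  rewrite Es. field; auto.
- apply hsym. exists z. split; auto. rewrite E. ring.
Qed.

Lemma Ci_Ci z : (Ci * (Ci * z))%C = (- z)%C.
Proof. apply injective_projections; simpl; ring. Qed.

Lemma shape_half_turn z : S0 (- z) <-> S0 z.
Proof. rewrite <- Ci_Ci, !shape_quarter_turn. tauto. Qed.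

(** Replaces the equivariance of [f]: near the unit circle [Ci * f z] is close to a point of [S0],
    and [near_shape] sends its preimage back near the circle. *)
Lemma quarter_turn_proper d : 0 < d -> exists e, 0 < e /\
  forall z, Omega z -> Cmod z < 1 + e ->
  forall z', Omega z' -> f z' = (Ci * f z)%C -> Cmod z' < 1 + d.
Proof.
intros Hd. apply (near_circle (fun z => forall z', Omega z' -> f z' = (Ci * f z)%C -> Cmod z' < 1 + d)).
intros z Hz.
assert (HS : S0 (Ci * f z)) by (apply shape_quarter_turn, (unit_circle_in_shape S0 f hS0 z Hz)).
destruct (near_shape S0 f hS0 _ d HS Hd) as [e [He H]].
destruct (shape_cont S0 f hS0 z ltac:(unfold closed_Omega; lra) e He) as [e1 [He1 H1]].
exists e1. split; auto. intros y Hy Hyz z' Hz' E. apply H; auto.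
rewrite E. replace (Ci * f y - Ci * f z)%C with (Ci * (f y - f z))%C by ring.
rewrite Cmod_mult, Cmod_Ci, Rmult_1_l. apply H1; auto. unfold closed_Omega, Omega in *; lra.
Qed.

(** The translational stream function at [Ci * u] is that of velocity [- (Ci * w)] at [u], and the
    rotational one depends only on [Cmod u]. *)
Lemma potential_quarter_turn eta w om : potential S0 f eta w om ->
  potential S0 f (fun u => eta (Ci * u)%C) (- (Ci * w))%C om.
Proof.
intros [D [L [K B]]]. split; [|split].
- intros u Hu. apply (cdiff_comp eta (fun u => Ci * u)%C).
  + apply D. now rewrite shape_quarter_turn.
  + apply cdiff_mult; [apply cdiff_const|apply cdiff_id].
- apply (lim_infty_comp eta (fun u => Ci * u)%C); auto. intros R0. exists R0.
  intros u Hu. now rewrite Cmod_mult, Cmod_Ci, Rmult_1_l.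
- exists K. intros eps He. destruct (B eps He) as [d [Hd H]].
  destruct (quarter_turn_proper d Hd) as [e [He1 H1]]. exists e. split; auto.
  intros z Hz Hze.
  destruct (shape_surj S0 f hS0 (Ci * f z)%C) as [z' [Hz' E]].
  { rewrite shape_quarter_turn. now apply (shape_ext S0 f hS0). }
  specialize (H z' Hz' (H1 z Hz Hze z' Hz' E)). rewrite E in H.
  rewrite Cmod_mult, Cmod_Ci, Rmult_1_l in H.
  replace (Cconj (- (Ci * w)) * f z)%C with (Cconj w * (Ci * f z))%C; auto.
  apply injective_projections; simpl; ring.
Qed.

Lemma potential_half_turn eta w om : potential S0 f eta w om ->
  potential S0 f (fun u => eta (- u)%C) (- w)%C om.
Proof.
intros H. apply potential_quarter_turn in H. apply potential_quarter_turn in H.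
refine (potential_ext S0 f _ _ _ _ _ _ _ _ _ H); auto.
- intros u. now rewrite Ci_Ci.
- apply injective_projections; simpl; ring.
Qed.

Lemma lim_infty_rot h l k : Cmod k = 1 -> lim_infty h l -> lim_infty (fun u => h (k * u)%C) l.
Proof.
intros Hk. apply (lim_infty_comp h (fun u => k * u)%C). intros R0. exists R0.
intros u Hu. now rewrite Cmod_mult, Hk, Rmult_1_l.
Qed.

Lemma potential_exterior_cdiff eta w om : potential S0 f eta w om ->
  exists R1, 0 < R1 /\ forall u, R1 < Cmod u -> cdiff eta u.
Proof.
intros [D _]. destruct (shape_bounded S0 f hS0) as [M [HM H]].
exists M. split; auto.
Qed.

(** The two limits say [eta u = - kappa w / u + o(1 / u^2)], with [kappa] the squared modulus of
    [c1]. The power [u ^ 1] matches [expansion_shift] at [p = 1]. *)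
Lemma potential_expansion : exists kappa : C, kappa <> 0%C /\ forall eta w om,
  potential S0 f eta w om ->
  lim_infty (fun u => u ^ 1 * eta u)%C (- (kappa * w))%C /\
  lim_infty (fun u => u * (u ^ 1 * eta u - - (kappa * w)))%C 0.
Proof.
destruct (potential_dipole S0 f hS0) as [c1 [beta [Hc1 Hdip]]].
exists (c1 * Cconj c1)%C. split.
{ rewrite <- Cmod2_conj. intros E. apply RtoC_inj in E. apply Cmod_gt_0 in Hc1. nra. }
intros eta w om Hp.
destruct (potential_exterior_cdiff _ _ _ Hp) as [R1 [HR1 Hd]].
assert (Hl : lim_infty eta 0) by apply Hp.
set (s := ln (R1 + 1)).
assert (Hs : R1 < exp s) by (unfold s; rewrite exp_ln; lra).
set (a1 := lcoef eta 1 s).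
assert (H1 : lim_infty (fun u => u * eta u)%C a1) by exact (laurent_lim_1 eta R1 HR1 Hd Hl s Hs).
set (h := fun u => (u * eta u - a1)%C).
assert (Hhd : forall u, R1 < Cmod u -> cdiff h u).
{ intros u Hu. apply cdiff_minus; [apply cdiff_mult; [apply cdiff_id|auto]|apply cdiff_const]. }
assert (Hhl : lim_infty h 0).
{ apply (lim_infty_eq _ (a1 - a1)%C); [ring|]. apply lim_infty_minus; [exact H1|apply lim_infty_const]. }
set (a2 := lcoef h 1 s).
assert (H2 : lim_infty (fun u => u * h u)%C a2) by exact (laurent_lim_1 h R1 HR1 Hhd Hhl s Hs).
assert (Hi : Cmod Ci = 1) by apply Cmod_Ci.
assert (Hm1 : Cmod (- (1)) = 1) by apply Cmod_m1.
(* The dipole formula for the odd part of [eta] and for its quarter turn removes the [beta] term. *)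
assert (Ha1 : a1 = (- (c1 * Cconj c1 * w))%C).
{ set (T := fun u => (RtoC 1 * eta u + RtoC (-1) * eta (- u))%C).
  assert (HT : potential S0 f T (RtoC 2 * w)%C 0).
  { refine (potential_ext S0 f _ _ _ _ _ _ (fun u => eq_refl) _ _
      (potential_lin S0 f 1 (-1) _ _ _ _ _ _ Hp (potential_half_turn _ _ _ Hp))).
    - apply injective_projections; simpl; ring.
    - ring. }
  assert (LT : lim_infty (fun u => u * T u)%C (RtoC 2 * a1)%C).
  { apply (lim_infty_eq _ (a1 + a1)%C); [apply injective_projections; simpl; ring|].
    apply (lim_infty_ext (fun u => u * eta u + (- (1) * u) * eta (- (1) * u))%C _ _ 0).
    - intros u _. unfold T. replace (- (1) * u)%C with (- u)%C by ring.
      apply injective_projections; simpl; ring.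
    - apply lim_infty_plus; auto.
      exact (lim_infty_rot (fun u => u * eta u)%C a1 _ Hm1 H1). }
  assert (E1 := Hdip _ _ _ HT LT).
  assert (LT' : lim_infty (fun u => u * T (Ci * u))%C (- Ci * (RtoC 2 * a1))%C).
  { apply (lim_infty_ext (fun u => - Ci * ((Ci * u) * T (Ci * u)))%C _ _ 0).
    - intros u _. apply injective_projections; simpl; ring.
    - apply lim_infty_scal. exact (lim_infty_rot (fun u => u * T u)%C _ _ Hi LT). }
  assert (E2 := Hdip _ _ _ (potential_quarter_turn _ _ _ HT) LT').
  assert (E2' : (RtoC 2 * a1 = Ci * (c1 * (Cconj (- (Ci * (RtoC 2 * w))) * beta - - (Ci * (RtoC 2 * w)) * Cconj c1)))%C).
  { rewrite <- E2. apply injective_projections; simpl; ring. }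
  assert (E3 : (RtoC 4 * a1 = RtoC 4 * - (c1 * Cconj c1 * w))%C).
  { replace (RtoC 4 * a1)%C with (RtoC 2 * a1 + RtoC 2 * a1)%C by (apply injective_projections; simpl; ring).
    rewrite E1 at 1. rewrite E2'. apply injective_projections; simpl; ring. }
  assert (H4 : RtoC 4 <> 0%C) by (intros E; apply RtoC_inj in E; lra).
  replace a1 with (RtoC 4 * a1 / RtoC 4)%C by (field; auto). rewrite E3. field; auto. }
(* Averaging [eta] with alternating signs over the four quarter turns gives a
   potential at rest, whose [u^-2] coefficient is [4 a2]. *)
assert (Ha2 : a2 = 0%C).
{ set (Z := fun u => (RtoC 1 * (RtoC 1 * eta u + RtoC (-1) * eta (Ci * u)) +
     RtoC 1 * (RtoC 1 * eta (- u) + RtoC (-1) * eta (Ci * - u)))%C).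
  assert (P1 := potential_lin S0 f 1 (-1) _ _ _ _ _ _ Hp (potential_quarter_turn _ _ _ Hp)).
  assert (P2 := potential_half_turn _ _ _ P1).
  assert (HZ : potential S0 f Z 0 0).
  { refine (potential_ext S0 f _ _ _ _ _ _ (fun u => eq_refl) _ _
      (potential_lin S0 f 1 1 _ _ _ _ _ _ P1 P2)).
    - apply injective_projections; simpl; ring.
    - ring. }
  destruct (shape_bounded S0 f hS0) as [M [HM HMb]].
  assert (LZ : lim_infty (fun _ => RtoC 0) (RtoC 4 * a2)%C).
  { apply (lim_infty_eq _ (a2 + a2 + (a2 + a2))%C); [apply injective_projections; simpl; ring|].
    apply (lim_infty_ext (fun u => (u * h u + (Ci * u) * h (Ci * u)) +
       ((- (1) * u) * h (- (1) * u) + (Ci * (- (1) * u)) * h (Ci * (- (1) * u))))%C _ _ M).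
    - intros u Hu. transitivity (u * u * Z u)%C.
      + unfold Z, h. replace (- (1) * u)%C with (- u)%C by ring.
        apply injective_projections; simpl; ring.
      + rewrite (potential_zero S0 f hS0 Z HZ); [ring|auto].
    - apply lim_infty_plus; apply lim_infty_plus.
      + exact H2.
      + exact (lim_infty_rot (fun u => u * h u)%C a2 _ Hi H2).
      + exact (lim_infty_rot (fun u => u * h u)%C a2 _ Hm1 H2).
      + exact (lim_infty_rot (fun u => (Ci * u) * h (Ci * u))%C a2 _ Hm1
          (lim_infty_rot (fun u => u * h u)%C a2 _ Hi H2)). }
  assert (E := lim_infty_unique _ _ _ LZ (lim_infty_const 0)).
  assert (H4 : RtoC 4 <> 0%C) by (intros E'; apply RtoC_inj in E'; lra).
  replace a2 with (RtoC 4 * a2 / RtoC 4)%C by (field; auto). rewrite E. field; auto. }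
rewrite <- Ha1. split.
- revert H1. apply (lim_infty_ext _ _ _ 0). intros u _. simpl. ring.
- rewrite <- Ha2. revert H2. apply (lim_infty_ext _ _ _ 0). intros u _. unfold h. simpl. ring.
Qed.

(** * Symmetric shapes whose boundary lies on a circle *)

Lemma segment_bdry x y : ~ S0 x -> S0 y -> exists t, 0 <= t <= 1 /\
  S0 (x + RtoC t * (y - x))%C /\
  forall e, 0 < e -> exists u, ~ S0 u /\ Cmod (u - (x + RtoC t * (y - x))) < e.
Proof.
intros Hx Hy. set (g := fun t => (x + RtoC t * (y - x))%C).
assert (Hg : forall t t', Cmod (g t' - g t) = Rabs (t' - t) * Cmod (y - x)).
{ intros t t'. unfold g. replace (x + RtoC t' * (y - x) - (x + RtoC t * (y - x)))%C
    with (RtoC (t' - t) * (y - x))%C by (rewrite RtoC_minus; ring).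
  now rewrite Cmod_mult, Cmod_R. }
assert (Hc : forall t e, 0 < e -> exists d, 0 < d /\ forall t', Rabs (t' - t) < d -> Cmod (g t' - g t) < e).
{ intros t e He. assert (P := Cmod_ge_0 (y - x)).
  exists (e / (Cmod (y - x) + 1)). split; [apply Rdiv_lt_0_compat; lra|].
  intros t' Ht'. rewrite Hg. apply Rlt_div_r in Ht'; [|lra]. generalize (Rabs_pos (t' - t)). nra. }
(* [tau] is the first parameter at which the segment meets the shape, so [g tau] is approached from
   outside along the segment itself. *)
destruct (completeness (fun t => 0 <= t <= 1 /\ forall s, 0 <= s <= t -> ~ S0 (g s))) as [tau [U1 U2]].
- exists 1. intros t [Ht _]. lra.
- exists 0. split; [lra|]. intros s Hs. replace s with 0 by lra. unfold g.
  replace (x + RtoC 0 * (y - x))%C with x by ring. exact Hx.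
- assert (T0 : 0 <= tau).
  { apply U1. split; [lra|]. intros s Hs. replace s with 0 by lra. unfold g.
    replace (x + RtoC 0 * (y - x))%C with x by ring. exact Hx. }
  assert (T1 : tau <= 1) by (apply U2; intros t [Ht _]; lra).
  assert (Hbelow : forall t, 0 <= t < tau -> ~ S0 (g t)).
  { intros t Ht HS. assert (tau <= t); [|lra]. apply U2. intros s [Hs1 Hs2].
    apply Rnot_lt_le. intros hlt. apply (Hs2 t); auto. lra. }
  assert (HS : S0 (g tau)).
  { apply NNPP. intros Hn.
    destruct (compact_set_closed S0 (g tau) (proj1 hS0) Hn) as [e [He H]].
    destruct (Hc tau e He) as [d [Hd Hd']].
    assert (Hlt : tau < 1).
    { destruct (Rle_lt_or_eq_dec _ _ T1) as [h|h]; auto. exfalso. apply Hn. rewrite h. unfold g.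
      replace (x + RtoC 1 * (y - x))%C with y by ring. exact Hy. }
    set (t := Rmin 1 (tau + d / 2)).
    assert (t1 : t <= 1) by apply Rmin_l. assert (t2 : t <= tau + d / 2) by apply Rmin_r.
    assert (t3 : tau < t) by (apply Rmin_glb_lt; lra).
    assert (t <= tau); [|lra]. apply U1. split; [lra|]. intros s Hs.
    destruct (Rlt_dec s tau); [apply Hbelow; lra|]. apply H, Hd'. rewrite Rabs_pos_eq; lra. }
  exists tau. split; [lra|]. split; [exact HS|]. intros e He.
  destruct (Hc tau e He) as [d [Hd Hd']].
  assert (Hpos : 0 < tau).
  { destruct (Rle_lt_or_eq_dec _ _ T0) as [h|h]; auto. exfalso. apply Hx.
    rewrite <- h in HS. unfold g in HS. replace (x + RtoC 0 * (y - x))%C with x in HS by ring. exact HS. }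
  set (t := Rmax 0 (tau - d / 2)).
  assert (t1 : 0 <= t) by apply Rmax_l. assert (t2 : tau - d / 2 <= t) by apply Rmax_r.
  assert (t3 : t < tau) by (apply Rmax_lub_lt; lra).
  exists (g t). split; [now apply Hbelow|]. apply Hd'. rewrite Rabs_left; lra.
Qed.

Section CircleBoundary.
Variable T : R.
Hypothesis HT : bdry_lim (fun z => Cmod (f z) ^ 2) T.

(** Exterior points close to [p] are values [f z] with [Cmod z] close to 1, by [near_shape], so
    their squared moduli are close to [T]. *)
Lemma bdry_modulus p : S0 p -> (forall e, 0 < e -> exists u, ~ S0 u /\ Cmod (u - p) < e) ->
  Cmod p ^ 2 = T.
Proof.
intros Hp Hap. apply NNPP. intros Hne.
set (eps := Rabs (T - Cmod p ^ 2) / 2).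
assert (He : 0 < eps).
{ unfold eps. assert (0 < Rabs (T - Cmod p ^ 2)) by (apply Rabs_pos_lt; lra). lra. }
destruct (HT eps He) as [d [Hd H]].
destruct (near_shape S0 f hS0 p d Hp Hd) as [e [He1 H1]].
assert (P := Cmod_ge_0 p).
set (e2 := Rmin 1 (eps / (2 * Cmod p + 1))).
assert (He2 : 0 < e2) by (apply Rmin_pos; [lra|apply Rdiv_lt_0_compat; lra]).
destruct (Hap (Rmin e e2)) as [u [Hu Hup]]; [now apply Rmin_pos|].
assert (M1 := Rmin_l e e2). assert (M2 := Rmin_r e e2).
assert (M3 : e2 <= 1) by apply Rmin_l. assert (M4 : e2 <= eps / (2 * Cmod p + 1)) by apply Rmin_r.
destruct (shape_surj S0 f hS0 u Hu) as [z [Hz <-]].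
specialize (H z Hz (H1 z Hz ltac:(lra))).
assert (X := Cmod_sqr_minus (f z) p).
assert (Q := Cmod_ge_0 (f z - p)).
assert (Y : Cmod (f z - p) * (2 * Cmod p + Cmod (f z - p)) < eps).
{ apply Rle_lt_trans with (Cmod (f z - p) * (2 * Cmod p + 1)); [apply Rmult_le_compat_l; lra|].
  apply Rlt_div_r; lra. }
assert (Z : Rabs (T - Cmod p ^ 2) <= Rabs (Cmod (f z) ^ 2 - Cmod p ^ 2) + Rabs (Cmod (f z) ^ 2 - T)).
{ replace (T - Cmod p ^ 2) with ((Cmod (f z) ^ 2 - Cmod p ^ 2) + - (Cmod (f z) ^ 2 - T)) by ring.
  eapply Rle_trans; [apply Rabs_triang|]. rewrite Rabs_Ropp. lra. }
unfold eps in *. lra.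
Qed.

Lemma segment_modulus x y : ~ S0 x -> S0 y ->
  exists t, 0 <= t <= 1 /\ Cmod (x + RtoC t * (y - x)) = sqrt T.
Proof.
intros Hx Hy. destruct (segment_bdry x y Hx Hy) as [t [Ht [HS Hap]]].
exists t. split; auto. rewrite <- (bdry_modulus _ HS Hap).
rewrite <- Rsqr_pow2. symmetry. apply sqrt_Rsqr, Cmod_ge_0.
Qed.

(** On the ray through [z] a segment from far away down to [z] stays at modulus at least [Cmod z],
    yet has to contain a point of modulus [sqrt T]. The factor [l] puts its starting point beyond
    the bound [M] of the shape. *)
Lemma shape_le_radius z : S0 z -> Cmod z <= sqrt T.
Proof.
intros Hz. apply Rnot_lt_le. intros Hlt.
assert (Hp := sqrt_pos T).
destruct (shape_bounded S0 f hS0) as [M [HM HMb]].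
set (l := 1 + M / Cmod z).
assert (HMz : 0 < M / Cmod z) by (apply Rdiv_lt_0_compat; lra).
destruct (segment_modulus (RtoC l * z) z) as [t [Ht E]]; auto.
- apply HMb. rewrite Cmod_mult, Cmod_R, Rabs_pos_eq by (unfold l; lra).
  unfold l. rewrite Rmult_plus_distr_r. replace (M / Cmod z * Cmod z) with M by (field; lra). lra.
- assert (E1 : (RtoC l * z + RtoC t * (z - RtoC l * z))%C = (RtoC (l + t * (1 - l)) * z)%C).
  { rewrite RtoC_plus, RtoC_mult, RtoC_minus. ring. }
  rewrite E1, Cmod_mult, Cmod_R in E.
  assert (1 <= l + t * (1 - l)) by (unfold l; nra).
  rewrite Rabs_pos_eq in E by lra. nra.
Qed.

(** If the origin were outside, the shape would be contained in the circle of radius [sqrt T]. The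
    exterior, joined to infinity through [f], crosses that circle, and by symmetry at two opposite
    points; this disconnects a shape invariant under the half turn. *)
Lemma zero_in_shape : S0 0%C.
Proof.
apply NNPP. intros H0.
assert (Hcirc : forall s, S0 s -> Cmod s = sqrt T).
{ intros s Hs. apply Rle_antisym; [now apply shape_le_radius|].
  destruct (segment_modulus 0%C s H0 Hs) as [t [Ht E]].
  replace (0 + RtoC t * (s - 0))%C with (RtoC t * s)%C in E by ring.
  rewrite Cmod_mult, Cmod_R, Rabs_pos_eq in E by lra.
  generalize (Cmod_ge_0 s). nra. }
destruct hS0 as [_ [[[[s Hs] Hpath] _] _]].
assert (HR : 0 < sqrt T).
{ rewrite <- (Hcirc s Hs). apply Cmod_gt_0. intros E. apply H0. now rewrite <- E. }
destruct (shape_surj S0 f hS0 0%C H0) as [z0 [Hz0 Ez0]].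
destruct (shape_infty S0 f hS0 (sqrt T)) as [R1 HR1].
unfold Omega in Hz0.
(* The image under [f] of a ray crosses the circle at a point outside the shape. *)
assert (Hray : forall t, 1 <= t -> Omega (RtoC t * z0)).
{ intros t Ht. unfold Omega. rewrite Cmod_mult, Cmod_R, Rabs_pos_eq; nra. }
set (b := Rmax 2 (R1 + 1)).
assert (b1 : 2 <= b) by apply Rmax_l. assert (b2 : R1 + 1 <= b) by apply Rmax_r.
destruct (ivt_on (fun t => Cmod (f (RtoC t * z0)) - sqrt T) 1 b) as [t [Ht E]].
{ lra. }
{ intros t Ht eps He.
  assert (Hc := cdiff_continuous _ _ (shape_holo S0 f hS0 _ (Hray t (proj1 Ht)))).
  destruct (proj1 (locally_Cmod _ _) (proj1 (continuous_Cmod _ _) Hc eps He)) as [d [Hd H]].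
  exists (d / Cmod z0). split; [apply Rdiv_lt_0_compat; lra|]. intros t' _ Ht'.
  replace (Cmod (f (RtoC t' * z0)) - sqrt T - (Cmod (f (RtoC t * z0)) - sqrt T)) with
    (Cmod (f (RtoC t' * z0)) - Cmod (f (RtoC t * z0))) by ring.
  eapply Rle_lt_trans; [apply Cmod_abs_minus|]. apply H.
  replace (RtoC t' * z0 - RtoC t * z0)%C with (RtoC (t' - t) * z0)%C by (rewrite RtoC_minus; ring).
  rewrite Cmod_mult, Cmod_R. apply Rlt_div_r in Ht'; lra. }
{ replace (RtoC 1 * z0)%C with z0 by ring. rewrite Ez0, Cmod_0. lra. }
{ specialize (HR1 (RtoC b * z0)%C (Hray b ltac:(lra))).
  rewrite Cmod_mult, Cmod_R, Rabs_pos_eq in HR1 by lra. specialize (HR1 ltac:(nra)). lra. }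
set (p := f (RtoC t * z0)) in *.
assert (Hp : ~ S0 p) by (apply (shape_ext S0 f hS0), Hray; lra).
assert (Hpm : Cmod p = sqrt T) by lra.
(* The line through [p] and [-p] then separates [s] from [-s] within the shape. *)
set (L := fun x => Im (Cconj p * x)).
assert (HL : forall x, S0 x -> L x <> 0).
{ intros x Hx E0. assert (Hxm := Hcirc x Hx).
  assert (E1 : (Cconj p * x)%C = RtoC (Re (Cconj p * x))).
  { apply injective_projections; [reflexivity|exact E0]. }
  set (m := Re (Cconj p * x)) in *.
  assert (Em : Rabs m = sqrt T * sqrt T).
  { rewrite <- Cmod_R, <- E1, Cmod_mult, Cmod_conj, Hpm, Hxm. reflexivity. }
  assert (Ex : (RtoC (sqrt T * sqrt T) * x = RtoC m * p)%C).
  { rewrite <- E1. replace (sqrt T * sqrt T) with (Cmod p ^ 2) by (rewrite Hpm; ring).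
    rewrite Cmod2_conj. ring. }
  assert (Hq : RtoC (sqrt T * sqrt T) <> 0%C) by (intros E2; apply RtoC_inj in E2; nra).
  assert (Exx : x = (RtoC m * p / RtoC (sqrt T * sqrt T))%C) by (rewrite <- Ex; field; auto).
  unfold Rabs in Em. destruct (Rcase_abs m).
  - apply Hp. apply shape_half_turn. replace (- p)%C with x; auto.
    rewrite Exx, <- Em, RtoC_opp. field. intros E3. apply RtoC_inj in E3. lra.
  - apply Hp. replace p with x; auto. rewrite Exx, <- Em. field.
    intros E3. apply RtoC_inj in E3. nra. }
assert (Hsep : forall a c, S0 a -> S0 c -> L a < 0 -> 0 < L c -> False).
{ intros a c Ha Hc La Lc. destruct (Hpath a c Ha Hc) as [g [[Hg1 Hg2] [Ega Egc]]].
  destruct (ivt_on (fun t => L (g t)) 0 1) as [v [Hv Ev]].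
  - lra.
  - intros v Hv eps He.
    assert (HP : locally (g v) (fun y => Cmod (y - g v) < eps / sqrt T)).
    { apply locally_Cmod. exists (eps / sqrt T). split; [now apply Rdiv_lt_0_compat|auto]. }
    assert (Hgv := Hg1 v Hv _ HP). unfold within, filtermap in Hgv.
    destruct (proj1 (locally_R _ _) Hgv) as [d [Hd H]].
    exists d. split; auto. intros v' Hv' Hvv. specialize (H v' Hvv Hv').
    unfold L. eapply Rle_lt_trans; [apply Im_le_Cmod_minus|].
    replace (Cconj p * g v' - Cconj p * g v)%C with (Cconj p * (g v' - g v))%C by ring.
    rewrite Cmod_mult, Cmod_conj, Hpm, Rmult_comm. apply Rlt_div_r in H; lra.
  - now rewrite Ega.
  - now rewrite Egc.
  - apply (HL (g v)); auto. }
assert (Hms : S0 (- s)) by (now apply shape_half_turn).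
assert (Ls : L (- s)%C = - L s) by (unfold L, Im; simpl; ring).
destruct (Rtotal_order (L s) 0) as [h|[h|h]].
- apply (Hsep s (- s)%C); auto. lra.
- now apply (HL s).
- apply (Hsep (- s)%C s); auto. lra.
Qed.

(** A segment from a point of the open disc to the origin never reaches modulus [sqrt T], so that
    point cannot be outside the shape. Closedness adds the bounding circle. *)
Lemma circle_bdry_disk : is_disk S0.
Proof.
assert (H0 := zero_in_shape). exists 0%C, (sqrt T). intros z.
replace (z - 0)%C with z by ring. split; [apply shape_le_radius|].
assert (Hin : forall z, Cmod z < sqrt T -> S0 z).
{ intros y Hy. apply NNPP. intros Hn.
  destruct (segment_modulus y 0%C Hn H0) as [t [Ht E]].
  replace (y + RtoC t * (0 - y))%C with (RtoC (1 - t) * y)%C in E by (rewrite RtoC_minus; ring).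
  rewrite Cmod_mult, Cmod_R, Rabs_pos_eq in E by lra.
  generalize (Cmod_ge_0 y). nra. }
intros Hz. apply NNPP. intros Hn.
assert (Hzz : z <> 0%C) by (intros ->; auto).
apply Cmod_gt_0 in Hzz.
destruct (compact_set_closed S0 z (proj1 hS0) Hn) as [e [He H]].
set (d := Rmin 1 (e / (2 * Cmod z))).
assert (Hd : 0 < d) by (apply Rmin_pos; [lra|apply Rdiv_lt_0_compat; lra]).
assert (d1 : d <= 1) by apply Rmin_l.
assert (d2 : d * Cmod z <= e / 2).
{ apply Rle_trans with (e / (2 * Cmod z) * Cmod z); [apply Rmult_le_compat_r; [lra|apply Rmin_r]|].
  right. field. lra. }
apply (H (RtoC (1 - d) * z)%C).
- replace (RtoC (1 - d) * z - z)%C with (- (RtoC d * z))%C by (rewrite RtoC_minus; ring).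
  rewrite Cmod_opp, Cmod_mult, Cmod_R, Rabs_pos_eq; lra.
- apply Hin. rewrite Cmod_mult, Cmod_R, Rabs_pos_eq by lra. nra.
Qed.
End CircleBoundary.

Hypothesis hdisk : ~ is_disk S0.

Lemma rotation_nonzero eta om R1 : om <> 0 -> potential S0 f eta 0 om ->
  exists u, R1 < Cmod u /\ eta u <> 0%C.
Proof.
intros Hom [Hd [Hl [K HB]]]. apply NNPP. intros Hno.
assert (Hz : forall u, R1 < Cmod u -> eta u = 0%C).
{ intros u Hu. apply NNPP. intros h. apply Hno. eauto. }
set (G := fun z => eta (f z)).
assert (HGd : forall z, 1 < Cmod z -> cdiff G z) by exact (potential_comp_cdiff S0 f hS0 eta Hd).
assert (HGl : lim_infty G 0) by (now apply (potential_comp_lim S0 f hS0)).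
destruct (shape_infty S0 f hS0 R1) as [R2 HR2].
set (s := ln (Rmax 1 R2 + 1)).
assert (m1 := Rmax_l 1 R2). assert (m2 := Rmax_r 1 R2).
assert (Es : exp s = Rmax 1 R2 + 1) by (apply exp_ln; lra).
assert (HG : forall z, 1 < Cmod z -> G z = 0%C).
(* An identity theorem: vanishing on one large circle kills all coefficients, hence [G] on all of
   [Omega]. *)
{ apply (laurent_zero G 1 Rlt_0_1 HGd HGl s); [lra|]. intros n.
  rewrite (lcoef_ext G (fun _ => RtoC 0)).
  - rewrite lcoef_cst. now destruct (Z.eqb _ _).
  - intros u Hu. apply Hz. apply HR2; [unfold Omega|]; lra. }
(* With [G = 0] the boundary condition says that [om / 2 * Cmod (f z) ^ 2] tends to [K]. *)
apply hdisk. apply (circle_bdry_disk (2 * K / om)).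
intros eps He.
assert (Ho : 0 < Rabs om) by now apply Rabs_pos_lt.
destruct (HB (eps * Rabs om / 2)) as [d [Hd0 H]]; [nra|].
exists d. split; auto. intros z Hz1 Hzd. specialize (H z Hz1 Hzd).
fold (G z) in H. rewrite HG in H by exact Hz1.
replace (Im 0 - Im (Cconj 0 * f z) + om / 2 * Cmod (f z) ^ 2 - K) with
  (om / 2 * (Cmod (f z) ^ 2 - 2 * K / om)) in H.
- rewrite Rabs_mult in H. unfold Rdiv at 1 in H. rewrite Rabs_mult, (Rabs_pos_eq (/ 2)) in H by lra.
  nra.
- unfold Im; simpl. field. auto.
Qed.

(** At large distance [eta] is even, since its difference with its half turn is a potential at rest.
    Comparing leading terms at [u] and [- u] gives [(-1) ^ p = 1], and then the next coefficient
    equals its own opposite. *)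
Lemma rotation_expansion eta om : om <> 0 -> potential S0 f eta 0 om ->
  exists (p : nat) (b : C), (1 <= p)%nat /\ b <> 0%C /\
    lim_infty (fun u => u ^ p * eta u)%C b /\
    lim_infty (fun u => u * (u ^ p * eta u - b))%C 0.
Proof.
intros Hom Hp.
destruct (potential_exterior_cdiff _ _ _ Hp) as [R1 [HR1 Hd]].
destruct (laurent_leading eta R1 HR1 Hd (proj1 (proj2 Hp)) (rotation_nonzero eta om R1 Hom Hp))
  as [p [b [b' [Hp1 [Hb [L1 L2]]]]]].
exists p, b. split; auto. split; auto. split; auto.
assert (HD : potential S0 f (fun u => RtoC 1 * eta u + RtoC (-1) * eta (- u))%C 0 0).
{ refine (potential_ext S0 f _ _ _ _ _ _ (fun u => eq_refl) _ _
    (potential_lin S0 f 1 (-1) _ _ _ _ _ _ Hp (potential_half_turn _ _ _ Hp))).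
  - apply injective_projections; simpl; ring.
  - ring. }
destruct (shape_bounded S0 f hS0) as [M [HM HMb]].
assert (Heven : forall u, M < Cmod u -> eta (- (1) * u)%C = eta u).
{ intros u Hu. assert (E := potential_zero S0 f hS0 _ HD u (HMb u Hu)). cbv beta in E.
  replace (- (1) * u)%C with (- u)%C by ring.
  replace (eta (- u)%C) with (eta u - (RtoC 1 * eta u + RtoC (-1) * eta (- u)))%C
    by (apply injective_projections; simpl; ring).
  rewrite E. ring. }
assert (Hm1 : Cmod (- (1)) = 1) by apply Cmod_m1.
assert (Hpow : forall u : C, ((- (1) * u) ^ p = (- (1)) ^ p * u ^ p)%C) by (intros; apply Cpow_mult_l).
set (sg := ((- (1)) ^ p)%C) in *.
assert (Lb : lim_infty (fun u => u ^ p * eta u)%C (sg * b)%C).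
{ assert (Lr := lim_infty_rot _ _ _ Hm1 L1). cbv beta in Lr.
  apply (lim_infty_ext (fun u => sg * ((- (1) * u) ^ p * eta (- (1) * u)))%C _ _ M).
  - intros u Hu. rewrite Heven, Hpow by auto.
    assert (Esg : (sg * sg = 1)%C).
    { unfold sg. rewrite <- Cpow_mult_l. replace (- (1) * - (1))%C with (RtoC 1) by ring. apply Cpow_1_l. }
    replace (sg * (sg * u ^ p * eta u))%C with ((sg * sg) * (u ^ p * eta u))%C by ring. rewrite Esg. ring.
  - now apply lim_infty_scal. }
assert (Esb : sg = 1%C).
{ assert (E := lim_infty_unique _ _ _ Lb L1).
  replace sg with (sg * b / b)%C by (field; auto). rewrite E. field; auto. }
assert (L3 : lim_infty (fun u => u * (u ^ p * eta u - b))%C (- b')%C).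
{ assert (Lr := lim_infty_rot _ _ _ Hm1 L2). cbv beta in Lr.
  apply (lim_infty_eq _ (- (1) * b')%C); [ring|].
  apply (lim_infty_ext (fun u => - (1) * ((- (1) * u) * ((- (1) * u) ^ p * eta (- (1) * u) - b)))%C _ _ M).
  - intros u Hu. rewrite Heven, Hpow, Esb by auto. ring.
  - now apply lim_infty_scal. }
assert (E := lim_infty_unique _ _ _ L2 L3).
assert (Eb' : b' = 0%C).
{ assert (E2 : (RtoC 2 * b' = 0)%C).
  { replace (RtoC 2 * b')%C with (b' - - b')%C by (apply injective_projections; simpl; ring).
    rewrite <- E. ring. }
  assert (H2 : RtoC 2 <> 0%C) by (intros E'; apply RtoC_inj in E'; lra).
  replace b' with (RtoC 2 * b' / RtoC 2)%C by (field; auto). rewrite E2. field; auto. }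
now rewrite <- Eb'.
Qed.

(** By uniqueness both potentials are real multiples of a potential [m] of unit angular velocity,
    hence share [p] and [b]. Such an [m] is obtained by dividing whichever of the two has a nonzero
    angular velocity. *)
Lemma rotation_pair eta1 om1 eta2 om2 : om1 <> 0 \/ om2 <> 0 ->
  potential S0 f eta1 0 om1 -> potential S0 f eta2 0 om2 ->
  exists (p : nat) (b : C), (1 <= p)%nat /\ b <> 0%C /\
    (lim_infty (fun u => u ^ p * eta1 u)%C (RtoC om1 * b)%C /\
     lim_infty (fun u => u * (u ^ p * eta1 u - RtoC om1 * b))%C 0) /\
    (lim_infty (fun u => u ^ p * eta2 u)%C (RtoC om2 * b)%C /\
     lim_infty (fun u => u * (u ^ p * eta2 u - RtoC om2 * b))%C 0).
Proof.
intros Hom H1 H2.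
assert (Hm : exists m, potential S0 f m 0 1).
{ assert (Hsc : forall eta om, om <> 0 -> potential S0 f eta 0 om -> exists m, potential S0 f m 0 1).
  { intros eta om Ho H. eexists.
    refine (potential_ext S0 f _ _ _ _ _ _ (fun u => eq_refl) _ _
      (potential_lin S0 f (/ om) 0 _ _ _ _ _ _ H H)).
    - ring.
    - field; auto. }
  destruct Hom as [h|h]; eapply Hsc; eauto. }
destruct Hm as [m Hm].
destruct (rotation_expansion m 1 ltac:(lra) Hm) as [p [b [Hp [Hb [L1 L2]]]]].
exists p, b. split; auto. split; auto.
destruct (shape_bounded S0 f hS0) as [M [HM HMb]].
assert (Hgen : forall eta om, potential S0 f eta 0 om ->
  lim_infty (fun u => u ^ p * eta u)%C (RtoC om * b)%C /\
  lim_infty (fun u => u * (u ^ p * eta u - RtoC om * b))%C 0).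
{ intros eta om H.
  assert (HD : potential S0 f (fun u => RtoC 1 * eta u + RtoC (- om) * m u)%C 0 0).
  { refine (potential_ext S0 f _ _ _ _ _ _ (fun u => eq_refl) _ _
      (potential_lin S0 f 1 (- om) _ _ _ _ _ _ H Hm)).
    - ring.
    - ring. }
  assert (E : forall u, M < Cmod u -> eta u = (RtoC om * m u)%C).
  { intros u Hu. assert (E := potential_zero S0 f hS0 _ HD u (HMb u Hu)). cbv beta in E.
    replace (eta u) with ((RtoC 1 * eta u + RtoC (- om) * m u) + RtoC om * m u)%C
      by (rewrite RtoC_opp; ring).
    rewrite E. ring. }
  split.
  - apply (lim_infty_ext (fun u => RtoC om * (u ^ p * m u))%C _ _ M).
    + intros u Hu. rewrite E by auto. ring.
    + now apply lim_infty_scal.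
  - apply (lim_infty_eq _ (RtoC om * 0)%C); [ring|].
    apply (lim_infty_ext (fun u => RtoC om * (u * (u ^ p * m u - b)))%C _ _ M).
    + intros u Hu. rewrite E by auto. ring.
    + now apply lim_infty_scal. }
split; auto.
Qed.
End Symmetric.

(** * Expansions in the fixed frame and comparison of the two motions *)

Lemma lim_infty_pow h l p : lim_infty h l -> lim_infty (fun u => h u ^ p)%C (l ^ p)%C.
Proof.
intros H. induction p; simpl; [apply lim_infty_const|now apply lim_infty_mult].
Qed.

(** The first-order term of [(1 - r / x) ^ (- p)] is [p r / x]; this is how the position enters the
    expansion. *)
Lemma lim_pow_quot_shift (r : C) (p : nat) :
  lim_infty (fun x => x * ((x / (x - r)) ^ p - 1))%C (RtoC (INR p) * r)%C.
Proof.
induction p.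
- apply (lim_infty_ext (fun _ => RtoC 0) _ _ 0).
  + intros u _. simpl. ring.
  + apply (lim_infty_eq _ 0%C); [simpl; ring|apply lim_infty_const].
- apply (lim_infty_eq _ (1 * (RtoC (INR p) * r) + r * 1)%C).
  { rewrite S_INR, RtoC_plus. ring. }
  apply (lim_infty_ext (fun x => (x / (x - r)) * (x * ((x / (x - r)) ^ p - 1)) + r * (x / (x - r)))%C _ _ (Cmod r)).
  + intros u Hu. simpl. set (q := (u / (u - r))%C).
    assert (Hn : (u - r)%C <> 0%C).
    { intros E. assert (X := Cmod_sub_le u r). rewrite E, Cmod_0 in X. lra. }
    assert (Eq : (r * q = u * (q - 1))%C) by (unfold q; field; auto).
    rewrite Eq. ring.
  + apply lim_infty_plus.
    * apply lim_infty_mult; [apply lim_infty_quot_shift|exact IHp].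
    * apply lim_infty_scal, lim_infty_quot_shift.
Qed.

(** With [v] the coordinate in the solid's frame, [x = q x * (e^(i alpha) * v x)] and [q] tends to
    1. As the second-order term of [eta] vanishes, that of [xi] comes from [q ^ p] alone. *)
Lemma expansion_shift (eta xi : C -> C) (p : nat) (b r : C) (alpha M : R) :
  lim_infty (fun u => u ^ p * eta u)%C b ->
  lim_infty (fun u => u * (u ^ p * eta u - b))%C 0 ->
  (forall x, M < Cmod x -> xi x = eta (Cexpi (- alpha) * (x - r))%C) ->
  lim_infty (fun x => x ^ p * xi x)%C (b * Cexpi alpha ^ p)%C /\
  lim_infty (fun x => x * (x ^ p * xi x - b * Cexpi alpha ^ p))%C
    (RtoC (INR p) * r * (b * Cexpi alpha ^ p))%C.
Proof.
intros H1 H2 Hxi.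
set (E := Cexpi alpha). set (k := Cexpi (- alpha)).
assert (HEk : (E * k = 1)%C).
{ unfold E, k. rewrite <- Cexpi_plus, Rplus_opp_r. unfold Cexpi. now rewrite cos_0, sin_0. }
set (v := fun x => (k * (x - r))%C).
assert (Hv : forall h l, lim_infty h l -> lim_infty (fun x => h (v x)) l).
{ intros h l. apply (lim_infty_comp h v). intros R0. exists (R0 + Cmod r). intros u Hu.
  unfold v, k. rewrite Cmod_mult, Cmod_Cexpi. assert (X := Cmod_sub_le u r). lra. }
set (q := fun x => (x / (x - r))%C).
assert (Hq : lim_infty q 1) by apply lim_infty_quot_shift.
assert (Ex : forall x, Cmod r < Cmod x -> x = (q x * (E * v x))%C).
{ intros x Hx. unfold q, v. replace (E * (k * (x - r)))%C with (E * k * (x - r))%C by ring.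
  rewrite HEk. field. intros E0. assert (X := Cmod_sub_le x r). rewrite E0, Cmod_0 in X. lra. }
assert (Exp : forall x, Cmod r < Cmod x -> (x ^ p = q x ^ p * (E ^ p * v x ^ p))%C).
{ intros x Hx. rewrite <- !Cpow_mult_l. now rewrite <- Ex. }
split.
- apply (lim_infty_eq _ (1 ^ p * (E ^ p * b))%C); [rewrite Cpow_1_l; ring|].
  apply (lim_infty_ext (fun x => q x ^ p * (E ^ p * (v x ^ p * eta (v x))))%C _ _ (Rmax M (Cmod r))).
  + intros x Hx. assert (m1 := Rmax_l M (Cmod r)). assert (m2 := Rmax_r M (Cmod r)).
    rewrite (Hxi x) by lra. fold k. fold (v x). rewrite (Exp x) by lra. ring.
  + apply lim_infty_mult; [now apply lim_infty_pow|]. apply lim_infty_scal. 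
    exact (Hv (fun u => u ^ p * eta u)%C b H1).
- apply (lim_infty_eq _ (1 * 1 ^ p * (E * E ^ p * 0) + RtoC (INR p) * r * (b * E ^ p))%C); [ring|].
  apply (lim_infty_ext (fun x => q x * q x ^ p * (E * E ^ p * (v x * (v x ^ p * eta (v x) - b))) +
     x * (q x ^ p - 1) * (b * E ^ p))%C _ _ (Rmax M (Cmod r))).
  + intros x Hx. assert (m1 := Rmax_l M (Cmod r)). assert (m2 := Rmax_r M (Cmod r)).
    rewrite (Hxi x) by lra. fold k. fold (v x). rewrite (Exp x) by lra.
    transitivity ((q x * (E * v x)) * (q x ^ p * (E ^ p * (v x ^ p * eta (v x) - b))) + x * (q x ^ p - 1) * (b * E ^ p))%C; [ring|].
    rewrite <- (Ex x) by lra. ring.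
  + apply lim_infty_plus.
    * apply lim_infty_mult.
      { apply lim_infty_mult; [exact Hq|now apply lim_infty_pow]. }
      apply lim_infty_scal. exact (Hv (fun u => u * (u ^ p * eta u - b))%C 0%C H2).
    * apply lim_infty_mult; [apply lim_pow_quot_shift|apply lim_infty_const].
Qed.

Theorem mainTheorem3 (S0 : C -> Prop) (f : C -> C)
  (hS0 : shape S0 f)
  (hsym : forall z : C, rigid_image (PI / 2) 0%C S0 z <-> S0 z)
  (hdisk : ~ is_disk S0)
  (r1 r2 w01 w02 : C) (alpha1 alpha2 omega1 omega2 : R)
  (hmove1 : ~ (w01 = 0%C /\ omega1 = 0%R))
  (hmove2 : ~ (w02 = 0%C /\ omega2 = 0%R))
  (xi1 xi2 : C -> C)
  (hxi1 : complex_potential S0 f r1 alpha1 w01 omega1 xi1)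
  (hxi2 : complex_potential S0 f r2 alpha2 w02 omega2 xi2)
  (rad : R) (hrad : (0 < rad)%R)
  (heq : forall z : C, (rad < Cmod z)%R -> xi1 z = xi2 z) :
  r1 = r2 /\
  (w01 * Cexpi alpha1)%C = (w02 * Cexpi alpha2)%C /\
  Rabs omega1 = Rabs omega2.
Proof.
assert (P1 := potential_of_complex S0 f hS0 _ _ _ _ _ hxi1).
assert (P2 := potential_of_complex S0 f hS0 _ _ _ _ _ hxi2).
set (eta1 := fun u => xi1 (Cexpi alpha1 * u + r1)%C) in *.
set (eta2 := fun u => xi2 (Cexpi alpha2 * u + r2)%C) in *.
assert (Hinv : forall a, (Cexpi a * Cexpi (- a) = 1)%C).
{ intros a. rewrite <- Cexpi_plus, Rplus_opp_r. unfold Cexpi. now rewrite cos_0, sin_0. }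
assert (Hne : forall a, Cexpi a <> 0%C).
{ intros a. apply Cmod_gt_0. rewrite Cmod_Cexpi. lra. }
assert (E1 : forall x, xi1 x = eta1 (Cexpi (- alpha1) * (x - r1))%C).
{ intros x. unfold eta1. f_equal. rewrite Cmult_assoc, Hinv. ring. }
assert (E2 : forall x, (rad < Cmod x)%R -> xi1 x = eta2 (Cexpi (- alpha2) * (x - r2))%C).
{ intros x Hx. rewrite heq by auto. unfold eta2. f_equal. rewrite Cmult_assoc, Hinv. ring. }
destruct (potential_expansion S0 f hS0 hsym) as [kappa [Hk Hexp]].
destruct (Hexp _ _ _ P1) as [A1 B1]. destruct (Hexp _ _ _ P2) as [A2 B2].
destruct (expansion_shift eta1 xi1 1 _ r1 alpha1 rad A1 B1 (fun x _ => E1 x)) as [C1 D1].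
destruct (expansion_shift eta2 xi1 1 _ r2 alpha2 rad A2 B2 E2) as [C2 D2].
(* At exponent 1 the coefficient of [xi1] is [- kappa w0 e^(i alpha)] for either motion, even when
   it is zero. *)
assert (HW : (w01 * Cexpi alpha1)%C = (w02 * Cexpi alpha2)%C).
{ assert (X := lim_infty_unique _ _ _ C1 C2). simpl in X.
  transitivity (- (- (kappa * w01) * (Cexpi alpha1 * 1)) / kappa)%C; [field; auto|].
  rewrite X. field; auto. }
assert (Hb : (- (kappa * w02) * Cexpi alpha2 ^ 1 = - (kappa * w01) * Cexpi alpha1 ^ 1)%C).
{ symmetry. exact (lim_infty_unique _ _ _ C1 C2). }
(* Taking moduli discards the unknown phases [e^(i p alpha)]. *)
assert (Hrot : forall (p : nat) (b : C), b <> 0%C ->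
   (RtoC omega1 * b * Cexpi alpha1 ^ p)%C = (RtoC omega2 * b * Cexpi alpha2 ^ p)%C -> Rabs omega1 = Rabs omega2).
{ intros p b Hb0 E. apply (f_equal Cmod) in E.
  rewrite !Cmod_mult, !Cmod_pow, !Cmod_Cexpi, !pow1, !Cmod_R, !Rmult_1_r in E.
  apply Cmod_gt_0 in Hb0. apply Rmult_eq_reg_r with (Cmod b); lra. }
(* Without translation the position is read at the leading exponent of the rotational potential,
   otherwise at exponent 1. *)
destruct (classic (w01 = 0%C)) as [h0|h0].
- assert (h0' : w02 = 0%C).
  { rewrite h0 in HW. replace w02 with (w02 * Cexpi alpha2 / Cexpi alpha2)%C by (field; auto).
    rewrite <- HW. field; auto. }
  assert (o1 : omega1 <> 0%R) by tauto. 
  rewrite h0 in P1. rewrite h0' in P2.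
  destruct (rotation_pair S0 f hS0 hsym hdisk eta1 omega1 eta2 omega2 (or_introl o1) P1 P2)
    as [p [b [Hp [Hb0 [[F1 G1] [F2 G2]]]]]].
  destruct (expansion_shift eta1 xi1 p _ r1 alpha1 rad F1 G1 (fun x _ => E1 x)) as [I1 J1].
  destruct (expansion_shift eta2 xi1 p _ r2 alpha2 rad F2 G2 E2) as [I2 J2].
  assert (X := lim_infty_unique _ _ _ I1 I2).
  rewrite <- X in J2. assert (Y := lim_infty_unique _ _ _ J1 J2).
  split; [|split; [exact HW|now apply (Hrot p b)]].
  set (c := (RtoC omega1 * b * Cexpi alpha1 ^ p)%C) in *.
  assert (Hc : c <> 0%C).
  { apply Cmult_neq_0; [apply Cmult_neq_0; [|auto]|now apply Cpow_nz].
    intros E. apply RtoC_inj in E. auto. }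
  assert (Hn : RtoC (INR p) <> 0%C).
  { intros E. apply RtoC_inj in E. apply INR_eq with (m := 0%nat) in E. lia. }
  transitivity (RtoC (INR p) * r1 * c / (RtoC (INR p) * c))%C; [field; auto|].
  rewrite Y. field; auto.
- rewrite Hb in D2. assert (Y := lim_infty_unique _ _ _ D1 D2).
  set (c := (- (kappa * w01) * Cexpi alpha1 ^ 1)%C) in *.
  assert (Hc : c <> 0%C).
  { apply Cmult_neq_0; [|now apply Cpow_nz]. intros E. apply (Cmult_neq_0 kappa w01 Hk h0).
    replace (kappa * w01)%C with (- - (kappa * w01))%C by ring. rewrite E. ring. }
  assert (Hr : r1 = r2).
  { transitivity (RtoC (INR 1) * r1 * c / c)%C; [simpl; field; auto|].
    rewrite Y. simpl. field; auto. }
  split; [exact Hr|]. split; [exact HW|]. subst r2.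
  destruct (classic (omega1 = 0%R /\ omega2 = 0%R)) as [[-> ->]|ho]; [reflexivity|].
  assert (ho' : omega1 <> 0%R \/ omega2 <> 0%R) by tauto.
  (* The even part has no translational velocity and keeps the angular velocity. *)
  assert (Hev : forall eta w om, potential S0 f eta w om ->
     potential S0 f (fun u => RtoC (/ 2) * eta u + RtoC (/ 2) * eta (- u))%C 0 om).
  { intros eta w om H.
    refine (potential_ext S0 f _ _ _ _ _ _ (fun u => eq_refl) _ _
      (potential_lin S0 f (/ 2) (/ 2) _ _ _ _ _ _ H (potential_half_turn S0 f hS0 hsym _ _ _ H))).
    - ring.
    - field. }
  destruct (rotation_pair S0 f hS0 hsym hdisk _ _ _ _ ho' (Hev _ _ _ P1) (Hev _ _ _ P2))
    as [p [b [Hp [Hb0 [[F1 G1] [F2 G2]]]]]].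
  (* The even part of [xi1] about the position, now known to be common to both motions. It is
     centred at the origin, hence the shift [0] below; beyond [rad + Cmod r1] both arguments have
     modulus larger than [rad]. *)
  set (z := fun y => (RtoC (/ 2) * xi1 (y + r1) + RtoC (/ 2) * xi1 (- y + r1))%C).
  destruct (expansion_shift _ z p _ 0%C alpha1 (rad + Cmod r1) F1 G1) as [I1 _].
  { intros x Hx. unfold z. rewrite !E1.
    replace (Cexpi (- alpha1) * (x + r1 - r1))%C with (Cexpi (- alpha1) * (x - 0))%C by ring.
    replace (Cexpi (- alpha1) * (- x + r1 - r1))%C with (- (Cexpi (- alpha1) * (x - 0)))%C by ring.
    reflexivity. }
  destruct (expansion_shift _ z p _ 0%C alpha2 (rad + Cmod r1) F2 G2) as [I2 _].
  { intros x Hx. assert (X1 := Cmod_sub_le x (- r1)). assert (X2 := Cmod_sub_le (- x) (- r1)).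
    rewrite Cmod_opp in X1. rewrite (Cmod_opp x), (Cmod_opp r1) in X2.
    replace (x - - r1)%C with (x + r1)%C in X1 by ring.
    replace (- x - - r1)%C with (- x + r1)%C in X2 by ring.
    unfold z. rewrite !E2 by lra.
    replace (Cexpi (- alpha2) * (x + r1 - r1))%C with (Cexpi (- alpha2) * (x - 0))%C by ring.
    replace (Cexpi (- alpha2) * (- x + r1 - r1))%C with (- (Cexpi (- alpha2) * (x - 0)))%C by ring.
    reflexivity. }
  apply (Hrot p b Hb0). exact (lim_infty_unique _ _ _ I1 I2).
Qed.
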